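(* Let $n\in\{0,1,2,\dots\}$, let $0\le\beta<1$, and let $\alpha>1$ be real. Let $f(z)=z+\sum_{k=2}^\infty a_kz^k$ belong to the class $T_n^\alpha(\beta)$. Then $$|a_k|\le \frac{2(1-\beta)\alpha^{n-1}}{(\alpha+k-1)^n},\qquad k=2,3,4,\dots$$ These inequalities are sharp: for each $k\ge 2$, equality is attained for the function $f$ (in $T_n^\alpha(\beta)$) satisfying $$\frac{D^nf(z)^\alpha}{\alpha^nz^\alpha}=\frac{1+(1-2\beta)z^{k-1}}{1-z^{k-1}},\qquad z\in E.$$
   Context: Let $E=\{z\in\mathbb{C}: |z|<1\}$ be the open unit disk, and let $A$ be the class of functions $f(z)=z+a_2z^2+a_3z^3+\cdots$ analytic in $E$. $D^n$ ($n\in\{0,1,2,\dots\}$) is the Salagean derivative operator, defined by $D^0g(z)=g(z)$ and $D^ng(z)=D(D^{n-1}g(z))=z[D^{n-1}g(z)]'$ for $n\ge1$. The expression $D^nf(z)^\alpha$ means $D^n$ applied to the function $f(z)^\alpha$. For real $\alpha>0$, $0\le\beta<1$ and $n\in\{0,1,2,\dots\}$, the class $T_n^\alpha(\beta)$ consists of those $f\in A$ which satisfy $$\operatorname{Re}\frac{D^nf(z)^\alpha}{\alpha^nz^\alpha}>\beta,\qquad z\in E.$$ All powers are principal determinations: $f(z)^\alpha=z^\alpha\,(f(z)/z)^\alpha$, where $(f(z)/z)^\alpha$ is the analytic branch taking the value $1$ at $z=0$, so that the quotient $D^nf(z)^\alpha/(\alpha^nz^\alpha)$ is analytic with value $1$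 at $z=0$. *)

(* Defs.v *)
From Stdlib Require Export Reals.
From Coquelicot Require Export Coquelicot.

Open Scope R_scope.

Definition unit_disk (z : C) : Prop := Cmod z < 1.

Definition slit_disk (z : C) : Prop := unit_disk z /\ ~ (Im z = 0 /\ Re z <= 0).

(* Complex differentiability; meant for open U. *)
Definition analytic_on (U : C -> Prop) (g : C -> C) : Prop :=
  forall z : C, U z -> ex_derive (K := C_AbsRing) (V := C_NormedModule) g z.

Definition has_expansion (f : C -> C) (a : nat -> C) : Prop :=
  forall z : C, unit_disk z ->
    is_pseries (K := C_AbsRing) (V := C_NormedModule) a z (f z).

Definition class_A (f : C -> C) : Prop :=
  analytic_on unit_disk f /\
  exists a : nat -> C, a 0%nat = 0 /\ a 1%nat = 1 /\ has_expansion f a.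

Definition Cexp (z : C) : C := (exp (Re z) * cos (Im z), exp (Re z) * sin (Im z)).

(* For z <> 0 this is the argument of z in (-PI, PI]. *)
Definition Carg (z : C) : R :=
  if Rle_dec 0 (Im z) then acos (Re z / Cmod z) else - acos (Re z / Cmod z).

Definition Cln (z : C) : C := (ln (Cmod z), Carg z).

Definition Cpowr (z : C) (alpha : R) : C := Cexp (alpha * Cln z)%C.

(* C_derive is total; it is the complex derivative wherever g is complex
   differentiable. *)
Fixpoint salagean (n : nat) (g : C -> C) : C -> C :=
  match n with
  | O => g
  | S m => fun z => (z * C_derive (salagean m g) z)%C
  end.

(* l is the analytic logarithm of f(z)/z on the disk vanishing at 0, so that
   Cexp (alpha * l z) is the analytic branch of (f(z)/z)^alpha equal to 1 at 0. *)
Definition log_branch (f l : C -> C) : Prop :=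
  analytic_on unit_disk l /\ l 0 = 0 /\
  forall z : C, unit_disk z -> f z = (z * Cexp (l z))%C.

Definition fpow (l : C -> C) (alpha : R) : C -> C :=
  fun z => (Cpowr z alpha * Cexp (alpha * l z))%C.

(* Q is the analytic function D^n f^alpha / (alpha^n z^alpha) on the disk.  As
   z^alpha is discontinuous across the negative real axis, the quotient is
   formed on the slit disk, and Q is its analytic extension. *)
Definition salagean_quotient (n : nat) (alpha : R) (f Q : C -> C) : Prop :=
  analytic_on unit_disk Q /\ Q 0 = 1 /\
  exists l : C -> C, log_branch f l /\
    forall z : C, slit_disk z ->
      Q z = (salagean n (fpow l alpha) z / (RtoC alpha ^ n * Cpowr z alpha))%C.

Definition class_T (n : nat) (alpha beta : R) (f : C -> C) : Prop :=
  class_A f /\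
  exists Q : C -> C, salagean_quotient n alpha f Q /\
    forall z : C, unit_disk z -> Re (Q z) > beta.

Definition extremal_quotient (beta : R) (k : nat) (z : C) : C :=
  ((1 + (1 - 2 * beta) * z ^ (k - 1)) / (1 - z ^ (k - 1)))%C.

(* For n = 0 the power alpha^(n-1) is 1/alpha, hence the integer exponent. *)
Definition coeff_bound (n : nat) (alpha beta : R) (k : nat) : R :=
  2 * (1 - beta) * powerRZ alpha (Z.of_nat n - 1) / (alpha + INR k - 1) ^ n.

(* Main.v *)
(* Put c = 1/alpha, theta = z d/dz and G = (f/z)^alpha = 1 + sum g_m z^m.  Then
   D^n f^alpha / (alpha^n z^alpha) = (1 + theta/alpha)^n G, so that
   g_m = (1 - beta) w_m p_m with w_m = (alpha / (alpha + m))^n and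
   1 + sum p_m z^m of positive real part, while f/z = G^c.  Since 0 < c < 1, G^c is a
   Beta mixture of the reciprocals 1/(1 + rho (G - 1)), 0 < rho < 1, and it suffices
   to bound the k-th coefficient of 1/(1 + rho sum w_m p_m z^m) by 2 rho w_k.
   This follows by testing the positive Toeplitz form of p, after Schur
   multiplication, on the coefficients of the reciprocal: the kernel
   w_(i-j) / (w_i w_(k-j)), j <= i <= k, is a positive Schur multiplier, being the n-th
   power of (alpha + k)/alpha + j (k - i) / (alpha (alpha + i - j)), where j (k - i) is
   the covariance of a Brownian bridge and 1 / (alpha + d) is a convex sequence.
   The coefficients of G and of the quotient are taken as Fourier coefficients on
   circles |z| = r, and r tends to 1.  The extremal function is built from its
   power series, which converges on the disk by the same coefficient bound. *)
Require Import Defs.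
From Stdlib Require Import Bool ZArith Lia Lra Psatz.

(** The factor rho in the bound on the reciprocals is what makes the mixture work. With X = G - 1
    and E the mean for the Beta law, (1 + X)^c = 1 + c E[X / (1 + rho X)], and X / (1 + rho X) = (1
    - 1 / (1 + rho X)) / rho. The division by rho cancels the linear factor, and c = 1/alpha is the
    one in the claimed bound. The density x^(-c) (1 - x)^c is integrable at 0 because c < 1.
    Bounding the terms of the binomial expansion of G^c one by one would lose the constant; each
    reciprocal is instead controlled through a single triangular linear system.

    G and the quotient are known only as complex differentiable functions, so their coefficients
    need a calculus of their own. Integration by parts in the angle turns theta into multiplication
    by the index, differentiation in the radius shows that a coefficient is a constant times r^m,
    and continuity at 0 then removes the negative indices.

    For the extremal function a logarithm of G is needed, hence a convergent 1/G; the case rho = 1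
    of the reciprocal bound provides it. *)

Fixpoint csum (f : nat -> C) (n : nat) : C :=
  match n with O => 0 | S m => csum f m + f m end%C.

Lemma RtoC_neq_0 (x : R) : x <> 0 -> RtoC x <> 0.
Proof. intros Hx K. apply Hx, RtoC_inj, K. Qed.

Lemma csum_ext (f g : nat -> C) (n : nat) :
  (forall i, (i < n)%nat -> f i = g i) -> csum f n = csum g n.
Proof.
  induction n as [|n IH]; intros H; simpl; [reflexivity|].
  rewrite IH by (intros; apply H; lia). rewrite H by lia. reflexivity.
Qed.

Lemma csum_plus (f g : nat -> C) (n : nat) :
  csum (fun i => f i + g i)%C n = (csum f n + csum g n)%C.
Proof. induction n as [|n IH]; simpl; [|rewrite IH]; ring. Qed.

Lemma csum_scal (c : C) (f : nat -> C) (n : nat) :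
  csum (fun i => c * f i)%C n = (c * csum f n)%C.
Proof. induction n as [|n IH]; simpl; [|rewrite IH]; ring. Qed.

Lemma csum_0 (f : nat -> C) (n : nat) :
  (forall i, (i < n)%nat -> f i = 0) -> csum f n = 0.
Proof.
  induction n as [|n IH]; intros H; simpl; [reflexivity|].
  rewrite IH by (intros; apply H; lia). rewrite H by lia. ring.
Qed.

Lemma csum_head (f : nat -> C) (n : nat) :
  csum f (S n) = (f O + csum (fun i => f (S i)) n)%C.
Proof.
  induction n as [|n IH]; [simpl; ring|].
  change (csum f (S (S n))) with (csum f (S n) + f (S n))%C.
  rewrite IH. simpl. ring.
Qed.

Lemma csum_single (f : nat -> C) (n k : nat) :
  (k < n)%nat -> (forall i, (i < n)%nat -> i <> k -> f i = 0) -> csum f n = f k.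
Proof.
  induction n as [|n IH]; intros Hk H; [lia|]. simpl.
  destruct (Nat.eq_dec k n) as [->|Hne].
  - rewrite csum_0 by (intros; apply H; lia). ring.
  - rewrite IH by (try lia; intros; apply H; lia). rewrite (H n) by lia. ring.
Qed.

Lemma csum_rev (f : nat -> C) (n : nat) :
  csum f n = csum (fun i => f (n - 1 - i)%nat) n.
Proof.
  induction n as [|n IH]; [reflexivity|].
  rewrite (csum_head (fun i => f (S n - 1 - i)%nat)).
  change (csum f (S n)) with (csum f n + f n)%C. rewrite IH.
  replace (S n - 1 - 0)%nat with n by lia.
  rewrite Cplus_comm. f_equal. apply csum_ext. intros i Hi. f_equal. lia.
Qed.

(** Interchange of summation over [j <= i < n] with [d = i - j]; it carries the associativity of
    [conv]. *)
Lemma csum_triangle (F : nat -> nat -> C) (n : nat) :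
  csum (fun i => csum (fun j => F i j) (S i)) n =
  csum (fun j => csum (fun d => F (j + d)%nat j) (n - j)) n.
Proof.
  induction n as [|n IH]; [reflexivity|].
  change (csum (fun i => csum (fun j => F i j) (S i)) (S n)) with
    (csum (fun i => csum (fun j => F i j) (S i)) n + csum (fun j => F n j) (S n))%C.
  rewrite IH.
  change (csum (fun j => F n j) (S n)) with (csum (fun j => F n j) n + F n n)%C.
  change (csum (fun j => csum (fun d => F (j + d)%nat j) (S n - j)) (S n)) with
    (csum (fun j => csum (fun d => F (j + d)%nat j) (S n - j)) n
     + csum (fun d => F (n + d)%nat n) (S n - n))%C.
  replace (S n - n)%nat with 1%nat by lia.
  rewrite (csum_ext (fun j => csum (fun d => F (j + d)%nat j) (S n - j))
            (fun j => csum (fun d => F (j + d)%nat j) (n - j) + F n j)%C).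
  - rewrite csum_plus. change (fun j => F n j) with (F n). cbn [csum].
    rewrite Nat.add_0_r. ring.
  - intros j Hj. replace (S n - j)%nat with (S (n - j)) by lia. cbn [csum].
    replace (j + (n - j))%nat with n by lia. reflexivity.
Qed.

Lemma Re_csum_nonneg (f : nat -> C) (n : nat) :
  (forall i, (i < n)%nat -> 0 <= Re (f i)) -> 0 <= Re (csum f n).
Proof.
  induction n as [|n IH]; intros H; simpl csum; [simpl; lra|].
  rewrite re_plus. specialize (IH ltac:(intros; apply H; lia)).
  specialize (H n ltac:(lia)). lra.
Qed.

Lemma Cmod_csum_le (f : nat -> C) (b : R) (n : nat) :
  (forall i, (i < n)%nat -> Cmod (f i) <= b) -> Cmod (csum f n) <= INR n * b.
Proof.
  induction n as [|n IH]; intros H; simpl csum.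
  - rewrite Cmod_0. simpl. lra.
  - rewrite S_INR. eapply Rle_trans; [apply Cmod_triangle|].
    specialize (IH ltac:(intros; apply H; lia)).
    specialize (H n ltac:(lia)). lra.
Qed.

(** * Formal power series *)

Definition conv (a b : nat -> C) (k : nat) : C :=
  csum (fun i => a i * b (k - i)%nat)%C (S k).

Definition theta (a : nat -> C) (k : nat) : C := (INR k * a k)%C.

Lemma conv_comm (a b : nat -> C) (k : nat) : conv a b k = conv b a k.
Proof.
  unfold conv. rewrite csum_rev. apply csum_ext. intros i Hi.
  replace (S k - 1 - i)%nat with (k - i)%nat by lia.
  replace (k - (k - i))%nat with i by lia. ring.
Qed.

Lemma conv_ext (a a' b b' : nat -> C) (k : nat) :
  (forall i, (i <= k)%nat -> a i = a' i) ->
  (forall i, (i <= k)%nat -> b i = b' i) -> conv a b k = conv a' b' k.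
Proof.
  intros Ha Hb. apply csum_ext. intros i Hi. rewrite Ha, Hb by lia. reflexivity.
Qed.

Lemma conv_assoc (a b c : nat -> C) (k : nat) :
  conv (conv a b) c k = conv a (conv b c) k.
Proof.
  unfold conv.
  rewrite (csum_ext _ (fun i => csum (fun j => a j * b (i - j)%nat * c (k - i)%nat)%C (S i))).
  2:{ intros i Hi. rewrite Cmult_comm, <- csum_scal. apply csum_ext. intros; ring. }
  rewrite (csum_triangle (fun i j => a j * b (i - j)%nat * c (k - i)%nat)%C).
  apply csum_ext. intros j Hj. rewrite <- csum_scal.
  replace (S k - j)%nat with (S (k - j)) by lia.
  apply csum_ext. intros d Hd. replace (j + d - j)%nat with d by lia.
  replace (k - (j + d))%nat with (k - j - d)%nat by lia. ring.
Qed.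

Lemma conv_left_comm (a b c : nat -> C) (k : nat) :
  conv a (conv b c) k = conv b (conv a c) k.
Proof.
  rewrite <- !conv_assoc. apply conv_ext; [|reflexivity].
  intros; apply conv_comm.
Qed.

Lemma conv_plus_r (a b c : nat -> C) (k : nat) :
  conv a (fun i => b i + c i)%C k = (conv a b k + conv a c k)%C.
Proof.
  unfold conv. rewrite <- csum_plus. apply csum_ext; intros; ring.
Qed.

Lemma conv_scal_r (a b : nat -> C) (c : C) (k : nat) :
  conv a (fun i => c * b i)%C k = (c * conv a b k)%C.
Proof.
  unfold conv. rewrite <- csum_scal. apply csum_ext; intros; ring.
Qed.

Lemma conv_plus_l (a b c : nat -> C) (k : nat) :
  conv (fun i => a i + b i)%C c k = (conv a c k + conv b c k)%C.
Proof. rewrite conv_comm, conv_plus_r. f_equal; apply conv_comm. Qed.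

Lemma conv_scal_l (a b : nat -> C) (c : C) (k : nat) :
  conv (fun i => c * a i)%C b k = (c * conv a b k)%C.
Proof. rewrite conv_comm, conv_scal_r. f_equal; apply conv_comm. Qed.

Lemma theta_conv (a b : nat -> C) (k : nat) :
  theta (conv a b) k = (conv (theta a) b k + conv a (theta b) k)%C.
Proof.
  unfold theta, conv. rewrite <- csum_scal, <- csum_plus. apply csum_ext.
  intros i Hi. replace (INR k) with (INR i + INR (k - i)) at 1.
  - rewrite RtoC_plus. ring.
  - rewrite <- plus_INR. f_equal. lia.
Qed.

(** * Schur multipliers of positive kernels *)

(* Only the entries with [j <= i] of a kernel matter: the form is half of the
   Hermitian form of the kernel completed by [A j i = conj (A i j)]. *)
Definition half_form (K : nat) (A : nat -> nat -> C) (u : nat -> C) : C :=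
  csum (fun i => csum (fun j => A i j * u j * Cconj (u i))%C (S i)) K.

Definition kernel_pos (K : nat) (A : nat -> nat -> C) : Prop :=
  forall u : nat -> C, 0 <= Re (half_form K A u).

(** An operational form of positive semidefiniteness of [V]: sums, products and powers of
    multipliers follow at once, without factorising a kernel. *)
Definition multiplier (K : nat) (V : nat -> nat -> R) : Prop :=
  forall A, kernel_pos K A -> kernel_pos K (fun i j => V i j * A i j)%C.

Lemma half_form_ext (K : nat) (A B : nat -> nat -> C) (u : nat -> C) :
  (forall i j, (j <= i < K)%nat -> A i j = B i j) ->
  half_form K A u = half_form K B u.
Proof.
  intros H. apply csum_ext. intros i Hi. apply csum_ext. intros j Hj.
  rewrite H by lia. reflexivity.
Qed.

Lemma multiplier_ext (K : nat) (V W : nat -> nat -> R) :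
  multiplier K V -> (forall i j, (j <= i < K)%nat -> V i j = W i j) ->
  multiplier K W.
Proof.
  intros HV H A HA u. rewrite (half_form_ext _ _ (fun i j => V i j * A i j)%C).
  - apply HV, HA.
  - intros i j Hij. rewrite H by lia. reflexivity.
Qed.

(** Conjugation by the diagonal matrix of [x], which the test vector absorbs. *)
Lemma multiplier_rank1 (K : nat) (x : nat -> R) :
  multiplier K (fun i j => x i * x j).
Proof.
  intros A HA u. specialize (HA (fun i => x i * u i)%C).
  replace (half_form K _ u) with (half_form K A (fun i => x i * u i)%C); [exact HA|].
  apply csum_ext. intros i Hi. apply csum_ext. intros j Hj.
  rewrite Cmult_conj, RtoC_mult.
  replace (Cconj (x i)) with (RtoC (x i)); [ring|].
  unfold Cconj, RtoC. simpl. f_equal. ring.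
Qed.

Lemma multiplier_plus (K : nat) (V W : nat -> nat -> R) :
  multiplier K V -> multiplier K W -> multiplier K (fun i j => V i j + W i j).
Proof.
  intros HV HW A HA u. specialize (HV A HA u). specialize (HW A HA u).
  replace (half_form K _ u) with
    (half_form K (fun i j => V i j * A i j)%C u
     + half_form K (fun i j => W i j * A i j)%C u)%C.
  - rewrite re_plus. lra.
  - unfold half_form. rewrite <- csum_plus. apply csum_ext. intros i Hi.
    rewrite <- csum_plus. apply csum_ext. intros j Hj. rewrite RtoC_plus. ring.
Qed.

Lemma multiplier_mult (K : nat) (V W : nat -> nat -> R) :
  multiplier K V -> multiplier K W -> multiplier K (fun i j => V i j * W i j).
Proof.
  intros HV HW A HA u.
  rewrite (half_form_ext _ _ (fun i j => V i j * (W i j * A i j))%C).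
  - apply HV, HW, HA.
  - intros. rewrite RtoC_mult. ring.
Qed.

Lemma multiplier_const (K : nat) (c : R) : 0 <= c -> multiplier K (fun _ _ => c).
Proof.
  intros Hc. apply (multiplier_ext _ _ _ (multiplier_rank1 K (fun _ => sqrt c))).
  intros. apply sqrt_sqrt, Hc.
Qed.

Lemma multiplier_pow (K : nat) (V : nat -> nat -> R) (n : nat) :
  multiplier K V -> multiplier K (fun i j => V i j ^ n).
Proof.
  intros HV. induction n as [|n IH]; simpl.
  - apply multiplier_const. lra.
  - apply multiplier_mult; assumption.
Qed.

(** Testing a positive kernel on a basis vector shows that its diagonal entries have nonnegative
    real part. *)
Lemma multiplier_diag (K : nat) (d : nat -> R) :
  (forall i, (i < K)%nat -> 0 <= d i) ->
  multiplier K (fun i j => if Nat.eqb j i then d i else 0).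
Proof.
  intros Hd A HA u. apply Re_csum_nonneg. intros i Hi.
  rewrite (csum_single _ _ i) by
    (try lia; intros j _ Hj; apply Nat.eqb_neq in Hj; rewrite Hj; ring).
  rewrite Nat.eqb_refl.
  assert (Hii : 0 <= Re (A i i)).
  { pose (e := fun l => if Nat.eqb l i then RtoC 1 else RtoC 0).
    assert (He : forall l, l <> i -> e l = 0).
    { intros l Hl. apply Nat.eqb_neq in Hl. unfold e. rewrite Hl. reflexivity. }
    assert (Hi1 : e i = 1) by (unfold e; rewrite Nat.eqb_refl; reflexivity).
    specialize (HA e). unfold half_form in HA.
    rewrite (csum_single _ _ i) in HA; [|exact Hi|].
    - rewrite (csum_single _ _ i) in HA; [|lia|].
      + rewrite Hi1 in HA. revert HA. destruct (A i i). unfold Cconj, Cmult, Re. simpl. lra.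
      + intros l _ Hl. rewrite (He l Hl). ring.
    - intros l _ Hl. apply csum_0. intros j _. rewrite (He l Hl).
      replace (Cconj 0) with (RtoC 0); [ring|].
      unfold Cconj, RtoC. simpl. f_equal. ring. }
  replace (d i * A i i * u i * Cconj (u i))%C
    with ((d i * Cmod (u i) ^ 2)%R * A i i)%C.
  - rewrite re_scal_l. apply Rmult_le_pos; [|exact Hii].
    apply Rmult_le_pos; [apply Hd, Hi|apply pow2_ge_0].
  - rewrite RtoC_mult, Cmod2_conj. ring.
Qed.

Fixpoint rsum (f : nat -> R) (n : nat) : R :=
  match n with O => 0 | S m => rsum f m + f m end.

Lemma multiplier_sum (K : nat) (V : nat -> nat -> nat -> R) (N : nat) :
  (forall s, (s < N)%nat -> multiplier K (V s)) ->
  multiplier K (fun i j => rsum (fun s => V s i j) N).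
Proof.
  induction N as [|N IH]; intros H; simpl.
  - apply multiplier_const. lra.
  - apply multiplier_plus; [apply IH; intros|]; apply H; lia.
Qed.

Lemma rsum_ext (f g : nat -> R) (n : nat) :
  (forall i, (i < n)%nat -> f i = g i) -> rsum f n = rsum g n.
Proof.
  induction n as [|n IH]; intros H; simpl; [reflexivity|].
  rewrite IH by (intros; apply H; lia). rewrite H by lia. reflexivity.
Qed.

Definition ind (b : bool) : R := if b then 1 else 0.

Lemma rsum_ind_interval (a b N : nat) :
  (b <= N)%nat ->
  rsum (fun s => ind (Nat.leb a s) * ind (Nat.ltb s b)) N = INR (b - a).
Proof.
  intros Hb. induction N as [|N IH] in b, Hb |- *.
  { replace (b - a)%nat with 0%nat by lia. reflexivity. }
  cbn [rsum]. destruct (Nat.eq_dec b (S N)) as [->|Hne].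
  - rewrite (rsum_ext _ (fun s => ind (Nat.leb a s) * ind (Nat.ltb s N))).
    2:{ intros s Hs. f_equal. unfold ind.
        destruct (Nat.ltb_spec s (S N)), (Nat.ltb_spec s N); lia || reflexivity. }
    rewrite IH by lia. rewrite (proj2 (Nat.ltb_lt N (S N))) by lia. unfold ind.
    destruct (Nat.leb_spec a N).
    + replace (S N - a)%nat with (S (N - a)) by lia. rewrite S_INR. lra.
    + replace (S N - a)%nat with 0%nat by lia.
      replace (N - a)%nat with 0%nat by lia. simpl. lra.
  - rewrite IH by lia. rewrite (proj2 (Nat.ltb_ge N b)) by lia. unfold ind. lra.
Qed.

Lemma rsum_lin (f g : nat -> R) (c : R) (n : nat) :
  rsum (fun i => f i + c * g i) n = rsum f n + c * rsum g n.
Proof. induction n as [|n IH]; simpl; [|rewrite IH]; ring. Qed.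

(** The truncated difference counts the integers common to [[i, i + s)] and [[j, j + s)], so the
    kernel is a Gram matrix of indicator functions. *)
Lemma multiplier_triangle (K s : nat) :
  multiplier K (fun i j => INR (s - (i - j))).
Proof.
  assert (H := multiplier_sum K
    (fun t i j => (ind (Nat.leb i t) * ind (Nat.ltb t (i + s))) *
                  (ind (Nat.leb j t) * ind (Nat.ltb t (j + s)))) (K + s)
    (fun t _ => multiplier_rank1 K
       (fun i => ind (Nat.leb i t) * ind (Nat.ltb t (i + s))))).
  apply (multiplier_ext _ _ _ H). intros i j Hij.
  replace (s - (i - j))%nat with ((j + s) - i)%nat by lia.
  rewrite <- (rsum_ind_interval i (j + s) (K + s)) by lia.
  apply rsum_ext. intros t Ht. unfold ind.
  destruct (Nat.leb_spec i t), (Nat.ltb_spec t (i + s)),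
    (Nat.leb_spec j t), (Nat.ltb_spec t (j + s)); try lia; lra.
Qed.

(** The vectors [x s], an indicator minus its mean slope, are the increments of a walk pinned at
    both ends. The sum over [s] of [x s i * x s j] is [j (k - i) / k] for [j <= i]. *)
Lemma multiplier_bridge (k : nat) :
  multiplier (S k) (fun i j => INR j * (INR k - INR i)).
Proof.
  destruct k as [|k].
  { apply (multiplier_ext _ _ _ (multiplier_const 1 0 (Rle_refl 0))).
    intros i j Hij. replace j with O by lia. simpl. lra. }
  set (k' := S k). assert (Hk : 0 < INR k') by (apply lt_0_INR; unfold k'; lia).
  pose (x := fun s i => ind (Nat.ltb s i) - INR i / INR k').
  assert (H := multiplier_mult _ _ _ (multiplier_const (S k') (INR k') (Rlt_le _ _ Hk))
    (multiplier_sum (S k') (fun s i j => x s i * x s j) k'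
    (fun s _ => multiplier_rank1 (S k') (x s)))).
  apply (multiplier_ext _ _ _ H). intros i j Hij. cbv beta.
  assert (E : forall b, (b <= k')%nat -> rsum (fun s => ind (Nat.ltb s b)) k' = INR b).
  { intros b Hb. transitivity (INR (b - 0)); [|f_equal; lia].
    rewrite <- (rsum_ind_interval 0 b k') by lia. apply rsum_ext. intros. simpl. ring. }
  assert (E1 : forall n, rsum (fun _ => 1) n = INR n).
  { induction n as [|n IH]; [reflexivity|]. rewrite S_INR. simpl. lra. }
  rewrite (rsum_ext _ (fun s => (ind (Nat.ltb s j) +
     - (INR j / INR k') * ind (Nat.ltb s i)) + - (INR i / INR k') * (ind (Nat.ltb s j)
      + - (INR j / INR k') * 1))).
  - rewrite !rsum_lin, !E, E1 by lia. field. lra.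
  - intros s Hs. unfold x.
    replace (ind (Nat.ltb s j)) with (ind (Nat.ltb s i) * ind (Nat.ltb s j)) at 2; [ring|].
    unfold ind. destruct (Nat.ltb_spec s i), (Nat.ltb_spec s j); try lia; lra.
Qed.

(* A convex sequence is a combination of triangles with weights its second
   differences (summation by parts). *)
Lemma multiplier_convex (K : nat) (phi : nat -> R) :
  (forall d, 0 <= phi d) -> (forall d, phi (S d) <= phi d) ->
  (forall d, 2 * phi (S d) <= phi d + phi (S (S d))) ->
  multiplier K (fun i j => phi (i - j)%nat).
Proof.
  intros H0 H1 H2.
  pose (c := fun s => phi s - 2 * phi (S s) + phi (S (S s))).
  (* The summation by parts stops at [N]: only [d <= S N] occur, so a constant and one more triangle
     carry the remainder and no limit is taken. *)
  assert (E : forall N d, (d <= S N)%nat ->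
    phi d = phi (S N) + (phi N - phi (S N)) * INR (S N - d)
            + rsum (fun s => c s * INR (S s - d)) N).
  { induction N as [|N IH]; intros d Hd.
    - simpl rsum. destruct d as [|d]; [simpl; lra|].
      replace d with O by lia. simpl. lra.
    - change (rsum (fun s => c s * INR (S s - d)) (S N)) with
        (rsum (fun s => c s * INR (S s - d)) N + c N * INR (S N - d)).
      destruct (Nat.eq_dec d (S (S N))) as [->|Hne].
      + rewrite (rsum_ext _ (fun s => 0 + 0 * 0)).
        * rewrite rsum_lin. replace (S (S N) - S (S N))%nat with O by lia.
          replace (S N - S (S N))%nat with O by lia. simpl INR.
          assert (Z : rsum (fun _ => 0) N = 0) by (clear; induction N; simpl; lra).
          rewrite Z. lra.
        * intros s Hs. replace (S s - S (S N))%nat with O by lia. simpl. lra.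
      + rewrite (IH d) at 1 by lia.
        replace (S (S N) - d)%nat with (S (S N - d)) by lia.
        rewrite (S_INR (S N - d)). unfold c. lra. }
  assert (H : multiplier K (fun i j => phi (S K) + (phi K - phi (S K)) * INR (S K - (i - j))
            + rsum (fun s => c s * INR (S s - (i - j))) K)).
  { apply multiplier_plus; [apply multiplier_plus|].
    - apply multiplier_const, H0.
    - apply multiplier_mult; [apply multiplier_const; specialize (H1 K); lra|].
      apply multiplier_triangle.
    - apply (multiplier_sum K (fun s i j => c s * INR (S s - (i - j)))). intros s _.
      apply multiplier_mult; [apply multiplier_const; unfold c; specialize (H2 s); lra|].
      apply multiplier_triangle. }
  apply (multiplier_ext _ _ _ H). intros i j Hij. symmetry. apply E. lia.
Qed.

(** * The reciprocal of a weighted Caratheodory series *)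

Definition wt (alpha : R) (n m : nat) : R := (alpha / (alpha + INR m)) ^ n.

Lemma wt_pos (alpha : R) (n m : nat) : 0 < alpha -> 0 < wt alpha n m.
Proof.
  intros Ha. apply pow_lt, Rdiv_lt_0_compat; [exact Ha|].
  pose proof (pos_INR m). lra.
Qed.

Lemma wt_0 (alpha : R) (n : nat) : 0 < alpha -> wt alpha n 0 = 1.
Proof.
  intros Ha. unfold wt. simpl INR. replace (alpha / (alpha + 0)) with 1 by (field; lra).
  apply pow1.
Qed.

Lemma wt_le_1 (alpha : R) (n m : nat) : 0 < alpha -> wt alpha n m <= 1.
Proof.
  intros Ha. rewrite <- (pow1 n). apply pow_incr. pose proof (pos_INR m). split.
  - apply Rlt_le, Rdiv_lt_0_compat; lra.
  - apply Rmult_le_reg_r with (alpha + INR m); [lra|]. field_simplify; lra.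
Qed.

Lemma multiplier_wt_ratio (alpha : R) (n k : nat) :
  0 < alpha ->
  multiplier (S k) (fun i j =>
    wt alpha n (i - j) / (wt alpha n i * wt alpha n (k - j))).
Proof.
  intros Ha.
  assert (H : multiplier (S k) (fun i j =>
    (((alpha + INR k) / alpha) +
     / alpha * (INR j * (INR k - INR i)) * (/ (alpha + INR (i - j)))) ^ n)).
  { apply multiplier_pow, multiplier_plus.
    - apply multiplier_const. pose proof (pos_INR k). apply Rlt_le, Rdiv_lt_0_compat; lra.
    - apply (multiplier_mult _ (fun i j => / alpha * (INR j * (INR k - INR i)))
               (fun i j => / (alpha + INR (i - j)))).
      + apply multiplier_mult; [|apply multiplier_bridge].
        apply multiplier_const, Rlt_le, Rinv_0_lt_compat, Ha.
      + apply (multiplier_convex _ (fun d => / (alpha + INR d))); intros d;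
          rewrite ?S_INR; pose proof (pos_INR d).
        * apply Rlt_le, Rinv_0_lt_compat. lra.
        * apply Rinv_le_contravar; lra.
        * apply Rminus_le_0.
          replace (_ - _) with (2 / ((alpha + INR d) * (alpha + (INR d + 1))
                                     * (alpha + (INR d + 1 + 1)))) by (field; lra).
          apply Rlt_le, Rdiv_lt_0_compat; [lra|].
          apply Rmult_lt_0_compat; [apply Rmult_lt_0_compat|]; lra. }
  (* The decomposition rests on (alpha + i)(alpha + k - j) = (alpha + k)(alpha + i - j) + j (k -
     i). *)
  apply (multiplier_ext _ _ _ H). intros i j Hij. cbv beta. unfold wt.
  assert (D : forall x y : R, x ^ n / y ^ n = (x / y) ^ n).
  { intros x y. unfold Rdiv. rewrite Rpow_mult_distr, pow_inv. reflexivity. }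
  rewrite <- Rpow_mult_distr, D. f_equal.
  rewrite !minus_INR by lia. pose proof (pos_INR j). pose proof (pos_INR i).
  pose proof (le_INR j i ltac:(lia)). pose proof (le_INR i k ltac:(lia)).
  field. lra.
Qed.

Lemma Cconj_R (x : R) : Cconj x = x.
Proof. unfold Cconj, RtoC. simpl. f_equal. ring. Qed.

(* The rows of the convolution equation of [r], tested against [r] with its
   [k]-th entry shifted by [lam], evaluate a form which is positive because
   its kernel is a Schur multiple of [p (i - j)]. *)
Lemma reciprocal_bound (alpha rho : R) (n k : nat) (p r : nat -> C) :
  0 < alpha -> 0 < rho <= 1 -> (1 <= k)%nat ->
  p O = 1 -> kernel_pos (S k) (fun i j => p (i - j)%nat) ->
  r O = 1 ->
  (forall i, (1 <= i <= k)%nat ->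
     r i = (- csum (fun j => (rho * wt alpha n (i - j))%R * p (i - j)%nat * r j) i)%C) ->
  Cmod (r k) <= 2 * rho * wt alpha n k.
Proof.
  intros Ha Hrho Hk Hp0 Hp Hr0 Hr.
  (* The weights in 1 + rho sum w_m p_m z^m. Index 0 escapes the factor [rho], and for this reason
     the diagonal is treated separately below. *)
  pose (tw := fun m => if Nat.eqb m 0 then 1 else rho * wt alpha n m).
  assert (Htw0 : tw O = 1) by reflexivity.
  assert (HtwS : forall m, (0 < m)%nat -> tw m = rho * wt alpha n m).
  { intros [|m] Hm; [lia|reflexivity]. }
  assert (Htw : forall m, 0 < tw m).
  { intros m. unfold tw. destruct (Nat.eqb m 0); [lra|].
    apply Rmult_lt_0_compat; [lra|apply wt_pos, Ha]. }
  assert (Hw := fun m => wt_pos alpha n m Ha).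
  (* Row [i] of the system is scaled by [tw (k - i) / tw i]. Up to the rank-one factor
     [tw (k - i) * tw (k - j)] this leaves the kernel [tw (i - j) / (tw i * tw (k - j))]. *)
  pose (V := fun i j => tw (i - j)%nat * (tw (k - i)%nat / tw i)).
  assert (HV : multiplier (S k) V).
  (* Off the diagonal all indices of [tw] are positive, and the remaining kernel is [/ rho] times
     the ratio of weights. On the diagonal [tw 0 = 1] leaves the excess [d], nonnegative since
     [rho <= 1] and zero at both ends [i = 0] and [i = k]. *)
  { pose (d := fun i => / (tw i * tw (k - i)%nat)
                        - / rho * / (wt alpha n i * wt alpha n (k - i))).
    assert (H : multiplier (S k) (fun i j => (tw (k - i)%nat * tw (k - j)%nat) *
       (/ rho * (wt alpha n (i - j) / (wt alpha n i * wt alpha n (k - j)))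
        + (if Nat.eqb j i then d i else 0)))).
    { apply multiplier_mult; [apply (multiplier_rank1 _ (fun i => tw (k - i)%nat))|].
      apply multiplier_plus.
      - apply multiplier_mult; [|apply multiplier_wt_ratio, Ha].
        apply multiplier_const, Rlt_le, Rinv_0_lt_compat. lra.
      - apply multiplier_diag. intros i Hi. unfold d.
        rewrite <- Rinv_mult. apply (proj1 (Rminus_le_0 _ _)), Rinv_le_contravar.
        + apply Rmult_lt_0_compat; apply Htw.
        + assert (P : 0 < wt alpha n i * wt alpha n (k - i)) by
            (apply Rmult_lt_0_compat; apply Hw).
          unfold tw. destruct (Nat.eqb_spec i 0) as [->|H1].
          * rewrite (proj2 (Nat.eqb_neq (k - 0) 0)) by lia.
            rewrite wt_0 by exact Ha. lra.
          * destruct (Nat.eqb_spec (k - i) 0) as [E|H2].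
            -- rewrite E, wt_0 by exact Ha. lra.
            -- set (P' := wt alpha n i * wt alpha n (k - i)) in *.
               replace (_ * _) with (rho * P' * rho) by (unfold P'; ring).
               rewrite <- (Rmult_1_r (rho * P')) at 2.
               apply Rmult_le_compat_l; [apply Rmult_le_pos|]; lra. }
    apply (multiplier_ext _ _ _ H). intros i j Hij. unfold V.
    pose proof (Htw i). pose proof (Htw (k - i)%nat). pose proof (Htw (k - j)%nat).
    pose proof (Hw i). pose proof (Hw (k - i)%nat). pose proof (Hw (k - j)%nat).
    destruct (Nat.eqb_spec j i) as [->|Hne].
    - unfold d. rewrite Nat.sub_diag, Htw0, wt_0 by exact Ha. field. lra.
    - rewrite (HtwS (i - j)%nat), (HtwS i), (HtwS (k - j)%nat) by lia. field. lra. }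
  destruct (Req_dec (Cmod (r k)) 0) as [E0|Hne].
  { rewrite E0. pose proof (Hw k). nra. }
  assert (Hpos : 0 < Cmod (r k)) by (pose proof (Cmod_ge_0 (r k)); lra).
  (* The form equals [tw k + lam * Cconj (r k + lam) / tw k]; a shift of modulus [tw k] against the
     direction of [r k] turns it into [2 * tw k - Cmod (r k)]. *)
  pose (lam := (- (tw k / Cmod (r k)) * r k)%C).
  pose (u := fun j => if Nat.eqb j k then (r k + lam)%C else r j).
  assert (Hu : forall j, (j < k)%nat -> u j = r j).
  { intros j Hj. unfold u. rewrite (proj2 (Nat.eqb_neq j k)) by lia. reflexivity. }
  assert (Huk : u k = (r k + lam)%C) by (unfold u; rewrite Nat.eqb_refl; reflexivity).
  specialize (HV _ Hp u).
  replace (half_form _ _ u) with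
    (RtoC (tw k) + / tw k * (lam * Cconj (r k + lam)))%C in HV.
  - assert (E : (lam * Cconj (r k + lam))%C
        = RtoC (tw k * (tw k - Cmod (r k)))).
    { unfold lam. rewrite Cplus_conj, Cmult_conj, Copp_conj, <- RtoC_div by lra.
      rewrite Cconj_R.
      transitivity ((- (tw k / Cmod (r k)) * (1 - tw k / Cmod (r k)))%R
                    * (r k * Cconj (r k)))%C.
      - rewrite RtoC_mult, RtoC_minus, RtoC_opp. ring.
      - rewrite <- Cmod2_conj, <- RtoC_mult. f_equal. field. lra. }
    rewrite E, <- RtoC_inv, <- RtoC_mult, <- RtoC_plus in HV by (pose proof (Htw k); lra).
    simpl Re in HV. pose proof (Htw k).
    rewrite HtwS in * by lia.
    replace (_ + _) with (2 * rho * wt alpha n k - Cmod (r k)) in HV; [lra|].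
    field. split; [specialize (Hw k)|]; lra.
  - unfold half_form.
    assert (Hrow : forall i, (i <= k)%nat ->
      csum (fun j => V i j * p (i - j)%nat * u j * Cconj (u i))%C (S i) =
      ((tw (k - i)%nat / tw i)%R * Cconj (u i) *
       (u i + csum (fun j => tw (i - j)%nat * p (i - j)%nat * u j) i))%C).
    { intros i Hi. cbn [csum]. rewrite Cmult_plus_distr_l, <- csum_scal, Cplus_comm.
      f_equal.
      - unfold V. rewrite Nat.sub_diag, Htw0, Hp0, RtoC_mult. ring.
      - apply csum_ext. intros j Hj. unfold V. rewrite RtoC_mult. ring. }
    assert (Hlow : forall i, (1 <= i <= k)%nat ->
      csum (fun j => tw (i - j)%nat * p (i - j)%nat * u j)%C i = (- r i)%C).
    { intros i Hi. rewrite (Hr i Hi).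
      assert (Copp2 : forall z : C, (- - z)%C = z) by (intros; ring).
      rewrite Copp2. apply csum_ext. intros j Hj.
      rewrite HtwS, Hu by lia. reflexivity. }
    change (csum ?f (S k)) with (csum f k + f k)%C.
    (* Rows [1 <= i < k] vanish, since there [u] agrees with [r] and satisfies the recurrence. Row 0
       contributes [tw k], and row [k] feels only the shift. *)
    rewrite (csum_single _ k 0); [|lia|].
    + rewrite !Hrow, (Hlow k) by lia. rewrite Huk, Hu, Hr0 by lia. cbn [csum].
      rewrite Nat.sub_0_r, Nat.sub_diag, Htw0, Cconj_R.
      unfold Rdiv. rewrite Rinv_1, Rmult_1_r, Rmult_1_l, RtoC_inv by (pose proof (Htw k); lra).
      ring.
    + intros i Hi Hi0. rewrite Hrow, (Hlow i), Hu by lia. ring.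
Qed.

(** * Binomial coefficients as moments of a Beta measure *)

Fixpoint gbinom (c : R) (m : nat) : R :=
  match m with O => 1 | S m => gbinom c m * (c - INR m) / (INR m + 1) end.

(* [(-1)^m gbinom c (S m) / c] is the [m]-th moment of the Beta distribution with
   density proportional to [x^(-c) (1 - x)^c] on (0, 1).  The singular integrals are
   replaced by integrals over [eps, 1 - eps] with [eps = 1 / (N + 4)]. *)
Definition beta_weight (c x : R) : R := exp ((-1 - c) * ln x) * exp (c * ln (1 - x)).

Definition beta_integral (c : R) (m N : nat) : R :=
  RInt (fun x => beta_weight c x * x ^ S m) (/ (INR N + 4)) (1 - / (INR N + 4)).

Lemma eps_range (N : nat) : 0 < / (INR N + 4) <= / 4.
Proof.
  pose proof (pos_INR N). split; [apply Rinv_0_lt_compat|apply Rinv_le_contravar]; lra.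
Qed.

Lemma ex_RInt_beta (c a b : R) (m : nat) :
  0 < a <= b -> b < 1 -> ex_RInt (fun x => beta_weight c x * x ^ S m) a b.
Proof.
  intros Hab Hb. apply (ex_RInt_continuous (V := R_CompleteNormedModule)).
  rewrite Rmin_left, Rmax_right by lra. intros x Hx.
  apply (ex_derive_continuous (V := R_NormedModule)).
  unfold beta_weight. auto_derive. repeat split; lra.
Qed.

Lemma beta_weight_pos (c x : R) : 0 < beta_weight c x.
Proof. apply Rmult_lt_0_compat; apply exp_pos. Qed.

(** Since eps <= 1/4, every interval of integration contains [[1/4, 3/4]]. The uniform lower bound
    permits division by the total mass before anything is known about its limit. *)
Lemma beta_integral_0_lower (c : R) :
  exists j, 0 < j /\ forall N, j <= beta_integral c 0 N.
Proof.
  exists (RInt (fun x => beta_weight c x * x ^ 1) (/ 4) (3 / 4)). split.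
  - apply RInt_gt_0; [lra| |].
    + intros x Hx. apply Rmult_lt_0_compat; [apply beta_weight_pos|simpl; lra].
    + intros x Hx. apply continuity_pt_filterlim, derivable_continuous_pt.
      apply ex_derive_Reals_0. unfold beta_weight. auto_derive. repeat split; lra.
  - intros N. unfold beta_integral. pose proof (eps_range N) as He.
    set (e := / (INR N + 4)) in *.
    assert (Hpos : forall a b, 0 < a <= b -> b < 1 ->
      0 <= RInt (fun x => beta_weight c x * x ^ 1) a b).
    { intros a b Hab Hb. apply RInt_ge_0; [lra|apply ex_RInt_beta; lra|].
      intros x Hx. apply Rmult_le_pos; [apply Rlt_le, beta_weight_pos|simpl; lra]. }
    rewrite <- (RInt_Chasles _ e (/ 4) (1 - e)) by (apply ex_RInt_beta; lra).
    rewrite <- (RInt_Chasles _ (/ 4) (3 / 4) (1 - e)) by (apply ex_RInt_beta; lra).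
    unfold plus; simpl. pose proof (Hpos e (/ 4)). pose proof (Hpos (3 / 4) (1 - e)).
    simpl in *. lra.
Qed.

Lemma is_lim_seq_Rpower_eps (s : R) :
  0 < s -> is_lim_seq (fun N => exp (s * ln (/ (INR N + 4)))) 0.
Proof.
  intros Hs.
  apply (is_lim_seq_ext (fun N => exp (- (s * ln (INR N + 4))))).
  { intros N. f_equal. pose proof (pos_INR N). rewrite ln_Rinv by lra. ring. }
  apply (is_lim_comp_seq exp _ m_infty).
  - apply is_lim_exp_m.
  - exists O. intros n _. discriminate.
  - apply (is_lim_seq_opp _ p_infty).
    replace p_infty with (Rbar_mult s p_infty).
    + apply is_lim_seq_scal_l.
      apply (is_lim_comp_seq ln _ p_infty).
      * apply is_lim_ln_p.
      * exists O. intros n _. discriminate.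
      * apply (is_lim_seq_plus _ _ p_infty 4); [apply is_lim_seq_INR|apply is_lim_seq_const|].
        reflexivity.
    + simpl. destruct (Rle_dec 0 s) as [H|H]; [|lra].
      destruct (Rle_lt_or_eq_dec 0 s H); [reflexivity|lra].
Qed.

(** This is x^(m + 1 - c) (1 - x)^(1 + c), whose derivative is x^(m - c) (1 - x)^c ((m + 1 - c) - (m
    + 2) x): the boundary term in the recurrence of the moments. *)
Definition beta_boundary (c : R) (m : nat) (x : R) : R :=
  x ^ S m * exp (- c * ln x) * exp ((1 + c) * ln (1 - x)).

Lemma beta_integral_S (c : R) (m N : nat) :
  (INR m + 2) * beta_integral c (S m) N =
  (INR m + 1 - c) * beta_integral c m N -
  (beta_boundary c m (1 - / (INR N + 4)) - beta_boundary c m (/ (INR N + 4))).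
Proof.
  unfold beta_integral. pose proof (eps_range N) as He.
  set (e := / (INR N + 4)) in *.
  pose (F := fun x => (INR m + 1 - c) * (beta_weight c x * x ^ S m)
                      - (INR m + 2) * (beta_weight c x * x ^ S (S m))).
  assert (H : is_RInt F e (1 - e) (beta_boundary c m (1 - e) - beta_boundary c m e)).
  { apply (is_RInt_derive (V := R_CompleteNormedModule) (beta_boundary c m));
      rewrite Rmin_left, Rmax_right by lra; intros x Hx.
    - unfold beta_boundary, F, beta_weight.
      auto_derive; [repeat split; lra|].
      replace (exp (- c * ln x)) with (x * exp ((-1 - c) * ln x)).
      2:{ rewrite <- (exp_ln x) at 1 by lra. rewrite <- exp_plus. f_equal. ring. }
      replace (exp ((1 + c) * ln (1 + - x))) with ((1 - x) * exp (c * ln (1 - x))).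
      2:{ rewrite <- (exp_ln (1 - x)) at 1 by lra. rewrite <- exp_plus.
          f_equal. unfold Rminus. ring. }
      change (match m with O => 1 | S _ => INR m + 1 end) with (INR (S m)).
      rewrite S_INR. simpl pow. field. lra.
    - apply (ex_derive_continuous (V := R_NormedModule)).
      unfold F, beta_weight. auto_derive. repeat split; lra. }
  apply (is_RInt_unique (V := R_CompleteNormedModule)) in H. rewrite <- H. unfold F.
  rewrite (RInt_minus (V := R_CompleteNormedModule)
    (fun x => (INR m + 1 - c) * (beta_weight c x * x ^ S m))
    (fun x => (INR m + 2) * (beta_weight c x * x ^ S (S m)))).
  2,3: apply (ex_RInt_scal (V := R_NormedModule)), ex_RInt_beta; lra.
  rewrite (RInt_scal (V := R_CompleteNormedModule) (fun x => beta_weight c x * x ^ S m))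
    by (apply ex_RInt_beta; lra).
  rewrite (RInt_scal (V := R_CompleteNormedModule) (fun x => beta_weight c x * x ^ S (S m)))
    by (apply ex_RInt_beta; lra).
  unfold minus, plus, opp, scal; simpl. unfold mult; simpl. ring.
Qed.

(** On [(0, 1)] the boundary term is at most x^(1 - c) and at most (1 - x)^(1 + c), so it vanishes
    at both ends. *)
Lemma beta_boundary_lim (c : R) (m : nat) :
  0 < c < 1 ->
  is_lim_seq (fun N => beta_boundary c m (1 - / (INR N + 4))
                       - beta_boundary c m (/ (INR N + 4))) 0.
Proof.
  intros Hc.
  assert (Hexp : forall a x, 0 < a -> 0 < x < 1 -> exp (a * ln x) <= 1).
  { intros a x Ha Hx. rewrite <- exp_0. apply Rlt_le, exp_increasing.
    assert (ln x < 0) by (rewrite <- ln_1; apply ln_increasing; lra). nra. }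
  assert (Hb : forall x, 0 < x < 1 ->
     0 <= beta_boundary c m x <= Rmin (exp ((1 - c) * ln x)) (exp ((1 + c) * ln (1 - x)))).
  { intros x Hx. unfold beta_boundary.
    assert (E : x ^ S m * exp (- c * ln x) = x ^ m * exp ((1 - c) * ln x)).
    { replace ((1 - c) * ln x) with (ln x + - c * ln x) by ring.
      rewrite exp_plus, exp_ln by lra. simpl. ring. }
    rewrite E. pose proof (Hexp (1 - c) x ltac:(lra) Hx).
    pose proof (Hexp (1 + c) (1 - x) ltac:(lra) ltac:(lra)).
    pose proof (exp_pos ((1 - c) * ln x)). pose proof (exp_pos ((1 + c) * ln (1 - x))).
    assert (0 <= x ^ m <= 1).
    { split; [apply pow_le; lra|]. rewrite <- (pow1 m). apply pow_incr. lra. }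
    set (u := exp ((1 - c) * ln x)) in *. set (v := exp ((1 + c) * ln (1 - x))) in *.
    assert (0 <= x ^ m * u <= u) by nra.
    split; [nra|]. apply Rmin_glb; nra. }
  apply (is_lim_seq_le_le (fun N => - exp ((1 - c) * ln (/ (INR N + 4)))) _
           (fun N => exp ((1 + c) * ln (/ (INR N + 4))))).
  - intros N. pose proof (eps_range N) as He. set (e := / (INR N + 4)) in *.
    pose proof (Hb e ltac:(lra)) as H1. pose proof (Hb (1 - e) ltac:(lra)) as H2.
    pose proof (Rmin_l (exp ((1 - c) * ln e)) (exp ((1 + c) * ln (1 - e)))).
    pose proof (Rmin_r (exp ((1 - c) * ln (1 - e))) (exp ((1 + c) * ln (1 - (1 - e))))) as H3.
    replace (1 - (1 - e)) with e in * by ring. lra.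
  - replace 0 with (- 0) by ring. apply (is_lim_seq_opp _ 0), is_lim_seq_Rpower_eps. lra.
  - apply is_lim_seq_Rpower_eps. lra.
Qed.

Lemma beta_ratio_lim (c : R) (m : nat) :
  0 < c < 1 ->
  is_lim_seq (fun N => beta_integral c m N / beta_integral c 0 N)
             ((-1) ^ m * gbinom c (S m) / c).
Proof.
  intros Hc. destruct (beta_integral_0_lower c) as (j & Hj & Hlow).
  induction m as [|m IH].
  - apply (is_lim_seq_ext (fun _ => 1)).
    + intros N. specialize (Hlow N). field. lra.
    + replace (_ / c) with 1; [apply is_lim_seq_const|]. simpl. field. lra.
  - pose (b := fun N => beta_boundary c m (1 - / (INR N + 4))
                       - beta_boundary c m (/ (INR N + 4))).
    assert (Hb : is_lim_seq (fun N => b N / beta_integral c 0 N) 0).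
    { apply is_lim_seq_abs_0, (is_lim_seq_le_le (fun _ => 0) _ (fun N => / j * Rabs (b N))).
      - intros N. split; [apply Rabs_pos|]. specialize (Hlow N).
        unfold Rdiv. rewrite Rabs_mult, Rmult_comm.
        apply Rmult_le_compat_r; [apply Rabs_pos|].
        rewrite Rabs_pos_eq by (apply Rlt_le, Rinv_0_lt_compat; lra).
        apply Rinv_le_contravar; lra.
      - apply is_lim_seq_const.
      - replace (Finite 0) with (Rbar_mult (/ j) 0) by (simpl; f_equal; ring).
        apply is_lim_seq_scal_l. apply -> is_lim_seq_abs_0. apply beta_boundary_lim, Hc. }
    pose proof (pos_INR m).
    apply (is_lim_seq_ext (fun N =>
      (INR m + 1 - c) / (INR m + 2) * (beta_integral c m N / beta_integral c 0 N)
      - / (INR m + 2) * (b N / beta_integral c 0 N))).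
    + intros N. specialize (Hlow N). pose proof (beta_integral_S c m N) as E.
      fold (b N) in E.
      replace (beta_integral c (S m) N) with
        (((INR m + 1 - c) * beta_integral c m N - b N) / (INR m + 2))
        by (rewrite <- E; field; lra).
      field. lra.
    + replace (Finite ((-1) ^ S m * gbinom c (S (S m)) / c)) with
       (Finite ((INR m + 1 - c) / (INR m + 2) * ((-1) ^ m * gbinom c (S m) / c)
         - / (INR m + 2) * 0)).
      * apply is_lim_seq_minus'; (apply (is_lim_seq_scal_l _ _ (Finite _)); assumption).
      * f_equal. change (gbinom c (S (S m))) with
          (gbinom c (S m) * (c - INR (S m)) / (INR (S m) + 1)).
        rewrite S_INR. simpl pow. field. lra.
Qed.

(** Positivity of the Beta law: a polynomial inequality on [(0, 1)] survives integration. The weight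
    carries an extra factor 1/x, so that [B * x] becomes [B] times the total mass and [x ^ S m]
    becomes the moment of order [m]. *)
Lemma gbinom_functional_le (c B : R) (y : nat -> R) (k : nat) :
  0 < c < 1 ->
  (forall x, 0 < x < 1 -> rsum (fun m => y m * x ^ S m) k <= B * x) ->
  rsum (fun m => y m * ((-1) ^ m * gbinom c (S m))) k <= B * c.
Proof.
  intros Hc Hy. destruct (beta_integral_0_lower c) as (j & Hj & Hlow).
  assert (Hint : forall N,
    rsum (fun m => y m * beta_integral c m N) k <= B * beta_integral c 0 N).
  { intros N. pose proof (eps_range N) as He. unfold beta_integral.
    set (e := / (INR N + 4)) in *.
    assert (Hs : forall K, is_RInt (fun x => rsum (fun m => y m * (beta_weight c x * x ^ S m)) K)
       e (1 - e) (rsum (fun m => y m * RInt (fun x => beta_weight c x * x ^ S m) e (1 - e)) K)).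
    { induction K as [|K IHK]; simpl rsum.
      - pose proof (is_RInt_const (V := R_NormedModule) e (1 - e) 0) as Z.
        change (scal (1 - e - e) 0) with ((1 - e - e) * 0) in Z.
        rewrite Rmult_0_r in Z. exact Z.
      - apply (is_RInt_plus (V := R_NormedModule)); [exact IHK|].
        apply (is_RInt_scal (V := R_NormedModule)), (RInt_correct (V := R_CompleteNormedModule)).
        apply ex_RInt_beta; lra. }
      rewrite <- (is_RInt_unique (V := R_CompleteNormedModule) _ _ _ _ (Hs k)).
    rewrite <- (RInt_scal (V := R_CompleteNormedModule)) by (apply ex_RInt_beta; lra).
    apply RInt_le; [lra|eexists; apply Hs| |].
    - apply (ex_RInt_scal (V := R_NormedModule)), ex_RInt_beta; lra.
    - intros x Hx. specialize (Hy x ltac:(lra)).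
      rewrite (rsum_ext _ (fun m => 0 + beta_weight c x * (y m * x ^ S m))) by (intros; ring).
      rewrite rsum_lin. unfold scal; simpl; unfold mult; simpl.
      replace (rsum (fun _ => 0) k) with 0 by (clear; induction k; simpl; lra).
      pose proof (beta_weight_pos c x).
      replace (B * (beta_weight c x * (x * 1))) with (beta_weight c x * (B * x)) by ring.
      rewrite Rplus_0_l. apply Rmult_le_compat_l; [lra|exact Hy]. }
  apply Rmult_le_reg_r with (/ c); [apply Rinv_0_lt_compat; lra|].
  replace (B * c * / c) with B by (field; lra).
  apply (is_lim_seq_le
           (fun N => rsum (fun m => y m * (beta_integral c m N / beta_integral c 0 N)) k)
           (fun _ => B) (rsum (fun m => y m * ((-1) ^ m * gbinom c (S m))) k * / c) B).
  - intros N. specialize (Hint N). specialize (Hlow N).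
    apply Rmult_le_reg_r with (beta_integral c 0 N); [lra|].
    eapply Rle_trans; [|exact Hint]. apply Req_le. clear Hint Hy.
    induction k as [|k IH]; simpl; [ring|]. rewrite Rmult_plus_distr_r, IH. field. lra.
  - clear Hy Hint. induction k as [|k IH]; cbn [rsum].
    + rewrite Rmult_0_l. apply is_lim_seq_const.
    + rewrite Rmult_plus_distr_r. apply is_lim_seq_plus'; [exact IH|].
      replace (y k * ((-1) ^ k * gbinom c (S k)) * / c)
        with (y k * ((-1) ^ k * gbinom c (S k) / c)) by (unfold Rdiv; ring).
      apply (is_lim_seq_scal_l _ _ (Finite _)), beta_ratio_lim, Hc.
  - apply is_lim_seq_const.
Qed.

(** * Fractional powers of a power series *)

Definition unit_series (k : nat) : C := match k with O => 1 | S _ => 0 end.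

Fixpoint power_series_pow (x : nat -> C) (m : nat) : nat -> C :=
  match m with O => unit_series | S m => conv x (power_series_pow x m) end.

Lemma conv_csum_r (x : nat -> C) (c : nat -> C) (F : nat -> nat -> C) (N k : nat) :
  conv x (fun i => csum (fun m => c m * F m i)%C N) k =
  csum (fun m => c m * conv x (F m) k)%C N.
Proof.
  induction N as [|N IH]; simpl csum.
  - unfold conv. apply csum_0. intros; ring.
  - rewrite conv_plus_r, IH, conv_scal_r. reflexivity.
Qed.

Lemma conv_unit_l (a : nat -> C) (k : nat) : conv unit_series a k = a k.
Proof.
  unfold conv. rewrite csum_head, csum_0.
  - rewrite Nat.sub_0_r. simpl. ring.
  - intros i Hi. simpl. ring.
Qed.

Lemma conv_low_0 (x y : nat -> C) (m k : nat) :
  x O = 0 -> (forall i, (i < m)%nat -> y i = 0) -> (k <= m)%nat -> conv x y k = 0.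
Proof.
  intros Hx Hy Hk. apply csum_0. intros i Hi.
  destruct i as [|i]; [rewrite Hx; ring|]. rewrite Hy by lia. ring.
Qed.

Lemma power_series_pow_low (x : nat -> C) (m k : nat) :
  x O = 0 -> (k < m)%nat -> power_series_pow x m k = 0.
Proof.
  intros Hx. revert k. induction m as [|m IH]; intros k Hk; [lia|].
  apply (conv_low_0 _ _ m); [exact Hx|exact IH|lia].
Qed.

Lemma theta_power_series_pow (x : nat -> C) (m k : nat) :
  theta (power_series_pow x (S m)) k =
  (INR (S m) * conv (theta x) (power_series_pow x m) k)%C.
Proof.
  revert k. induction m as [|m IH]; intros k.
  - simpl power_series_pow. rewrite theta_conv.
    rewrite (conv_ext x x (theta unit_series) (fun _ => 0 * 0)%C); [| |].
    + rewrite conv_scal_r. simpl INR. ring.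
    + reflexivity.
    + intros [|i] _; unfold theta; simpl; ring.
  - change (power_series_pow x (S (S m))) with (conv x (power_series_pow x (S m))).
    rewrite theta_conv.
    rewrite (conv_ext x x (theta (power_series_pow x (S m)))
      (fun i => INR (S m) * conv (theta x) (power_series_pow x m) i)%C)
      by (intros; auto).
    rewrite conv_scal_r, conv_left_comm.
    change (conv x (power_series_pow x m)) with (power_series_pow x (S m)).
    rewrite (S_INR (S m)), RtoC_plus. ring.
Qed.

(** The geometric series for 1/(1 + rho x). Cutting it at [K] is exact through degree [K], because
    the next power of [x] starts in degree [K + 1]. *)
Lemma resolvent_series (x : nat -> C) (rho : C) (K i : nat) :
  x O = 0 -> (i <= K)%nat ->
  let r := fun j => csum (fun m => (- rho) ^ m * power_series_pow x m j)%C (S K) in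
  r i = (unit_series i - rho * conv x r i)%C.
Proof.
  intros Hx Hi r. unfold r at 2. rewrite conv_csum_r.
  assert (E : r i = (unit_series i + csum (fun m => (- rho) ^ S m
                      * power_series_pow x (S m) i)%C (S K))%C).
  { unfold r. rewrite csum_head. cbn [csum].
    rewrite (power_series_pow_low x (S K)) by (trivial; lia).
    simpl. ring. }
  rewrite E. unfold Cminus. f_equal.
  transitivity (- rho * csum (fun m => (- rho) ^ m * power_series_pow x (S m) i) (S K))%C;
    [|simpl; ring].
  rewrite <- csum_scal. apply csum_ext. intros m _. simpl. ring.
Qed.

(** The equation (1 + x) theta h = c h theta x of h = (1 + x)^c. It characterises the fractional
    power by a linear recurrence on coefficients, which is also what [f] supplies. *)
Lemma binomial_series_theta (x : nat -> C) (c : R) (K k : nat) :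
  x O = 0 -> (k <= K)%nat ->
  let h := fun j => csum (fun m => gbinom c m * power_series_pow x m j)%C (S K) in
  (theta h k + conv x (theta h) k)%C = (c * conv h (theta x) k)%C.
Proof.
  intros Hx Hk h.
  (* [theta x] has no constant term either, so [Y m] vanishes through degree [m], one degree further
     than the power itself; sums over [m] can thus be shifted and extended to a common range. *)
  pose (Y := fun m => conv (theta x) (power_series_pow x m)).
  assert (HY : forall m j, (j <= m)%nat -> Y m j = 0).
  { intros m j Hj. apply (conv_low_0 _ _ m); [unfold theta; rewrite Hx; ring| |exact Hj].
    intros i Hi. apply power_series_pow_low; assumption. }
  assert (HxY : forall m j, conv x (Y m) j = Y (S m) j).
  { intros m j. apply conv_left_comm. }
  assert (Hh : forall j, (j <= K)%nat ->
    theta h j = csum (fun m => (gbinom c (S m) * INR (S m))%R * Y m j)%C (S K)).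
  { intros j Hj. unfold theta, h. rewrite <- csum_scal, csum_head. cbn [csum].
    rewrite HY by exact Hj.
    rewrite (csum_ext (fun i => INR j * (gbinom c (S i) * power_series_pow x (S i) j))%C
       (fun m => (gbinom c (S m) * INR (S m))%R * Y m j)%C).
    - destruct j as [|j]; simpl; ring.
    - intros m Hm. pose proof (theta_power_series_pow x m j) as T. unfold theta in T.
      rewrite RtoC_mult. transitivity (gbinom c (S m) * (INR j * power_series_pow x (S m) j))%C;
      [ring|]. rewrite T. fold (theta x). unfold Y. ring. }
  rewrite (conv_ext x x (theta h) (fun j => csum (fun m => (gbinom c (S m) * INR (S m))%R
             * Y m j)%C (S K))) by (try reflexivity; intros; apply Hh; lia).
  rewrite conv_csum_r, Hh by exact Hk.
  rewrite (csum_ext (fun m => (gbinom c (S m) * INR (S m))%R * conv x (Y m) k)%C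
            (fun m => (gbinom c (S m) * INR (S m))%R * Y (S m) k)%C)
    by (intros; rewrite HxY; reflexivity).
  assert (E : csum (fun m => (gbinom c (S m) * INR (S m))%R * Y (S m) k)%C (S K)
     = csum (fun m => (gbinom c m * INR m)%R * Y m k)%C (S K)).
  { rewrite (csum_head (fun m => (gbinom c m * INR m)%R * Y m k)%C). cbn [csum].
    rewrite (HY (S K)) by lia. simpl INR at 3. rewrite Rmult_0_r. ring. }
  rewrite E, <- csum_plus, conv_comm. unfold h. rewrite conv_csum_r, <- csum_scal.
  apply csum_ext. intros m _. fold (Y m). rewrite <- Cmult_plus_distr_r, <- RtoC_plus.
  rewrite Cmult_assoc, <- RtoC_mult. do 2 f_equal.
  (* The relation (m + 1) binom(c, m + 1) + m binom(c, m) = c binom(c, m). *)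
  change (gbinom c (S m)) with (gbinom c m * (c - INR m) / (INR m + 1)).
  rewrite S_INR. field. pose proof (pos_INR m). lra.
Qed.

(** In degree [m] the equation contains the coefficient [h m] only through [alpha * m * h m], so the
    constant term determines all the others. *)
Lemma root_series_unique (alpha : R) (g h h' : nat -> C) (k : nat) :
  alpha <> 0 -> g O = 1 -> h O = h' O ->
  (forall m, (m <= k)%nat -> (alpha * conv g (theta h) m)%C = conv h (theta g) m) ->
  (forall m, (m <= k)%nat -> (alpha * conv g (theta h') m)%C = conv h' (theta g) m) ->
  forall m, (m <= k)%nat -> h m = h' m.
Proof.
  intros Ha Hg H0 H H'. intros m.
  induction m as [m IH] using (well_founded_induction Wf_nat.lt_wf). intros Hm.
  destruct m as [|m]; [exact H0|].
  assert (E : forall f, (alpha * conv g (theta f) (S m))%C = conv f (theta g) (S m) ->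
    f (S m) = ((csum (fun i => f i * theta g (S m - i)%nat) (S m)
      - alpha * csum (fun i => theta f i * g (S m - i)%nat) (S m)) / (alpha * INR (S m)))%C).
  { intros f Ef. rewrite conv_comm in Ef. unfold conv in Ef.
    change (csum ?F (S (S m))) with (csum F (S m) + F (S m))%C in Ef.
    cbv beta in Ef. rewrite Nat.sub_diag, Hg in Ef.
    replace (theta g 0) with (RtoC 0) in Ef by (unfold theta; simpl; ring).
    rewrite Cmult_0_r, Cplus_0_r in Ef. rewrite <- Ef.
    assert (HS : RtoC (INR (S m)) <> 0).
    { intros K. apply RtoC_inj in K. revert K. apply not_0_INR. lia. }
    assert (Ha' : RtoC alpha <> 0) by (intros K; apply Ha, RtoC_inj, K).
    unfold theta at 2. field. split; assumption. }
  rewrite (E h (H _ Hm)), (E h' (H' _ Hm)). do 2 f_equal.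
  - apply csum_ext. intros i Hi. rewrite (IH i) by lia. reflexivity.
  - f_equal. apply csum_ext. intros i Hi. unfold theta. rewrite (IH i) by lia. reflexivity.
Qed.

Lemma Re_csum_R (f : nat -> C) (n : nat) : Re (csum f n) = rsum (fun i => Re (f i)) n.
Proof.
  induction n as [|n IH]; [reflexivity|]. cbn [csum rsum]. rewrite re_plus, IH. reflexivity.
Qed.

(** A statement about finitely many coefficients, with no convergence assumed: it serves both for a
    given [f] on a fixed circle and for the formal series from which the extremal function is
    built. *)
Lemma root_coefficient_bound (alpha beta : R) (n k : nat) (p g h : nat -> C) :
  1 < alpha -> 0 <= beta < 1 -> (1 <= k)%nat ->
  p O = 1 -> kernel_pos (S k) (fun i j => p (i - j)%nat) ->
  g O = 1 -> (forall m, (1 <= m <= k)%nat -> g m = (((1 - beta) * wt alpha n m)%R * p m)%C) ->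
  h O = 1 ->
  (forall m, (m <= k)%nat -> (alpha * conv g (theta h) m)%C = conv h (theta g) m) ->
  Cmod (h k) <= 2 * (1 - beta) * wt alpha n k / alpha.
Proof.
  intros Ha Hb Hk Hp0 Hp Hg0 Hg Hh0 Hh.
  pose (c := / alpha).
  assert (Hc : 0 < c < 1).
  { split; [apply Rinv_0_lt_compat; lra|]. rewrite <- Rinv_1. apply Rinv_lt_contravar; lra. }
  pose (x := fun m => match m with O => RtoC 0 | S _ => g m end).
  assert (Hx0 : x O = 0) by reflexivity.
  assert (Hxg : forall m, (0 < m)%nat -> x m = g m) by (intros [|m] Hm; [lia|reflexivity]).
  pose (H := fun j => csum (fun m => gbinom c m * power_series_pow x m j)%C (S k)).
  assert (HH : forall m, (m <= k)%nat -> h m = H m).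
  { apply (root_series_unique alpha g); [lra|exact Hg0| |exact Hh|].
    - unfold H. rewrite csum_head, csum_0, Hh0.
      + simpl. ring.
      + intros i Hi. rewrite power_series_pow_low by (trivial; lia). ring.
    - intros m Hm. pose proof (binomial_series_theta x c k m Hx0 Hm) as E.
      cbv zeta in E. fold H in E.
      rewrite (conv_ext g (fun i => unit_series i + x i)%C (theta H) (theta H)).
      + rewrite conv_plus_l, conv_unit_l, E.
        rewrite Cmult_assoc, <- RtoC_mult. unfold c. rewrite Rinv_r, Cmult_1_l by lra.
        apply conv_ext; [reflexivity|]. intros [|i] Hi; unfold theta; simpl INR;
          [ring|rewrite Hxg by lia; reflexivity].
      + intros [|i] Hi; simpl; [rewrite Hg0|]; ring.
      + reflexivity. }
  destruct (Req_dec (Cmod (h k)) 0) as [Z|NZ].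
  { rewrite Z. pose proof (wt_pos alpha n k ltac:(lra)).
    apply Rmult_le_pos; [|apply Rlt_le, Rinv_0_lt_compat; lra]. nra. }
  assert (Hpos : 0 < Cmod (h k)) by (pose proof (Cmod_ge_0 (h k)); lra).
  (* A unimodular factor with [s * h k = Cmod (h k)], which reduces the estimate to a real linear
     functional. *)
  pose (s := (/ Cmod (h k) * Cconj (h k))%C).
  assert (Hs : Cmod s = 1).
  { unfold s. rewrite Cmod_mult, Cmod_conj, <- RtoC_inv, Cmod_R, Rabs_pos_eq by
      (try apply Rlt_le, Rinv_0_lt_compat; lra). field. lra. }
  (* With these numbers [Cmod (h k)] is the sum of [y m * ((-1) ^ m * gbinom c (S m))], while the
     sum of [y m * t ^ S m] is [Re (- s * r k)] for r = 1/(1 + t x). *)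
  pose (y := fun m => Re (s * (-1) ^ m * power_series_pow x (S m) k)%C).
  pose (B := 2 * (1 - beta) * wt alpha n k).
  assert (Hy := gbinom_functional_le c B y k Hc).
  assert (E1 : rsum (fun m => y m * ((-1) ^ m * gbinom c (S m))) k = Cmod (h k)).
  { rewrite (rsum_ext _ (fun m => Re (s * (gbinom c (S m) * power_series_pow x (S m) k))%C)).
    - rewrite <- Re_csum_R, csum_scal.
      replace (csum (fun m => gbinom c (S m) * power_series_pow x (S m) k)%C k) with (H k).
      + rewrite <- HH by lia. unfold s.
        transitivity (Re (/ Cmod (h k) * (Cmod (h k) ^ 2)%R)%C).
        * rewrite Cmod2_conj. f_equal. ring.
        * rewrite <- RtoC_inv, <- RtoC_mult by lra. simpl. field. lra.
      + unfold H. rewrite csum_head. destruct k as [|k']; [lia|]. simpl. ring.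
    - intros m Hm. unfold y.
      rewrite <- re_scal_r. f_equal. rewrite RtoC_mult, RtoC_pow.
      assert (P : (RtoC (-1) ^ m * RtoC (-1) ^ m)%C = 1).
      { rewrite <- Cpow_mult_l. replace (RtoC (-1) * RtoC (-1))%C with (RtoC 1) by ring.
        apply Cpow_1_l. }
      transitivity ((RtoC (-1) ^ m * RtoC (-1) ^ m)
          * (s * (gbinom c (S m) * power_series_pow x (S m) k)))%C; [ring|].
      rewrite P. ring. }
  rewrite E1 in Hy. unfold B, c in Hy. apply Hy. clear Hy E1.
  intros t Ht. fold B.
  pose (r := fun j => csum (fun m => (- t) ^ m * power_series_pow x m j)%C (S k)).
  assert (Hr : forall i, (i <= k)%nat -> r i = (unit_series i - t * conv x r i)%C).
  { intros i Hi. apply (resolvent_series x t k i Hx0 Hi). }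
  assert (Hr0 : r O = 1).
  { rewrite Hr by lia. rewrite (conv_low_0 _ _ 0); [simpl; ring|exact Hx0|lia|lia]. }
  (* The factor [1 - beta] of [g] is merged with [t]: the reciprocal bound is applied with
     [t * (1 - beta)] in the place of [rho]. *)
  assert (Hbound : Cmod (r k) <= 2 * (t * (1 - beta)) * wt alpha n k).
  { apply (reciprocal_bound alpha _ n k p); try assumption; try lra.
    - split; [apply Rmult_lt_0_compat; lra|nra].
    - intros i Hi. rewrite Hr by lia. destruct i as [|i]; [lia|].
      rewrite conv_comm. unfold conv.
      change (csum ?F (S (S i))) with (csum F (S i) + F (S i))%C. cbv beta.
      rewrite Nat.sub_diag, Hx0, Cmult_0_r, Cplus_0_r.
      unfold Cminus. change (unit_series (S i)) with (RtoC 0). rewrite Cplus_0_l.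
      f_equal. rewrite <- csum_scal. apply csum_ext. intros j Hj.
      rewrite Hxg, Hg by lia. rewrite !RtoC_mult. ring. }
  apply Rle_trans with (Cmod (r k)); [|unfold B; nra].
  apply Rle_trans with (Re (- s * r k)%C).
  - apply Req_le. unfold r. rewrite csum_head. destruct k as [|k']; [lia|].
    change (power_series_pow x 0 (S k')) with (RtoC 0). rewrite Cmult_0_r, Cplus_0_l.
    rewrite <- csum_scal, Re_csum_R. apply rsum_ext. intros m Hm. unfold y.
    rewrite <- re_scal_r. f_equal.
    replace (- t)%C with (RtoC (-1) * t)%C by ring.
    rewrite Cpow_mult_l, RtoC_pow. simpl Cpow. ring.
  - eapply Rle_trans; [apply Rle_abs|]. eapply Rle_trans; [apply re_le_Cmod|].
    rewrite Cmod_mult, Cmod_opp, Hs. lra.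
Qed.

(** * Complex differentiation *)

Notation is_Cderive f z l :=
  (@is_derive C_AbsRing C_NormedModule (f : C -> C) (z : C) (l : C)).
Notation Ccontinuous := (continuous (T := C_UniformSpace) (U := C_UniformSpace)).
Notation CRcontinuous := (continuous (T := C_UniformSpace) (U := R_UniformSpace)).
Notation is_Cpseries := (is_pseries (K := C_AbsRing) (V := C_NormedModule)).
Notation R2 := (prod_UniformSpace R_UniformSpace R_UniformSpace).

Lemma is_Cderive_eps (f : C -> C) (z l : C) :
  is_Cderive f z l <->
  forall eps : R, 0 < eps -> exists del : R, 0 < del /\
    forall w : C, Cmod (w - z) < del ->
      Cmod (f w - f z - (w - z) * l) <= eps * Cmod (w - z).
Proof.
  split.
  - intros [_ H] eps Heps.
    specialize (H z (fun P HP => HP) (mkposreal eps Heps)). destruct H as [del H].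
    exists del. split; [apply cond_pos|]. intros w Hw. apply (H w Hw).
  - intros H. split; [apply is_linear_scal_l|].
    intros x Hx eps. rewrite <- (is_filter_lim_locally_unique _ _ Hx).
    destruct (H eps (cond_pos eps)) as (del & Hdel & Hw).
    exists (mkposreal del Hdel). intros w Hb. apply (Hw w Hb).
Qed.

(** The product and chain rules are stated for the field as a module over itself; both structures on
    [C] carry the same norm and hence the same derivatives. *)
Lemma is_Cderive_alg (f : C -> C) (z l : C) :
  is_Cderive f z l <->
  is_derive (K := C_AbsRing) (V := AbsRing_NormedModule C_AbsRing) f z l.
Proof.
  split; intros [_ H]; (split; [apply is_linear_scal_l|exact H]).
Qed.

Lemma is_Cderive_mult (f g : C -> C) (z df dg : C) :
  is_Cderive f z df -> is_Cderive g z dg ->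
  is_Cderive (fun w => f w * g w)%C z (df * g z + f z * dg)%C.
Proof.
  rewrite !is_Cderive_alg. intros Hf Hg.
  apply (is_derive_mult (K := C_AbsRing) f g z df dg Hf Hg Cmult_comm).
Qed.

Lemma is_Cderive_plus (f g : C -> C) (z df dg : C) :
  is_Cderive f z df -> is_Cderive g z dg ->
  is_Cderive (fun w => f w + g w)%C z (df + dg)%C.
Proof. intros Hf Hg. apply (is_derive_plus f g z df dg Hf Hg). Qed.

Lemma is_Cderive_const (c z : C) : is_Cderive (fun _ => c) z 0.
Proof. apply (is_derive_const (K := C_AbsRing) (V := C_NormedModule) c z). Qed.

Lemma is_Cderive_id (z : C) : is_Cderive (fun w => w) z 1.
Proof. apply is_Cderive_alg, (is_derive_id (K := C_AbsRing) z). Qed.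

Lemma is_Cderive_scal (c : C) (f : C -> C) (z df : C) :
  is_Cderive f z df -> is_Cderive (fun w => c * f w)%C z (c * df)%C.
Proof.
  intros Hf. replace (c * df)%C with (0 * f z + c * df)%C by ring.
  apply is_Cderive_mult; [apply is_Cderive_const|exact Hf].
Qed.

Lemma is_Cderive_comp (f g : C -> C) (z df dg : C) :
  is_Cderive f (g z) df -> is_Cderive g z dg ->
  is_Cderive (fun w => f (g w)) z (dg * df)%C.
Proof.
  intros Hf Hg. apply is_Cderive_alg in Hg.
  apply (is_derive_comp (K := C_AbsRing) (V := C_NormedModule) f g z df dg Hf Hg).
Qed.

Lemma is_Cderive_unique (f : C -> C) (z l l' : C) :
  is_Cderive f z l -> is_Cderive f z l' -> l = l'.
Proof.
  intros H H'. rewrite <- (is_C_derive_unique f z l H). apply is_C_derive_unique, H'.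
Qed.

Lemma is_Cderive_eq (f : C -> C) (z l l' : C) :
  is_Cderive f z l -> l = l' -> is_Cderive f z l'.
Proof. intros H <-. exact H. Qed.

Lemma is_Cderive_ext_loc (f g : C -> C) (z l : C) (r : R) :
  0 < r -> (forall w, Cmod (w - z) < r -> f w = g w) ->
  is_Cderive f z l -> is_Cderive g z l.
Proof.
  intros Hr H. apply is_derive_ext_loc. exists (mkposreal r Hr). exact H.
Qed.

Lemma Cmod_minus_sym (z w : C) : Cmod (z - w) = Cmod (w - z).
Proof. rewrite <- Cmod_opp. f_equal. ring. Qed.

Lemma Cmod_ge_minus (z w : C) : Cmod z - Cmod (w - z) <= Cmod w.
Proof.
  replace z with (w + - (w - z))%C at 1 by ring.
  pose proof (Cmod_triangle w (- (w - z))) as H. rewrite Cmod_opp in H. lra.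
Qed.

Lemma is_Cderive_inv (z : C) : z <> 0 -> is_Cderive Cinv z (- / (z * z))%C.
Proof.
  intros Hz. assert (Hp := proj1 (Cmod_gt_0 z) Hz).
  apply is_Cderive_eps. intros eps Heps.
  set (d := Cmod z) in *.
  (* The error is |w - z|^2 / (|w| d^2), and |w| >= d/2 bounds it by 2 |w - z|^2 / d^3. *)
  exists (Rmin (d / 2) (eps * d ^ 3 / 2)). split.
  { apply Rmin_glb_lt; [lra|]. pose proof (pow_lt d 3 Hp). nra. }
  intros w Hw. pose proof (Rmin_l (d / 2) (eps * d ^ 3 / 2)).
  pose proof (Rmin_r (d / 2) (eps * d ^ 3 / 2)).
  pose proof (Cmod_ge_minus z w) as Hg. fold d in Hg.
  assert (Hw0 : w <> 0) by (apply Cmod_gt_0; lra).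
  replace (/ w - / z - (w - z) * - / (z * z))%C
    with ((w - z) * ((w - z) * / (w * (z * z))))%C by (field; split; assumption).
  rewrite !Cmod_mult, Cmod_inv, !Cmod_mult by (apply Cmult_neq_0; [|apply Cmult_neq_0]; assumption).
  fold d. rewrite (Rmult_comm eps). apply Rmult_le_compat_l; [apply Cmod_ge_0|].
  apply Rmult_le_reg_r with (Cmod w * (d * d)); [repeat apply Rmult_lt_0_compat; lra|].
  rewrite Rmult_assoc, Rinv_l, Rmult_1_r by
    (apply Rgt_not_eq; repeat apply Rmult_lt_0_compat; lra).
  apply Rle_trans with (eps * (d / 2 * (d * d))).
  - simpl in *. lra.
  - apply Rmult_le_compat_l; [lra|]. apply Rmult_le_compat_r; [nra|]. lra.
Qed.

(** * The complex exponential *)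

Lemma derivable_pt_lim_0_eps (f : R -> R) (l : R) :
  derivable_pt_lim f 0 l ->
  forall eps, 0 < eps -> exists del, 0 < del /\
    forall h, Rabs h < del -> Rabs (f h - f 0 - l * h) <= eps * Rabs h.
Proof.
  intros H eps Heps. destruct (H eps Heps) as [del Hd].
  exists del. split; [apply cond_pos|]. intros h Hh.
  destruct (Req_dec h 0) as [->|Hne].
  - rewrite Rmult_0_r, Rminus_0_r, Rminus_diag, Rabs_R0. lra.
  - specialize (Hd h Hne Hh). rewrite Rplus_0_l in Hd.
    replace (f h - f 0 - l * h) with (((f h - f 0) / h - l) * h) by (field; exact Hne).
    rewrite Rabs_mult. apply Rmult_le_compat_r; [apply Rabs_pos|lra].
Qed.

Lemma Cexp_plus (z w : C) : Cexp (z + w) = (Cexp z * Cexp w)%C.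
Proof.
  unfold Cexp. rewrite re_plus, im_plus, exp_plus, cos_plus, sin_plus.
  unfold Cmult. simpl. f_equal; ring.
Qed.

Lemma Cexp_0 : Cexp 0 = 1.
Proof. unfold Cexp. simpl. rewrite exp_0, cos_0, sin_0. unfold RtoC. f_equal; ring. Qed.

Lemma Cexp_neq_0 (z : C) : Cexp z <> 0.
Proof.
  intros H. apply C1_nz. rewrite <- Cexp_0. replace (RtoC 0) with (z + - z)%C by ring.
  rewrite Cexp_plus, H. ring.
Qed.

Lemma Cmod_le_Rabs (z : C) : Cmod z <= Rabs (Re z) + Rabs (Im z).
Proof.
  destruct z as [x y]. replace (x, y) with (RtoC x + Ci * RtoC y)%C.
  - eapply Rle_trans; [apply Cmod_triangle|].
    rewrite Cmod_mult, Cmod_Ci, !Cmod_R. simpl. unfold Re, Im. simpl.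
    apply Req_le. f_equal; [f_equal; ring|rewrite Rmult_1_l; f_equal; ring].
  - unfold Ci, RtoC, Cplus, Cmult. simpl. f_equal; ring.
Qed.

Lemma Rabs_Im_le (z : C) : Rabs (Im z) <= Cmod z.
Proof. eapply Rle_trans; [|apply Rmax_Cmod]. apply Rmax_r. Qed.

Lemma is_Cderive_Cexp_0 : is_Cderive Cexp 0 1.
Proof.
  apply is_Cderive_eps. intros eps Heps.
  (* The four error terms [A1] to [A4] add up to at most 8 e |w|, so 20 leaves room; [e <= 1] keeps
     |1 + x| <= 2 and exp x <= 3. *)
  set (e := Rmin (eps / 20) 1).
  assert (He : 0 < e) by (apply Rmin_glb_lt; lra).
  assert (He1 : e <= eps / 20) by apply Rmin_l.
  assert (He2 : e <= 1) by apply Rmin_r.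
  assert (Dexp : derivable_pt_lim exp 0 1) by (rewrite <- exp_0; apply derivable_pt_lim_exp).
  assert (Dcos : derivable_pt_lim cos 0 0).
  { pose proof (derivable_pt_lim_cos 0) as K. rewrite sin_0, Ropp_0 in K. exact K. }
  assert (Dsin : derivable_pt_lim sin 0 1) by (rewrite <- cos_0; apply derivable_pt_lim_sin).
  destruct (derivable_pt_lim_0_eps _ _ Dexp e He) as (d1 & Hd1 & H1).
  destruct (derivable_pt_lim_0_eps _ _ Dcos e He) as (d2 & Hd2 & H2).
  destruct (derivable_pt_lim_0_eps _ _ Dsin e He) as (d3 & Hd3 & H3).
  set (d := Rmin (Rmin d1 d2) (Rmin d3 e)).
  assert (Hm : d <= d1 /\ d <= d2 /\ d <= d3 /\ d <= e).
  { unfold d. pose proof (Rmin_l (Rmin d1 d2) (Rmin d3 e)).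
    pose proof (Rmin_r (Rmin d1 d2) (Rmin d3 e)). pose proof (Rmin_l d1 d2).
    pose proof (Rmin_r d1 d2). pose proof (Rmin_l d3 e). pose proof (Rmin_r d3 e). lra. }
  exists d. split; [unfold d; apply Rmin_glb_lt; apply Rmin_glb_lt; assumption|].
  intros w Hw. rewrite Cexp_0.
  replace (w - 0)%C with w in * by ring.
  pose proof (re_le_Cmod w) as Hx. pose proof (Rabs_Im_le w) as Hy.
  set (x := Re w) in *. set (y := Im w) in *. set (m := Cmod w) in *.
  specialize (H1 x ltac:(lra)). specialize (H2 y ltac:(lra)). specialize (H3 y ltac:(lra)).
  rewrite exp_0 in H1. rewrite cos_0 in H2. rewrite sin_0 in H3.
  eapply Rle_trans; [apply Cmod_le_Rabs|].
  replace (Re (Cexp w - 1 - w * 1)) with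
    ((exp x - 1 - 1 * x) * cos y + (1 + x) * (cos y - 1 - 0 * y)) by
    (unfold Cexp; fold x y; destruct w; simpl in *; unfold x; simpl; ring).
  replace (Im (Cexp w - 1 - w * 1)) with
    (exp x * (sin y - 0 - 1 * y) + (exp x - 1) * y) by
    (unfold Cexp; fold x y; destruct w; simpl in *; unfold y; simpl; ring).
  assert (Hcos : Rabs (cos y) <= 1).
  { apply Rabs_le. pose proof (COS_bound y). lra. }
  assert (Hem : e * Rabs x <= e * m) by (apply Rmult_le_compat_l; lra).
  assert (Hemy : e * Rabs y <= e * m) by (apply Rmult_le_compat_l; lra).
  assert (Hm0 : 0 <= m) by apply Cmod_ge_0.
  assert (Hex : Rabs (exp x - 1) <= 2 * e).
  { replace (exp x - 1) with ((exp x - 1 - 1 * x) + x) by ring.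
    eapply Rle_trans; [apply Rabs_triang|]. nra. }
  assert (Hex2 : Rabs (exp x) <= 3).
  { replace (exp x) with ((exp x - 1) + 1) by ring.
    eapply Rle_trans; [apply Rabs_triang|]. rewrite Rabs_R1. lra. }
  assert (A1 : Rabs ((exp x - 1 - 1 * x) * cos y) <= e * m).
  { rewrite Rabs_mult. rewrite <- (Rmult_1_r (e * m)).
    apply Rmult_le_compat; try apply Rabs_pos; lra. }
  assert (A2 : Rabs ((1 + x) * (cos y - 1 - 0 * y)) <= 2 * (e * m)).
  { rewrite Rabs_mult. apply Rmult_le_compat; try apply Rabs_pos; [|lra].
    eapply Rle_trans; [apply Rabs_triang|]. rewrite Rabs_R1. lra. }
  assert (A3 : Rabs (exp x * (sin y - 0 - 1 * y)) <= 3 * (e * m)).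
  { rewrite Rabs_mult. apply Rmult_le_compat; try apply Rabs_pos; lra. }
  assert (A4 : Rabs ((exp x - 1) * y) <= (2 * e) * m).
  { rewrite Rabs_mult. apply Rmult_le_compat; try apply Rabs_pos; lra. }
  pose proof (Rabs_triang ((exp x - 1 - 1 * x) * cos y) ((1 + x) * (cos y - 1 - 0 * y))).
  pose proof (Rabs_triang (exp x * (sin y - 0 - 1 * y)) ((exp x - 1) * y)).
  assert (20 * (e * m) <= eps * m) by nra. nra.
Qed.

Lemma is_Cderive_Cexp (z : C) : is_Cderive Cexp z (Cexp z).
Proof.
  apply (is_derive_ext (fun w => Cexp z * Cexp (w + - z))%C).
  { intros w. rewrite <- Cexp_plus. f_equal. ring. }
  apply is_Cderive_eq with (Cexp z * (1 * 1))%C; [|ring].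
  apply is_Cderive_scal.
  apply (is_Cderive_comp Cexp (fun w => w + - z)%C).
  - replace (z + - z)%C with (RtoC 0) by ring. apply is_Cderive_Cexp_0.
  - replace (RtoC 1) with (1 + 0)%C by ring.
    apply is_Cderive_plus; [apply is_Cderive_id|apply is_Cderive_const].
Qed.


(** * Continuity of complex-valued functions *)

Lemma is_Cderive_continuity (f : C -> C) (z l : C) :
  is_Cderive f z l -> Ccontinuous f z.
Proof.
  intros H.
  assert (K : continuous (T := AbsRing_UniformSpace C_AbsRing) (U := C_UniformSpace) f z).
  { apply (ex_derive_continuous (K := C_AbsRing) (V := C_NormedModule)). exists l. exact H. }
  intros P HP. apply locally_C, (K P HP).
Qed.

Lemma continuous_C_eps (f : C -> C) (z : C) :
  Ccontinuous f z ->
  forall eps, 0 < eps -> exists del, 0 < del /\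
    forall w, Cmod (w - z) < del -> Cmod (f w - f z) < eps.
Proof.
  intros H eps Heps.
  (* The uniform structure of [C] is that of a product, with squares as balls; the factor [sqrt 2]
     compares squares with discs. *)
  assert (Hs : 0 < eps / sqrt 2) by (apply Rdiv_lt_0_compat; [exact Heps|apply sqrt_lt_R0; lra]).
  destruct (H _ (locally_ball (f z) (mkposreal _ Hs))) as [d Hd].
  exists d. split; [apply cond_pos|]. intros w Hw.
  specialize (Hd w (C_NormedModule_mixin_compat1 z w d Hw)).
  apply (C_NormedModule_mixin_compat2 (f z) (f w)) in Hd. simpl in Hd.
  replace eps with (sqrt 2 * (eps / sqrt 2)); [exact Hd|].
  field. apply Rgt_not_eq, sqrt_lt_R0. lra.
Qed.

Section Continuity.
Context {T : UniformSpace}.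
Implicit Types (f g : T -> C) (u v : T -> R) (t : T).

Lemma continuous_Cpair u v t :
  continuous u t -> continuous v t ->
  continuous (U := C_UniformSpace) (fun x => (u x, v x)) t.
Proof.
  intros Hu Hv P [eps HP].
  specialize (Hu _ (locally_ball (u t) eps)). specialize (Hv _ (locally_ball (v t) eps)).
  unfold filtermap in *. generalize (filter_and _ _ Hu Hv).
  apply filter_imp. intros x [H1 H2]. apply HP. split; assumption.
Qed.

Lemma continuous_Re f t :
  continuous (U := C_UniformSpace) f t -> continuous (fun x => Re (f x)) t.
Proof.
  intros Hf. apply (continuous_comp (U := T) (V := C_UniformSpace) f (fun z => Re z)).
  - exact Hf.
  - apply (continuous_fst (U := R_UniformSpace) (V := R_UniformSpace)).
Qed.

Lemma continuous_Im f t :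
  continuous (U := C_UniformSpace) f t -> continuous (fun x => Im (f x)) t.
Proof.
  intros Hf. apply (continuous_comp (U := T) (V := C_UniformSpace) f (fun z => Im z)).
  - exact Hf.
  - apply (continuous_snd (U := R_UniformSpace) (V := R_UniformSpace)).
Qed.

Lemma continuous_Cplus f g t :
  continuous (U := C_UniformSpace) f t -> continuous (U := C_UniformSpace) g t ->
  continuous (U := C_UniformSpace) (fun x => f x + g x)%C t.
Proof.
  intros Hf Hg. apply continuous_Cpair.
  - apply (continuous_plus (V := R_NormedModule)); apply continuous_Re; assumption.
  - apply (continuous_plus (V := R_NormedModule)); apply continuous_Im; assumption.
Qed.

Lemma continuous_Cmult f g t :
  continuous (U := C_UniformSpace) f t -> continuous (U := C_UniformSpace) g t ->
  continuous (U := C_UniformSpace) (fun x => f x * g x)%C t.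
Proof.
  intros Hf Hg.
  pose proof (continuous_Re _ _ Hf). pose proof (continuous_Im _ _ Hf).
  pose proof (continuous_Re _ _ Hg). pose proof (continuous_Im _ _ Hg).
  apply continuous_Cpair.
  - apply (continuous_minus (V := R_NormedModule));
      apply (continuous_mult (K := R_AbsRing)); assumption.
  - apply (continuous_plus (V := R_NormedModule));
      apply (continuous_mult (K := R_AbsRing)); assumption.
Qed.

Lemma continuous_Cconst (c : C) t : continuous (U := C_UniformSpace) (fun _ : T => c) t.
Proof. apply continuous_const. Qed.

Lemma continuous_Cconj f t :
  continuous (U := C_UniformSpace) f t ->
  continuous (U := C_UniformSpace) (fun x => Cconj (f x)) t.
Proof.
  intros Hf. apply continuous_Cpair; [apply continuous_Re, Hf|].
  apply (continuous_opp (V := R_NormedModule) (fun x => Im (f x))), continuous_Im, Hf.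
Qed.

End Continuity.

(** * The principal logarithm on the slit plane *)

Lemma continuous_comp_pt (g : C -> R) (h : R -> R) (z : C) :
  CRcontinuous g z ->
  continuity_pt h (g z) ->
  CRcontinuous (fun w => h (g w)) z.
Proof.
  intros Hg Hh. apply (continuous_comp (U := C_UniformSpace) g h); [exact Hg|].
  apply continuity_pt_filterlim, Hh.
Qed.

Lemma continuous_Re_id (z : C) :
  CRcontinuous (fun w : C => Re w) z.
Proof. apply (continuous_fst (U := R_UniformSpace) (V := R_UniformSpace)). Qed.

Lemma continuous_Im_id (z : C) :
  CRcontinuous (fun w : C => Im w) z.
Proof. apply (continuous_snd (U := R_UniformSpace) (V := R_UniformSpace)). Qed.

Lemma continuous_Cmod (z : C) :
  CRcontinuous Cmod z.
Proof.
  apply (continuous_comp_pt (fun w => Re w ^ 2 + Im w ^ 2) sqrt).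
  - apply (continuous_plus (V := R_NormedModule));
      apply (continuous_comp_pt _ (fun x => x ^ 2));
      try apply continuous_Re_id; try apply continuous_Im_id;
      apply derivable_continuous_pt, derivable_pt_pow.
  - apply continuity_pt_sqrt. destruct z as [x y]. simpl. nra.
Qed.

Lemma Re_over_Cmod_bound (z : C) : z <> 0 -> -1 <= Re z / Cmod z <= 1.
Proof.
  intros Hz. apply Cmod_gt_0 in Hz. pose proof (re_le_Cmod z) as H.
  assert (H' : Rabs (Re z / Cmod z) <= 1).
  { unfold Rdiv. rewrite Rabs_mult, (Rabs_pos_eq (/ _)) by (apply Rlt_le, Rinv_0_lt_compat, Hz).
    apply Rmult_le_reg_r with (Cmod z); [exact Hz|]. rewrite Rmult_assoc, Rinv_l; lra. }
  revert H'. generalize (Re z / Cmod z). intros x Hx.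
  split; [apply Rabs_le_between in Hx; lra|apply Rabs_le_between in Hx; lra].
Qed.

Lemma sqrt_1_minus_ratio (z : C) :
  z <> 0 -> sqrt (1 - (Re z / Cmod z) ^ 2) = Rabs (Im z) / Cmod z.
Proof.
  intros Hz. apply Cmod_gt_0 in Hz. pose proof (Cmod2_alt z) as E.
  apply sqrt_lem_1.
  - replace (1 - (Re z / Cmod z) ^ 2) with ((Im z / Cmod z) ^ 2).
    + apply pow2_ge_0.
    + replace (Im z / Cmod z) with (Im z * / Cmod z) by reflexivity.
      rewrite Rpow_mult_distr. replace (Im z ^ 2) with (Cmod z ^ 2 - Re z ^ 2) by lra.
      field. lra.
  - apply Rmult_le_pos; [apply Rabs_pos|apply Rlt_le, Rinv_0_lt_compat, Hz].
  - replace (Rabs (Im z) / Cmod z * (Rabs (Im z) / Cmod z))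
      with (Rabs (Im z) ^ 2 / Cmod z ^ 2) by (field; lra).
    rewrite pow2_abs. replace (Im z ^ 2) with (Cmod z ^ 2 - Re z ^ 2) by lra. field. lra.
Qed.

Lemma Cexp_Cln (z : C) : z <> 0 -> Cexp (Cln z) = z.
Proof.
  intros Hz. pose proof (Re_over_Cmod_bound z Hz) as Hb.
  pose proof (sqrt_1_minus_ratio z Hz) as Hs. apply Cmod_gt_0 in Hz.
  unfold Cexp, Cln. simpl Re. simpl Im. unfold Carg. rewrite exp_ln by exact Hz.
  assert (Hc : cos (acos (Re z / Cmod z)) = Re z / Cmod z) by (apply cos_acos; exact Hb).
  assert (Hsin : sin (acos (Re z / Cmod z)) = Rabs (Im z) / Cmod z).
  { rewrite sin_acos by exact Hb. rewrite <- Hs. f_equal. unfold Rsqr. ring. }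
  destruct (Rle_dec 0 (Im z)) as [H|H].
  - rewrite Hc, Hsin, Rabs_pos_eq by exact H.
    apply injective_projections; simpl; unfold Re, Im; field; lra.
  - rewrite cos_neg, sin_neg, Hc, Hsin, Rabs_left by lra.
    apply injective_projections; simpl; unfold Re, Im; field; lra.
Qed.

Definition slit (z : C) : Prop := ~ (Im z = 0 /\ Re z <= 0).

Lemma slit_neq_0 (z : C) : slit z -> z <> 0.
Proof. intros H ->. apply H. simpl. lra. Qed.

Lemma continuous_Re_ratio (z : C) :
  z <> 0 ->
  CRcontinuous (fun w : C => Re w / Cmod w) z.
Proof.
  intros Hz. apply (continuous_mult (K := R_AbsRing)); [apply continuous_Re_id|].
  apply (continuous_comp_pt Cmod Rinv); [apply continuous_Cmod|].
  apply continuity_pt_inv; [apply derivable_continuous_pt, derivable_pt_id|].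
  apply Cmod_gt_0 in Hz. unfold id. lra.
Qed.

Lemma locally_Re_pos (z : C) (g : C -> R) :
  CRcontinuous g z -> 0 < g z ->
  locally (T := C_UniformSpace) z (fun w => 0 < g w).
Proof. intros Hg Hz. apply (Hg (fun y => 0 < y)). apply (open_gt 0), Hz. Qed.

(** [Carg] changes its formula across the positive axis, so the right half-plane is treated by the
    single expression [atan (Im w / Re w)]. In the rest of the slit plane [Im z] is nonzero and the
    argument of [acos] stays strictly inside [(-1, 1)]. *)
Lemma continuous_Carg (z : C) :
  slit z -> CRcontinuous Carg z.
Proof.
  intros Hz. pose proof (slit_neq_0 z Hz) as Hz0.
  destruct (Rlt_dec 0 (Re z)) as [Hre|Hre].
  - apply continuous_ext_loc with (fun w => atan (Im w / Re w)).
    + generalize (locally_Re_pos z (fun w => Re w) (continuous_Re_id z) Hre).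
      apply filter_imp. intros w Hw. unfold Carg.
      assert (Hw0 : (w : C) <> RtoC 0) by (intros E; rewrite E in Hw; simpl in Hw; lra).
      pose proof (proj1 (Cmod_gt_0 w) Hw0) as Hm.
      rewrite acos_atan by (apply Rdiv_lt_0_compat; assumption).
      replace (Rsqr (Re w / Cmod w)) with ((Re w / Cmod w) ^ 2) by (unfold Rsqr; ring).
      rewrite sqrt_1_minus_ratio by exact Hw0.
      replace (Rabs (Im w) / Cmod w / (Re w / Cmod w)) with (Rabs (Im w) / Re w)
        by (field; lra).
      destruct (Rle_dec 0 (Im w)) as [H|H].
      * rewrite Rabs_pos_eq by exact H. reflexivity.
      * rewrite Rabs_left, <- atan_opp by lra. f_equal. field. lra.
    + apply (continuous_comp_pt (fun w => Im w / Re w) atan).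
      * apply (continuous_mult (K := R_AbsRing)); [apply continuous_Im_id|].
        apply (continuous_comp_pt (fun w => Re w) Rinv); [apply continuous_Re_id|].
        apply continuity_pt_inv; [apply derivable_continuous_pt, derivable_pt_id|].
        unfold id. lra.
      * apply derivable_continuous_pt, derivable_pt_atan.
  - assert (Him : Im z <> 0) by (intros E; apply Hz; split; [exact E|lra]).
    assert (Hint : -1 < Re z / Cmod z < 1).
    { pose proof (Re_over_Cmod_bound z Hz0) as Hb.
      pose proof (sqrt_1_minus_ratio z Hz0) as Hs.
      assert (0 < Rabs (Im z) / Cmod z).
      { apply Rdiv_lt_0_compat; [apply Rabs_pos_lt, Him|apply Cmod_gt_0, Hz0]. }
      destruct (Req_dec (Re z / Cmod z) 1) as [E|E].
      { rewrite E in Hs. replace (1 - 1 ^ 2) with 0 in Hs by ring. rewrite sqrt_0 in Hs. lra. }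
      destruct (Req_dec (Re z / Cmod z) (-1)) as [E'|E'].
      { rewrite E' in Hs. replace (1 - (-1) ^ 2) with 0 in Hs by ring.
        rewrite sqrt_0 in Hs. lra. }
      lra. }
    assert (Hac : CRcontinuous
                    (fun w => acos (Re w / Cmod w)) z).
    { apply (continuous_comp_pt (fun w => Re w / Cmod w) acos).
      - apply continuous_Re_ratio, Hz0.
      - apply derivable_continuous_pt, derivable_pt_acos, Hint. }
    destruct (Rlt_dec 0 (Im z)) as [H|H].
    + apply continuous_ext_loc with (fun w => acos (Re w / Cmod w)); [|exact Hac].
      generalize (locally_Re_pos z (fun w => Im w) (continuous_Im_id z) H).
      apply filter_imp. intros w Hw. unfold Carg.
      destruct (Rle_dec 0 (Im w)); [reflexivity|lra].
    + apply continuous_ext_loc with (fun w => - acos (Re w / Cmod w)).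
      * generalize (locally_Re_pos z (fun w => - Im w)
          (continuous_opp (V := R_NormedModule) _ _ (continuous_Im_id z)) ltac:(lra)).
        apply filter_imp. intros w Hw. unfold Carg.
        destruct (Rle_dec 0 (Im w)); [lra|reflexivity].
      * apply (continuous_opp (V := R_NormedModule) (fun w => acos (Re w / Cmod w))), Hac.
Qed.

Lemma continuous_Cln (z : C) :
  slit z -> Ccontinuous Cln z.
Proof.
  intros Hz. apply continuous_Cpair; [|apply continuous_Carg, Hz].
  apply (continuous_comp_pt Cmod ln); [apply continuous_Cmod|].
  apply derivable_continuous_pt. exists (/ Cmod z). apply derivable_pt_lim_ln.
  apply Cmod_gt_0, slit_neq_0, Hz.
Qed.

(** An inverse function argument: [Cexp (Cln w) = w], and continuity of [Cln] brings [Cln w] into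
    the range where the expansion of [Cexp] at [Cln z] applies. *)
Lemma is_Cderive_Cln (z : C) : slit z -> is_Cderive Cln z (/ z)%C.
Proof.
  intros Hz. pose proof (slit_neq_0 z Hz) as Hz0.
  pose proof (proj1 (Cmod_gt_0 z) Hz0) as Hm.
  assert (HE := proj1 (is_Cderive_eps _ _ _) (is_Cderive_Cexp (Cln z))).
  rewrite Cexp_Cln in HE by exact Hz0.
  apply is_Cderive_eps. intros eps Heps.
  (* The first bound gives |D| |z| <= 2 |d| for the increments [D] of the logarithm and [d] of the
     variable; the second then makes the error e |D| / |z| at most eps |d|. *)
  set (e := Rmin (Cmod z / 2) (eps * Cmod z ^ 2 / 2)).
  assert (He : 0 < e).
  { apply Rmin_glb_lt; [lra|]. pose proof (pow_lt _ 2 Hm). nra. }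
  destruct (HE e He) as (d1 & Hd1 & H1).
  destruct (continuous_C_eps _ _ (continuous_Cln z Hz) d1 Hd1) as (d2 & Hd2 & H2).
  exists (Rmin d2 (Cmod z)). split; [apply Rmin_glb_lt; assumption|].
  intros w Hw. pose proof (Rmin_l d2 (Cmod z)). pose proof (Rmin_r d2 (Cmod z)).
  specialize (H1 (Cln w) (H2 w ltac:(lra))).
  assert (Hw0 : w <> 0).
  { apply Cmod_gt_0. pose proof (Cmod_ge_minus z w). lra. }
  rewrite Cexp_Cln in H1 by exact Hw0.
  set (D := (Cln w - Cln z)%C) in *. set (d := (w - z)%C) in *.
  replace (D - d * / z)%C with (- (d - D * z) * / z)%C by (field; exact Hz0).
  rewrite Cmod_mult, Cmod_opp, Cmod_inv by exact Hz0.
  pose proof (Rmin_l (Cmod z / 2) (eps * Cmod z ^ 2 / 2)) as E1. fold e in E1.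
  pose proof (Rmin_r (Cmod z / 2) (eps * Cmod z ^ 2 / 2)) as E2. fold e in E2.
  assert (HD : Cmod D * Cmod z <= 2 * Cmod d).
  { rewrite <- Cmod_mult. replace (D * z)%C with (d + - (d - D * z))%C by ring.
    pose proof (Cmod_triangle d (- (d - D * z))) as T. rewrite Cmod_opp in T.
    assert (e * Cmod D <= Cmod z / 2 * Cmod D).
    { apply Rmult_le_compat_r; [apply Cmod_ge_0|exact E1]. }
    replace (d + - (d - D * z))%C with (D * z)%C in * by ring.
    rewrite Cmod_mult in *. lra. }
  apply Rmult_le_reg_r with (Cmod z * Cmod z); [apply Rmult_lt_0_compat; exact Hm|].
  apply Rle_trans with (e * (Cmod D * Cmod z)).
  - replace (Cmod (d - D * z) * / Cmod z * (Cmod z * Cmod z))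
      with (Cmod (d - D * z) * Cmod z) by (field; lra).
    rewrite <- Rmult_assoc. apply Rmult_le_compat_r; lra.
  - apply Rle_trans with (e * (2 * Cmod d)); [apply Rmult_le_compat_l; lra|].
    replace (eps * Cmod d * (Cmod z * Cmod z)) with (eps * Cmod z ^ 2 / 2 * (2 * Cmod d))
      by (simpl; field).
    apply Rmult_le_compat_r; [pose proof (Cmod_ge_0 d); lra|exact E2].
Qed.

(** * Power series on the unit disk *)

(** Equivalent to a radius of convergence of at least 1, in a form that passes easily to [theta] and
    [conv]. *)
Definition subexp (a : nat -> C) : Prop :=
  forall rho, 0 < rho < 1 -> exists M, forall i, Cmod (a i) * rho ^ i <= M.

(** Two real series, so that the function is total; it is the sum of the power series wherever these
    converge. *)
Definition psum (a : nat -> C) (z : C) : C :=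
  (Series (fun i => Re (a i * z ^ i)%C), Series (fun i => Im (a i * z ^ i)%C)).

Definition partial (a : nat -> C) (z : C) (N : nat) : C := csum (fun i => a i * z ^ i)%C N.

Lemma Im_csum_R (f : nat -> C) (n : nat) : Im (csum f n) = rsum (fun i => Im (f i)) n.
Proof.
  induction n as [|n IH]; [reflexivity|]. cbn [csum rsum]. rewrite im_plus, IH. reflexivity.
Qed.

Lemma ex_series_geom_bound (x : nat -> R) (M q : R) :
  0 <= q < 1 -> (forall i, Rabs (x i) <= M * q ^ i) -> ex_series (fun i => Rabs (x i)).
Proof.
  intros Hq Hx.
  apply (ex_series_le (V := R_CompleteNormedModule) _ (fun i => M * q ^ i)).
  - intros i. unfold norm; simpl. unfold abs; simpl. rewrite Rabs_Rabsolu. apply Hx.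
  - apply (ex_series_scal (V := R_NormedModule) M). exists (/ (1 - q)).
    apply is_series_geom. rewrite Rabs_pos_eq; lra.
Qed.

Lemma Series_tail_geom (x : nat -> R) (M q : R) (N : nat) :
  0 <= q < 1 -> (forall i, Rabs (x i) <= M * q ^ i) ->
  Rabs (Series x - rsum x N) <= M * q ^ N / (1 - q).
Proof.
  intros Hq Hx. pose proof (ex_series_geom_bound x M q Hq Hx) as Ha.
  pose proof (ex_series_Rabs _ Ha) as He.
  assert (E : Series x - rsum x N = Series (fun i => x (N + i)%nat)).
  { destruct N as [|N].
    - simpl. rewrite Rminus_0_r. reflexivity.
    - rewrite (Series_incr_n x (S N)) by (try lia; exact He). simpl Nat.pred.
      assert (S : sum_f_R0 x N = rsum x (S N)).
      { clear. induction N as [|N IH]; simpl in *; [ring|]. rewrite IH. ring. }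
      rewrite S. ring. }
  rewrite E.
  assert (Hx' : forall i, Rabs (x (N + i)%nat) <= (M * q ^ N) * q ^ i).
  { intros i. rewrite Rmult_assoc, <- pow_add. apply Hx. }
  eapply Rle_trans; [apply Series_Rabs; exact (ex_series_geom_bound _ _ q Hq Hx')|].
  assert (Hg : Rabs q < 1) by (rewrite Rabs_pos_eq; lra).
  unfold Rdiv. rewrite <- (Series_geom q Hg), <- Series_scal_l.
  apply Series_le.
  - intros i. split; [apply Rabs_pos|apply Hx'].
  - apply (ex_series_scal (V := R_NormedModule) (M * q ^ N)).
    exists (/ (1 - q)). apply is_series_geom, Hg.
Qed.

Lemma coef_bound_nonneg (a : nat -> C) (rho M : R) :
  0 < rho -> (forall i, Cmod (a i) * rho ^ i <= M) -> 0 <= M.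
Proof.
  intros Hr H. eapply Rle_trans; [|apply (H O)]. simpl. pose proof (Cmod_ge_0 (a O)). lra.
Qed.

Lemma term_bound (a : nat -> C) (rho M r : R) (z : C) (i : nat) :
  0 < rho -> 0 <= r -> (forall i, Cmod (a i) * rho ^ i <= M) -> Cmod z <= r ->
  Cmod (a i * z ^ i) <= M * (r / rho) ^ i.
Proof.
  intros Hrho Hr H Hz. rewrite Cmod_mult, Cmod_pow.
  pose proof (pow_lt rho i Hrho) as Hp.
  replace (M * (r / rho) ^ i) with (M / rho ^ i * r ^ i).
  2:{ unfold Rdiv. rewrite Rpow_mult_distr, pow_inv. ring. }
  apply Rmult_le_compat; [apply Cmod_ge_0|apply pow_le, Cmod_ge_0| |].
  - apply Rmult_le_reg_r with (rho ^ i); [exact Hp|].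
    unfold Rdiv. rewrite Rmult_assoc, Rinv_l by lra. rewrite Rmult_1_r. apply H.
  - apply pow_incr. split; [apply Cmod_ge_0|exact Hz].
Qed.

Lemma ratio_lt_1 (r rho : R) : 0 <= r < rho -> 0 <= r / rho < 1.
Proof.
  intros H. split.
  - apply Rmult_le_pos; [lra|apply Rlt_le, Rinv_0_lt_compat; lra].
  - apply Rmult_lt_reg_r with rho; [lra|]. unfold Rdiv. rewrite Rmult_assoc, Rinv_l; lra.
Qed.

Lemma psum_tail (a : nat -> C) (rho M r : R) (z : C) (N : nat) :
  0 <= r < rho -> (forall i, Cmod (a i) * rho ^ i <= M) -> Cmod z <= r ->
  Cmod (psum a z - partial a z N) <= 2 * (M * (r / rho) ^ N / (1 - r / rho)).
Proof.
  intros Hr H Hz. pose proof (ratio_lt_1 r rho Hr) as Hq.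
  assert (Ht := fun i => term_bound a rho M r z i ltac:(lra) ltac:(lra) H Hz).
  eapply Rle_trans; [apply Cmod_le_Rabs|]. rewrite double. apply Rplus_le_compat.
  - replace (Re (psum a z - partial a z N))
      with (Series (fun i => Re (a i * z ^ i)%C) - rsum (fun i => Re (a i * z ^ i)%C) N)
      by (rewrite <- Re_csum_R; reflexivity).
    apply Series_tail_geom; [exact Hq|]. intros i.
    eapply Rle_trans; [apply re_le_Cmod|apply Ht].
  - replace (Im (psum a z - partial a z N))
      with (Series (fun i => Im (a i * z ^ i)%C) - rsum (fun i => Im (a i * z ^ i)%C) N)
      by (rewrite <- Im_csum_R; reflexivity).
    apply Series_tail_geom; [exact Hq|]. intros i.
    eapply Rle_trans; [apply Rabs_Im_le|apply Ht].
Qed.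

Lemma geom_eventually_small (K q eps : R) :
  0 <= q < 1 -> 0 < eps -> exists N0, forall N, (N0 <= N)%nat -> K * q ^ N <= eps.
Proof.
  intros Hq Heps.
  assert (H : is_lim_seq (fun N => K * q ^ N) 0).
  { replace (Finite 0) with (Rbar_mult K 0) by (simpl; f_equal; ring).
    apply is_lim_seq_scal_l, is_lim_seq_geom. rewrite Rabs_pos_eq; lra. }
  apply is_lim_seq_spec in H. destruct (H (mkposreal eps Heps)) as [N0 HN].
  exists N0. intros N HN'. specialize (HN N HN'). simpl in HN.
  rewrite Rminus_0_r in HN. apply Rabs_lt_between in HN. lra.
Qed.

Lemma psum_uniform (a : nat -> C) (r eps : R) :
  subexp a -> 0 <= r < 1 -> 0 < eps ->
  exists N0, forall N, (N0 <= N)%nat -> forall z, Cmod z <= r ->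
    Cmod (psum a z - partial a z N) <= eps.
Proof.
  intros Ha Hr Heps. set (rho := (1 + r) / 2). assert (Hrho : r < rho < 1) by (unfold rho; lra).
  destruct (Ha rho ltac:(lra)) as [M HM].
  pose proof (ratio_lt_1 r rho ltac:(lra)) as Hq.
  destruct (geom_eventually_small (2 * (M / (1 - r / rho))) (r / rho) eps Hq Heps) as [N0 HN].
  exists N0. intros N HN' z Hz. eapply Rle_trans; [|apply (HN N HN')].
  eapply Rle_trans; [apply (psum_tail a rho M r z N); [lra|exact HM|exact Hz]|].
  apply Req_le. field. lra.
Qed.

Lemma is_pseries_eps (a : nat -> C) (z l : C) :
  is_Cpseries a z l <->
  forall eps, 0 < eps -> exists N0, forall N, (N0 <= N)%nat ->
    Cmod (l - partial a z N) <= eps.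
Proof.
  assert (E : forall n,
    sum_n (G := C_NormedModule) (fun k => scal (pow_n (z : C_AbsRing) k) (a k)) n
    = partial a z (S n)).
  { assert (P : forall k, pow_n (K := C_AbsRing) z k = (z ^ k)%C).
    { induction k as [|k IH]; [reflexivity|]. simpl. rewrite IH. reflexivity. }
    induction n as [|n IH].
    - rewrite sum_O, P. unfold partial. cbn [csum]. rewrite Cplus_0_l. apply Cmult_comm.
    - rewrite sum_Sn, IH, P. unfold partial. cbn [csum].
      apply (f_equal2 Cplus); [reflexivity|apply Cmult_comm]. }
  unfold is_pseries, is_series. split.
  - intros H eps Heps.
    assert (Hs : 0 < eps / sqrt 2) by (apply Rdiv_lt_0_compat; [exact Heps|apply sqrt_lt_R0; lra]).
    destruct (H _ (locally_ball l (mkposreal _ Hs))) as [N0 HN].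
    exists (S N0). intros [|N] HN'; [lia|]. specialize (HN N ltac:(lia)).
    apply (C_NormedModule_mixin_compat2 l) in HN. rewrite E in HN. simpl in HN.
    rewrite Cmod_minus_sym. apply Rlt_le.
    replace eps with (sqrt 2 * (eps / sqrt 2)); [exact HN|].
    field. apply Rgt_not_eq, sqrt_lt_R0. lra.
  - intros H P [eps HP].
    destruct (H (eps / 2) ltac:(pose proof (cond_pos eps); lra)) as [N0 HN].
    exists N0. intros n Hn. apply HP, C_NormedModule_mixin_compat1. rewrite E.
    specialize (HN (S n) ltac:(lia)). rewrite Cmod_minus_sym in HN.
    eapply Rle_lt_trans; [exact HN|]. pose proof (cond_pos eps). lra.
Qed.

Lemma is_pseries_psum (a : nat -> C) (z : C) :
  subexp a -> Cmod z < 1 ->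
  is_Cpseries a z (psum a z).
Proof.
  intros Ha Hz. apply is_pseries_eps. intros eps Heps.
  destruct (psum_uniform a (Cmod z) eps Ha) as [N0 HN];
    [split; [apply Cmod_ge_0|exact Hz]|exact Heps|].
  exists N0. intros N HN'. apply HN; [exact HN'|lra].
Qed.

Lemma Cmod_small_eq (x y : C) : (forall eps, 0 < eps -> Cmod (x - y) <= eps) -> x = y.
Proof.
  intros H. apply Ceq_minus, Cmod_eq_0. apply Rle_antisym; [|apply Cmod_ge_0].
  apply le_epsilon. intros eps Heps. rewrite Rplus_0_l. apply H, Heps.
Qed.

Lemma is_pseries_unique_eps (a : nat -> C) (z l l' : C) :
  is_Cpseries a z l ->
  is_Cpseries a z l' -> l = l'.
Proof.
  rewrite !is_pseries_eps. intros H H'. apply Cmod_small_eq. intros eps Heps.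
  destruct (H (eps / 2) ltac:(lra)) as [N HN]. destruct (H' (eps / 2) ltac:(lra)) as [N' HN'].
  specialize (HN (N + N')%nat ltac:(lia)). specialize (HN' (N + N')%nat ltac:(lia)).
  replace (l - l')%C with ((l - partial a z (N + N')) + - (l' - partial a z (N + N')))%C by ring.
  eapply Rle_trans; [apply Cmod_triangle|]. rewrite Cmod_opp. lra.
Qed.

Lemma eventually_bounded (x : nat -> R) (N0 : nat) (B : R) :
  (forall N, (N0 <= N)%nat -> x N <= B) -> exists M, forall N, x N <= M.
Proof.
  induction N0 as [|N0 IH] in B |- *; intros H.
  - exists B. intros N. apply H. lia.
  - apply (IH (Rmax B (x N0))). intros N HN. destruct (Nat.eq_dec N N0) as [->|Hne].
    + apply Rmax_r.
    + eapply Rle_trans; [apply H; lia|apply Rmax_l].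
Qed.

(** At the point [rho] a term is the difference of two consecutive partial sums, which are
    eventually within 1 of the limit. *)
Lemma has_expansion_subexp (f : C -> C) (a : nat -> C) : has_expansion f a -> subexp a.
Proof.
  intros H rho Hrho.
  assert (Hz : unit_disk rho) by (unfold unit_disk; rewrite Cmod_R, Rabs_pos_eq; lra).
  destruct (proj1 (is_pseries_eps _ _ _) (H _ Hz) 1 ltac:(lra)) as [N0 HN].
  apply (eventually_bounded _ N0 2). intros N HN'.
  pose proof (HN N HN') as H1. pose proof (HN (S N) ltac:(lia)) as H2.
  replace (Cmod (a N) * rho ^ N) with (Cmod (a N * RtoC rho ^ N)).
  - replace (a N * RtoC rho ^ N)%C with
      ((f rho - partial a rho N) + - (f rho - partial a rho (S N)))%C.
    + eapply Rle_trans; [apply Cmod_triangle|]. rewrite Cmod_opp. lra.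
    + unfold partial. cbn [csum]. ring.
  - rewrite Cmod_mult, Cmod_pow, Cmod_R, Rabs_pos_eq; lra.
Qed.

Lemma has_expansion_psum (f : C -> C) (a : nat -> C) (z : C) :
  has_expansion f a -> unit_disk z -> f z = psum a z.
Proof.
  intros H Hz. apply (is_pseries_unique_eps a z); [apply H, Hz|].
  apply is_pseries_psum; [apply (has_expansion_subexp f), H|exact Hz].
Qed.

(** The quantity n q^n + q^n / (1 - q) does not increase with n, and it starts at 1 / (1 - q). *)
Lemma mult_geom_le (q : R) (i : nat) : 0 <= q < 1 -> INR i * q ^ i <= / (1 - q).
Proof.
  intros Hq.
  assert (H : forall n, INR n * q ^ n + q ^ n / (1 - q) <= / (1 - q)).
  { induction n as [|n IH]; [simpl; apply Req_le; field; lra|].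
    rewrite S_INR. simpl pow. pose proof (pow_le q n (proj1 Hq)). pose proof (pos_INR n).
    eapply Rle_trans; [|exact IH].
    replace (q ^ n / (1 - q)) with (q ^ n + q * q ^ n / (1 - q)) by (field; lra).
    assert (INR n * (q * q ^ n) <= INR n * q ^ n) by (apply Rmult_le_compat_l; nra). nra. }
  specialize (H i).
  assert (0 <= q ^ i / (1 - q)).
  { apply Rmult_le_pos; [apply pow_le; lra|apply Rlt_le, Rinv_0_lt_compat; lra]. }
  lra.
Qed.

Lemma subexp_theta (a : nat -> C) : subexp a -> subexp (theta a).
Proof.
  intros Ha rho Hrho. set (r := (1 + rho) / 2). assert (Hr : rho < r < 1) by (unfold r; lra).
  destruct (Ha r ltac:(lra)) as [M HM].
  pose proof (coef_bound_nonneg a r M ltac:(lra) HM) as HM0.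
  pose proof (ratio_lt_1 rho r ltac:(lra)) as Hq.
  exists (M * / (1 - rho / r)). intros i. unfold theta.
  rewrite Cmod_mult, Cmod_R, (Rabs_pos_eq (INR i)) by apply pos_INR.
  replace (INR i * Cmod (a i) * rho ^ i)
    with ((Cmod (a i) * r ^ i) * (INR i * (rho / r) ^ i)).
  - apply Rmult_le_compat; [|apply Rmult_le_pos; [apply pos_INR|apply pow_le; lra]|apply HM|].
    + apply Rmult_le_pos; [apply Cmod_ge_0|apply pow_le; lra].
    + apply mult_geom_le, Hq.
  - unfold Rdiv. rewrite Rpow_mult_distr, pow_inv. field. apply pow_nonzero. lra.
Qed.

Definition dseries (a : nat -> C) (i : nat) : C := (INR (S i) * a (S i))%C.

Lemma subexp_dseries (a : nat -> C) : subexp a -> subexp (dseries a).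
Proof.
  intros Ha rho Hrho. destruct (subexp_theta a Ha rho Hrho) as [M HM].
  exists (M / rho). intros i. specialize (HM (S i)). unfold theta in HM. simpl pow in HM.
  unfold dseries. apply Rmult_le_reg_r with rho; [lra|].
  unfold Rdiv. rewrite (Rmult_assoc M), Rinv_l by lra. lra.
Qed.

Lemma subexp_bounded (a : nat -> C) (B : R) : (forall i, Cmod (a i) <= B) -> subexp a.
Proof.
  intros H rho Hrho. exists B. intros i. rewrite <- (Rmult_1_r B).
  apply Rmult_le_compat; [apply Cmod_ge_0|apply pow_le; lra|apply H|].
  rewrite <- (pow1 i). apply pow_incr. lra.
Qed.

Lemma Cmod_csum_geom (f : nat -> C) (M q : R) (N : nat) :
  0 <= q < 1 -> 0 <= M -> (forall i, Cmod (f i) <= M * q ^ i) ->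
  Cmod (csum f N) <= M / (1 - q).
Proof.
  intros Hq HM Hf.
  assert (H : Cmod (csum f N) <= M * (1 - q ^ N) / (1 - q)).
  { induction N as [|N IH]; cbn [csum].
    - rewrite Cmod_0. simpl. apply Req_le. field. lra.
    - eapply Rle_trans; [apply Cmod_triangle|]. specialize (Hf N).
      replace (M * (1 - q ^ S N) / (1 - q)) with (M * (1 - q ^ N) / (1 - q) + M * q ^ N)
        by (simpl; field; lra). lra. }
  eapply Rle_trans; [exact H|]. apply Rmult_le_compat_r.
  - apply Rlt_le, Rinv_0_lt_compat. lra.
  - pose proof (pow_le q N (proj1 Hq)). nra.
Qed.

(** The factor [r] on the left avoids the exponent i - 1. The remainders satisfy E_(i+1) = w E_i +
    (i + 1) z^i (w - z)^2. *)
Lemma pow_remainder_bound (z w : C) (r : R) (i : nat) :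
  0 <= r -> Cmod z <= r -> Cmod w <= r ->
  r * Cmod (w ^ S i - z ^ S i - (w - z) * (INR (S i) * z ^ i)) <=
  INR i ^ 2 * r ^ i * Cmod (w - z) ^ 2.
Proof.
  intros Hr Hz Hw. induction i as [|i IH].
  - replace (w ^ 1 - z ^ 1 - (w - z) * (INR 1 * z ^ 0))%C with (RtoC 0) by (simpl; ring).
    rewrite Cmod_0. simpl. lra.
  - replace (w ^ S (S i) - z ^ S (S i) - (w - z) * (INR (S (S i)) * z ^ S i))%C with
      (w * (w ^ S i - z ^ S i - (w - z) * (INR (S i) * z ^ i))
       + INR (S i) * z ^ i * ((w - z) * (w - z)))%C
      by (rewrite !S_INR, !RtoC_plus; simpl; ring).
    set (E := (w ^ S i - z ^ S i - (w - z) * (INR (S i) * z ^ i))%C) in *.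
    set (d := (w - z)%C) in *.
    apply Rle_trans with (r * (r * Cmod E) + r * (INR (S i) * r ^ i * Cmod d ^ 2)).
    + rewrite <- Rmult_plus_distr_l. apply Rmult_le_compat_l; [exact Hr|].
      eapply Rle_trans; [apply Cmod_triangle|]. apply Rplus_le_compat.
      * rewrite Cmod_mult. apply Rmult_le_compat_r; [apply Cmod_ge_0|exact Hw].
      * rewrite !Cmod_mult, Cmod_pow, Cmod_R, Rabs_pos_eq by apply pos_INR.
        replace (Cmod d * Cmod d) with (Cmod d ^ 2) by ring.
        apply Rmult_le_compat_r; [apply pow2_ge_0|].
        apply Rmult_le_compat_l; [apply pos_INR|].
        apply pow_incr. split; [apply Cmod_ge_0|exact Hz].
    + apply Rle_trans with (r * (INR i ^ 2 * r ^ i * Cmod d ^ 2)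
                            + r * (INR (S i) * r ^ i * Cmod d ^ 2)).
      * apply Rplus_le_compat_r, Rmult_le_compat_l; [exact Hr|exact IH].
      * rewrite S_INR. simpl (r ^ S i). pose proof (pos_INR i).
        pose proof (pow_le r i Hr). pose proof (pow2_ge_0 (Cmod d)).
        replace (r * (INR i ^ 2 * r ^ i * Cmod d ^ 2) + r * ((INR i + 1) * r ^ i * Cmod d ^ 2))
          with ((r * r ^ i * Cmod d ^ 2) * (INR i ^ 2 + INR i + 1)) by ring.
        replace ((INR i + 1) ^ 2 * (r * r ^ i) * Cmod d ^ 2)
          with ((r * r ^ i * Cmod d ^ 2) * (INR i + 1) ^ 2) by ring.
        apply Rmult_le_compat_l; [|nra].
        apply Rmult_le_pos; [apply Rmult_le_pos|]; assumption.
Qed.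

(** Termwise differentiation with an explicit quadratic remainder K |w - z|^2, uniform for |w| <= r.
    The factors i^2 from the second-order remainders are paid for by the growth bound of
    [theta (theta a)]. *)
Lemma is_Cderive_psum (a : nat -> C) (z : C) :
  subexp a -> Cmod z < 1 -> is_Cderive (psum a) z (psum (dseries a) z).
Proof.
  intros Ha Hz. pose proof (Cmod_ge_0 z) as Hz0.
  set (r := (1 + Cmod z) / 2). assert (Hr : Cmod z < r < 1) by (unfold r; lra).
  set (rho := (1 + r) / 2). assert (Hrho : r < rho < 1) by (unfold rho; lra).
  destruct (subexp_theta _ (subexp_theta _ Ha) rho ltac:(lra)) as [M HM].
  pose proof (coef_bound_nonneg _ rho M ltac:(lra) HM) as HM0.
  pose proof (ratio_lt_1 r rho ltac:(lra)) as Hq.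
  set (K := M / (1 - r / rho) / r ^ 2).
  assert (Hr2 : 0 < r ^ 2) by (apply pow_lt; lra).
  assert (HK : 0 <= K).
  { unfold K, Rdiv. repeat apply Rmult_le_pos; try lra;
      apply Rlt_le, Rinv_0_lt_compat; simpl in *; lra. }
  assert (Hmain : forall w, Cmod w <= r ->
    Cmod (psum a w - psum a z - (w - z) * psum (dseries a) z) <= K * Cmod (w - z) ^ 2).
  (* The partial sums obey the bound with the same [K]; the three tails cost [eps / 3] each. *)
  { intros w Hw. apply le_epsilon. intros eps Heps.
    destruct (psum_uniform a r (eps / 3) Ha ltac:(lra) ltac:(lra)) as [N1 HN1].
    assert (Hd : 0 < Cmod (w - z) + 1) by (pose proof (Cmod_ge_0 (w - z)); lra).
    destruct (psum_uniform (dseries a) r (eps / 3 / (Cmod (w - z) + 1))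
      (subexp_dseries _ Ha) ltac:(lra)) as [N2 HN2]; [apply Rdiv_lt_0_compat; lra|].
    set (N := (N1 + N2)%nat).
    pose proof (HN1 (S N) ltac:(unfold N; lia) w Hw) as A1.
    pose proof (HN1 (S N) ltac:(unfold N; lia) z ltac:(lra)) as A2.
    pose proof (HN2 N ltac:(unfold N; lia) z ltac:(lra)) as A3.
    set (T := (partial a w (S N) - partial a z (S N) - (w - z) * partial (dseries a) z N)%C).
    assert (HT : Cmod T <= K * Cmod (w - z) ^ 2).
    { replace T with (csum (fun i => a (S i) *
        (w ^ S i - z ^ S i - (w - z) * (INR (S i) * z ^ i)))%C N).
      - unfold K. replace (M / (1 - r / rho) / r ^ 2 * Cmod (w - z) ^ 2)
          with ((M / r ^ 2 * Cmod (w - z) ^ 2) / (1 - r / rho)) by (field; lra).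
        apply Cmod_csum_geom; [exact Hq| |].
        + apply Rmult_le_pos; [|apply pow2_ge_0]. apply Rmult_le_pos; [lra|].
          apply Rlt_le, Rinv_0_lt_compat, Hr2.
        + intros i. rewrite Cmod_mult.
          pose proof (pow_remainder_bound z w r i ltac:(lra) ltac:(lra) Hw) as B.
          set (E := Cmod (w ^ S i - z ^ S i - (w - z) * (INR (S i) * z ^ i))) in *.
          set (d2 := Cmod (w - z) ^ 2) in *.
          assert (Hd2 : 0 <= d2) by apply pow2_ge_0.
          pose proof (term_bound (theta (theta a)) rho M r r (S i) ltac:(lra) ltac:(lra) HM
            ltac:(rewrite Cmod_R, Rabs_pos_eq; lra)) as C0.
          unfold theta in C0. rewrite !Cmod_mult, Cmod_pow, !Cmod_R, (Rabs_pos_eq r),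
            Rabs_pos_eq in C0 by (try apply pos_INR; lra).
          set (ai := Cmod (a (S i))) in *. assert (Hai : 0 <= ai) by apply Cmod_ge_0.
          apply Rmult_le_reg_l with (r ^ 2); [exact Hr2|].
          replace (r ^ 2 * (M / r ^ 2 * d2 * (r / rho) ^ i)) with (M * (r / rho) ^ i * d2)
            by (field; lra).
          apply Rle_trans with (M * (r / rho) ^ S i * d2).
          * apply Rle_trans with (INR (S i) * (INR (S i) * ai) * r ^ S i * d2);
              [|apply Rmult_le_compat_r; assumption].
            apply Rle_trans with (r * ai * (INR i ^ 2 * r ^ i * d2)).
            -- replace (r ^ 2 * (ai * E)) with (r * ai * (r * E)) by ring.
               apply Rmult_le_compat_l; [apply Rmult_le_pos; lra|exact B].
            -- rewrite S_INR. simpl (r ^ S i). pose proof (pos_INR i).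
               replace (r * ai * (INR i ^ 2 * r ^ i * d2))
                 with (INR i ^ 2 * (r * r ^ i * ai * d2)) by ring.
               replace ((INR i + 1) * ((INR i + 1) * ai) * (r * r ^ i) * d2)
                 with ((INR i + 1) ^ 2 * (r * r ^ i * ai * d2)) by ring.
               apply Rmult_le_compat_r; [|nra].
               pose proof (pow_le r i ltac:(lra)).
               apply Rmult_le_pos; [apply Rmult_le_pos; [apply Rmult_le_pos|]|]; lra.
          * apply Rmult_le_compat_r; [exact Hd2|]. apply Rmult_le_compat_l; [exact HM0|].
            simpl. rewrite <- (Rmult_1_l ((r / rho) ^ i)) at 2.
            apply Rmult_le_compat_r; [apply pow_le|]; lra.
      - unfold T, partial. rewrite !csum_head. rewrite <- csum_scal.
        simpl (w ^ 0)%C. simpl (z ^ 0)%C.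
        transitivity (csum (fun i => a (S i) * w ^ S i)%C N
          + (-1) * csum (fun i => a (S i) * z ^ S i)%C N
          + (-1) * csum (fun i => (w - z) * (dseries a i * z ^ i))%C N)%C; [|ring].
        rewrite <- !csum_scal, <- !csum_plus. apply csum_ext. intros i _.
        unfold dseries. ring. }
    replace (psum a w - psum a z - (w - z) * psum (dseries a) z)%C with
      (T + (psum a w - partial a w (S N)) + - (psum a z - partial a z (S N))
       + - ((w - z) * (psum (dseries a) z - partial (dseries a) z N)))%C
      by (unfold T; ring).
    eapply Rle_trans; [apply Cmod_triangle|]. rewrite Cmod_opp, Cmod_mult.
    assert (Cmod (w - z) * Cmod (psum (dseries a) z - partial (dseries a) z N) <= eps / 3).
    { apply Rle_trans with ((Cmod (w - z) + 1) * (eps / 3 / (Cmod (w - z) + 1))).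
      - apply Rmult_le_compat; try apply Cmod_ge_0; lra.
      - apply Req_le. field. lra. }
    eapply Rle_trans; [apply Rplus_le_compat_r, Cmod_triangle|].
    eapply Rle_trans; [apply Rplus_le_compat_r, Rplus_le_compat_r, Cmod_triangle|].
    rewrite Cmod_opp. lra. }
  apply is_Cderive_eps. intros eps Heps.
  exists (Rmin (r - Cmod z) (eps / (K + 1))). split.
  { apply Rmin_glb_lt; [lra|apply Rdiv_lt_0_compat; lra]. }
  intros w Hw. pose proof (Rmin_l (r - Cmod z) (eps / (K + 1))).
  pose proof (Rmin_r (r - Cmod z) (eps / (K + 1))).
  eapply Rle_trans; [apply Hmain|].
  - replace w with (z + (w - z))%C by ring. eapply Rle_trans; [apply Cmod_triangle|]. lra.
  - simpl. rewrite Rmult_1_r, <- Rmult_assoc. apply Rmult_le_compat_r; [apply Cmod_ge_0|].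
    apply Rle_trans with ((K + 1) * (eps / (K + 1))); [|apply Req_le; field; lra].
    apply Rmult_le_compat; try apply Cmod_ge_0; lra.
Qed.

Definition series_shift (b : nat -> C) (k : nat) : C :=
  match k with O => 0 | S i => b i end.

Lemma is_pseries_shift (b : nat -> C) (z : C) :
  subexp b -> Cmod z < 1 ->
  is_Cpseries (series_shift b) z (z * psum b z)%C.
Proof.
  intros Hb Hz.
  pose proof (proj1 (is_pseries_eps _ _ _) (is_pseries_psum _ z Hb Hz)) as H.
  apply is_pseries_eps. intros eps Heps. destruct (H eps Heps) as [N0 HN].
  exists (S N0). intros [|N] HN'; [lia|]. specialize (HN N ltac:(lia)).
  replace (partial (series_shift b) z (S N)) with (z * partial b z N)%C.
  - replace (z * psum b z - z * partial b z N)%C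
      with (z * (psum b z - partial b z N))%C by ring.
    rewrite Cmod_mult. rewrite <- (Rmult_1_l eps).
    apply Rmult_le_compat; try apply Cmod_ge_0; lra.
  - unfold partial. rewrite csum_head, <- csum_scal.
    simpl series_shift. rewrite Cmult_0_l, Cplus_0_l.
    apply csum_ext. intros i _. simpl. ring.
Qed.

Lemma psum_ext (a b : nat -> C) (z : C) : (forall i, a i = b i) -> psum a z = psum b z.
Proof.
  intros H. unfold psum. f_equal; apply Series_ext; intros i; rewrite H; reflexivity.
Qed.

Lemma psum_theta (a : nat -> C) (z : C) :
  subexp a -> Cmod z < 1 -> psum (theta a) z = (z * psum (dseries a) z)%C.
Proof.
  intros Ha Hz. pose proof (subexp_dseries a Ha) as Hd.
  apply (is_pseries_unique_eps (series_shift (dseries a)) z).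
  - rewrite (psum_ext (theta a) (series_shift (dseries a))).
    + apply is_pseries_psum; [|exact Hz]. intros rho Hrho.
      destruct (subexp_theta a Ha rho Hrho) as [M HM]. exists M. intros i.
      eapply Rle_trans; [|apply (HM i)]. apply Req_le. do 2 f_equal.
      destruct i; [unfold theta; simpl; ring|reflexivity].
    + intros [|i]; [unfold theta; simpl; ring|reflexivity].
  - apply is_pseries_shift; assumption.
Qed.

Lemma is_Cderive_psum_theta (a : nat -> C) (z : C) :
  subexp a -> Cmod z < 1 -> z <> 0 -> is_Cderive (psum a) z (psum (theta a) z / z)%C.
Proof.
  intros Ha Hz Hz0. apply is_Cderive_eq with (psum (dseries a) z).
  - apply is_Cderive_psum; assumption.
  - rewrite psum_theta by assumption. field. exact Hz0.
Qed.

(** Absolute convergence justifies the Cauchy product for each of the four products of real and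
    imaginary parts. *)
Lemma psum_conv (a b : nat -> C) (z : C) :
  subexp a -> subexp b -> Cmod z < 1 -> psum (conv a b) z = (psum a z * psum b z)%C.
Proof.
  intros Ha Hb Hz.
  set (r := Cmod z). assert (Hr0 : 0 <= r) by apply Cmod_ge_0. fold r in Hz.
  set (rho := (1 + r) / 2). assert (Hrho : r < rho < 1) by (unfold rho; lra).
  pose proof (ratio_lt_1 r rho ltac:(lra)) as Hq.
  assert (Hs : forall c, subexp c ->
    ex_series (fun i => Rabs (Re (c i * z ^ i)%C)) /\
    ex_series (fun i => Rabs (Im (c i * z ^ i)%C))).
  { intros c Hc. destruct (Hc rho ltac:(lra)) as [M HM].
    assert (Ht := fun i => term_bound c rho M r z i ltac:(lra) ltac:(lra) HM (Rle_refl _)).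
    split; apply (ex_series_geom_bound _ M (r / rho) Hq); intros i;
      (eapply Rle_trans; [|apply Ht]); [apply re_le_Cmod|apply Rabs_Im_le]. }
  destruct (Hs a Ha) as [Har Hai]. destruct (Hs b Hb) as [Hbr Hbi].
  pose proof (Series_correct _ (ex_series_Rabs _ Har)) as Sar.
  pose proof (Series_correct _ (ex_series_Rabs _ Hai)) as Sai.
  pose proof (Series_correct _ (ex_series_Rabs _ Hbr)) as Sbr.
  pose proof (Series_correct _ (ex_series_Rabs _ Hbi)) as Sbi.
  assert (Hsum : forall (f : nat -> R) n, sum_f_R0 f n = rsum f (S n)).
  { intros f n. induction n as [|n IH]; simpl in *; [ring|]. rewrite IH. ring. }
  assert (Hterm : forall n, (conv a b n * z ^ n)%C =
    csum (fun k => (a k * z ^ k) * (b (n - k)%nat * z ^ (n - k)))%C (S n)).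
  { intros n. unfold conv. rewrite Cmult_comm, <- csum_scal. apply csum_ext.
    intros i Hi. replace n with (i + (n - i))%nat at 1 by lia. rewrite Cpow_add_r. ring. }
  unfold psum at 1. apply injective_projections; cbn [fst snd].
  - rewrite (Series_ext _ (fun n =>
      sum_f_R0 (fun k => Re (a k * z ^ k)%C * Re (b (n - k)%nat * z ^ (n - k))%C) n -
      sum_f_R0 (fun k => Im (a k * z ^ k)%C * Im (b (n - k)%nat * z ^ (n - k))%C) n)).
    + pose proof (is_series_minus _ _ _ _ (is_series_mult _ _ _ _ Sar Sbr Har Hbr)
                    (is_series_mult _ _ _ _ Sai Sbi Hai Hbi)) as E.
      apply is_series_unique in E. exact E.
    + intros n. rewrite Hterm, Re_csum_R, !Hsum.
      generalize (S n). intros N. induction N as [|N IH]; cbn [rsum]; [ring|].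
      rewrite IH, re_mult. ring.
  - rewrite (Series_ext _ (fun n =>
      sum_f_R0 (fun k => Re (a k * z ^ k)%C * Im (b (n - k)%nat * z ^ (n - k))%C) n +
      sum_f_R0 (fun k => Im (a k * z ^ k)%C * Re (b (n - k)%nat * z ^ (n - k))%C) n)).
    + pose proof (is_series_plus _ _ _ _ (is_series_mult _ _ _ _ Sar Sbi Har Hbi)
                    (is_series_mult _ _ _ _ Sai Sbr Hai Hbr)) as E.
      apply is_series_unique in E. exact E.
    + intros n. rewrite Hterm, Im_csum_R, !Hsum.
      generalize (S n). intros N. induction N as [|N IH]; cbn [rsum]; [ring|].
      rewrite IH, im_mult. ring.
Qed.

Lemma subexp_conv (a b : nat -> C) : subexp a -> subexp b -> subexp (conv a b).
Proof.
  intros Ha Hb rho Hrho. set (r := (1 + rho) / 2). assert (Hr : rho < r < 1) by (unfold r; lra).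
  destruct (Ha r ltac:(lra)) as [M HM]. destruct (Hb r ltac:(lra)) as [M' HM'].
  pose proof (coef_bound_nonneg a r M ltac:(lra) HM) as H0.
  pose proof (coef_bound_nonneg b r M' ltac:(lra) HM') as H0'.
  pose proof (ratio_lt_1 rho r ltac:(lra)) as Hq. set (q := rho / r) in *.
  exists (M * M' * (/ (1 - q) + 1)). intros k.
  assert (B : Cmod (conv a b k) * r ^ k <= INR (S k) * (M * M')).
  { replace (Cmod (conv a b k) * r ^ k) with (Cmod (conv a b k * RtoC r ^ k)).
    - unfold conv. rewrite Cmult_comm, <- csum_scal. apply Cmod_csum_le. intros i Hi.
      replace k with (i + (k - i))%nat at 1 by lia. rewrite Cpow_add_r.
      rewrite !Cmod_mult, !Cmod_pow, Cmod_R, Rabs_pos_eq by lra.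
      replace (_ * _) with ((Cmod (a i) * r ^ i) * (Cmod (b (k - i)%nat) * r ^ (k - i))) by ring.
      apply Rmult_le_compat; [| |apply HM|apply HM'];
        (apply Rmult_le_pos; [apply Cmod_ge_0|apply pow_le; lra]).
    - rewrite Cmod_mult, Cmod_pow, Cmod_R, Rabs_pos_eq; lra. }
  replace (Cmod (conv a b k) * rho ^ k) with ((Cmod (conv a b k) * r ^ k) * q ^ k).
  - apply Rle_trans with (INR (S k) * (M * M') * q ^ k).
    + apply Rmult_le_compat_r; [apply pow_le; lra|exact B].
    + rewrite S_INR. replace ((INR k + 1) * (M * M') * q ^ k)
        with (M * M' * (INR k * q ^ k + q ^ k)) by ring.
      apply Rmult_le_compat_l; [apply Rmult_le_pos; assumption|].
      apply Rplus_le_compat; [apply mult_geom_le, Hq|].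
      rewrite <- (pow1 k). apply pow_incr. lra.
  - unfold q, Rdiv. rewrite Rpow_mult_distr, pow_inv. field. apply pow_nonzero. lra.
Qed.

Lemma psum_0 (a : nat -> C) : subexp a -> psum a 0 = a O.
Proof.
  intros Ha. apply (is_pseries_unique_eps a 0).
  - apply is_pseries_psum; [exact Ha|]. rewrite Cmod_0. lra.
  - apply is_pseries_eps. intros eps Heps. exists 1%nat. intros [|N] HN; [lia|].
    unfold partial. rewrite csum_head, csum_0 by (intros; simpl; ring).
    replace (a O - _)%C with (RtoC 0) by (simpl; ring). rewrite Cmod_0. lra.
Qed.

(** * Fourier coefficients on circles *)

Definition cis (t : R) : C := (cos t, sin t).

Lemma cis_plus (s t : R) : cis (s + t) = (cis s * cis t)%C.
Proof. unfold cis, Cmult. simpl. rewrite cos_plus, sin_plus. f_equal; ring. Qed.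

Lemma cis_0 : cis 0 = 1.
Proof. unfold cis. rewrite cos_0, sin_0. reflexivity. Qed.

Lemma cis_conj (t : R) : Cconj (cis t) = cis (- t).
Proof. unfold cis, Cconj. simpl. rewrite cos_neg, sin_neg. reflexivity. Qed.

Lemma Cmod_cis (t : R) : Cmod (cis t) = 1.
Proof.
  transitivity (sqrt 1); [|apply sqrt_1]. unfold cis, Cmod. simpl. f_equal.
  pose proof (sin2_cos2 t) as H. unfold Rsqr in H. lra.
Qed.

Lemma cis_neq_0 (t : R) : cis t <> 0.
Proof. apply Cmod_gt_0. rewrite Cmod_cis. lra. Qed.

Lemma Cmod_circle (r t : R) : 0 <= r -> Cmod (r * cis t) = r.
Proof. intros Hr. rewrite Cmod_mult, Cmod_cis, Cmod_R, Rabs_pos_eq; lra. Qed.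

Lemma cis_pow (t : R) (i : nat) : (cis t ^ i)%C = cis (INR i * t).
Proof.
  induction i as [|i IH].
  - simpl. rewrite Rmult_0_l, cis_0. reflexivity.
  - rewrite S_INR, Rmult_plus_distr_r, cis_plus, Rmult_1_l, <- IH. simpl. ring.
Qed.

Lemma cis_period (m : Z) : cis (- (IZR m * PI)) = cis (- (IZR m * - PI)).
Proof.
  assert (Hs : sin (IZR m * PI) = 0) by (apply sin_eq_0_1; exists m; reflexivity).
  unfold cis. rewrite Ropp_mult_distr_r_reverse, Ropp_involutive, cos_neg, sin_neg, Hs.
  f_equal. ring.
Qed.

(** * Integrals and derivatives of complex functions of a real variable *)

Definition ccont (f : R -> C) : Prop :=
  forall t, continuous (T := R_UniformSpace) (U := C_UniformSpace) f t.

Definition CInt (f : R -> C) : C :=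
  (RInt (fun t => Re (f t)) (- PI) PI, RInt (fun t => Im (f t)) (- PI) PI).

Lemma ex_RInt_Re (f : R -> C) (a b : R) : ccont f -> ex_RInt (fun t => Re (f t)) a b.
Proof.
  intros H. apply (ex_RInt_continuous (V := R_CompleteNormedModule)).
  intros t _. apply continuous_Re, H.
Qed.

Lemma ex_RInt_Im (f : R -> C) (a b : R) : ccont f -> ex_RInt (fun t => Im (f t)) a b.
Proof.
  intros H. apply (ex_RInt_continuous (V := R_CompleteNormedModule)).
  intros t _. apply continuous_Im, H.
Qed.

Lemma CInt_plus (f g : R -> C) :
  ccont f -> ccont g -> CInt (fun t => f t + g t)%C = (CInt f + CInt g)%C.
Proof.
  intros Hf Hg. unfold CInt, Cplus at 3. simpl. f_equal.
  - apply (RInt_plus (V := R_CompleteNormedModule)); apply ex_RInt_Re; assumption.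
  - apply (RInt_plus (V := R_CompleteNormedModule)); apply ex_RInt_Im; assumption.
Qed.

Lemma CInt_scal (c : C) (f : R -> C) :
  ccont f -> CInt (fun t => c * f t)%C = (c * CInt f)%C.
Proof.
  intros Hf. pose proof (ex_RInt_Re f (- PI) PI Hf) as H1.
  pose proof (ex_RInt_Im f (- PI) PI Hf) as H2.
  unfold CInt. apply injective_projections; cbn [fst snd].
  - rewrite (RInt_ext _ (fun t => minus (scal (Re c) (Re (f t))) (scal (Im c) (Im (f t)))))
      by (intros; reflexivity).
    rewrite (RInt_minus (V := R_CompleteNormedModule) (fun t => scal (Re c) (Re (f t)))
      (fun t => scal (Im c) (Im (f t))))
      by (apply (ex_RInt_scal (V := R_NormedModule)); assumption).
    rewrite !(RInt_scal (V := R_CompleteNormedModule)) by assumption. reflexivity.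
  - rewrite (RInt_ext _ (fun t => plus (scal (Re c) (Im (f t))) (scal (Im c) (Re (f t)))))
      by (intros; reflexivity).
    rewrite (RInt_plus (V := R_CompleteNormedModule) (fun t => scal (Re c) (Im (f t)))
      (fun t => scal (Im c) (Re (f t))))
      by (apply (ex_RInt_scal (V := R_NormedModule)); assumption).
    rewrite !(RInt_scal (V := R_CompleteNormedModule)) by assumption. reflexivity.
Qed.

Lemma PI_range : - PI < PI.
Proof. pose proof PI_RGT_0. lra. Qed.

Lemma CInt_ext (f g : R -> C) :
  (forall t, - PI < t < PI -> f t = g t) -> CInt f = CInt g.
Proof.
  intros H. unfold CInt. pose proof PI_range.
  f_equal; apply RInt_ext; rewrite Rmin_left, Rmax_right by lra;
    intros t Ht; rewrite H by exact Ht; reflexivity.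
Qed.

(** Real and imaginary parts are estimated separately, whence the extra factor 2; it is harmless
    because the bound only serves in limits. *)
Lemma CInt_bound (f : R -> C) (B : R) :
  ccont f -> (forall t, - PI <= t <= PI -> Cmod (f t) <= B) ->
  Cmod (CInt f) <= 2 * (2 * PI * B).
Proof.
  intros Hf HB. pose proof PI_range.
  assert (G : forall u : R -> R, ex_RInt u (- PI) PI ->
     (forall t, - PI <= t <= PI -> Rabs (u t) <= B) ->
     Rabs (RInt u (- PI) PI) <= 2 * PI * B).
  { intros u Hu Hb.
    replace (2 * PI * B) with ((PI - - PI) * B) by ring.
    apply abs_RInt_le_const; [lra|exact Hu|exact Hb]. }
  eapply Rle_trans; [apply Cmod_le_Rabs|]. rewrite double.
  apply Rplus_le_compat.
  - apply (G (fun t => Re (f t))); [apply ex_RInt_Re, Hf|].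
    intros t Ht. eapply Rle_trans; [apply re_le_Cmod|apply HB, Ht].
  - apply (G (fun t => Im (f t))); [apply ex_RInt_Im, Hf|].
    intros t Ht. eapply Rle_trans; [apply Rabs_Im_le|apply HB, Ht].
Qed.

Lemma CInt_Re_nonneg (f : R -> C) :
  ccont f -> (forall t, 0 <= Re (f t)) -> 0 <= Re (CInt f).
Proof.
  intros Hf H. pose proof PI_range. apply RInt_ge_0; [lra|apply ex_RInt_Re, Hf|].
  intros t _. apply H.
Qed.

Lemma ccont_csum (f : nat -> R -> C) (N : nat) :
  (forall i, ccont (f i)) -> ccont (fun t => csum (fun i => f i t) N).
Proof.
  intros Hf t. induction N as [|N IH]; cbn [csum].
  - apply continuous_Cconst.
  - apply continuous_Cplus; [exact IH|apply Hf].
Qed.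

Lemma CInt_csum (f : nat -> R -> C) (N : nat) :
  (forall i, ccont (f i)) ->
  CInt (fun t => csum (fun i => f i t) N) = csum (fun i => CInt (f i)) N.
Proof.
  intros Hf. induction N as [|N IH]; cbn [csum].
  - unfold CInt. simpl. rewrite !RInt_const. unfold scal; simpl; unfold mult; simpl.
    unfold RtoC. f_equal; ring.
  - rewrite CInt_plus, IH; [reflexivity|apply ccont_csum, Hf|apply Hf].
Qed.

Definition is_RCderive (f : R -> C) (t : R) (v : C) : Prop :=
  is_derive (fun s => Re (f s)) t (Re v) /\ is_derive (fun s => Im (f s)) t (Im v).

Lemma is_derive_R_eps (f : R -> R) (x l : R) :
  is_derive f x l <->
  forall eps, 0 < eps -> exists del, 0 < del /\
    forall y, Rabs (y - x) < del -> Rabs (f y - f x - (y - x) * l) <= eps * Rabs (y - x).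
Proof.
  split.
  - intros [_ H] eps Heps.
    destruct (H x (fun P HP => HP) (mkposreal eps Heps)) as [del Hd].
    exists del. split; [apply cond_pos|]. intros y Hy. apply (Hd y Hy).
  - intros H. split; [apply is_linear_scal_l|].
    intros x' Hx eps. rewrite <- (is_filter_lim_locally_unique _ _ Hx).
    destruct (H eps (cond_pos eps)) as (del & Hdel & Hw).
    exists (mkposreal del Hdel). intros y Hy. apply (Hw y Hy).
Qed.

Lemma is_RCderive_eps (f : R -> C) (t : R) (v : C) :
  is_RCderive f t v <->
  forall eps, 0 < eps -> exists del, 0 < del /\
    forall s, Rabs (s - t) < del ->
      Cmod (f s - f t - (s - t)%R * v) <= eps * Rabs (s - t).
Proof.
  unfold is_RCderive. rewrite !is_derive_R_eps.
  assert (ERe : forall s, Re (f s - f t - (s - t)%R * v) = Re (f s) - Re (f t) - (s - t) * Re v).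
  { intros s. destruct (f s), (f t), v. simpl. ring. }
  assert (EIm : forall s, Im (f s - f t - (s - t)%R * v) = Im (f s) - Im (f t) - (s - t) * Im v).
  { intros s. destruct (f s), (f t), v. simpl. ring. }
  split.
  - intros [H1 H2] eps Heps. destruct (H1 (eps / 2) ltac:(lra)) as (d1 & Hd1 & K1).
    destruct (H2 (eps / 2) ltac:(lra)) as (d2 & Hd2 & K2).
    exists (Rmin d1 d2). split; [apply Rmin_glb_lt; assumption|]. intros s Hs.
    pose proof (Rmin_l d1 d2). pose proof (Rmin_r d1 d2).
    specialize (K1 s ltac:(lra)). specialize (K2 s ltac:(lra)).
    eapply Rle_trans; [apply Cmod_le_Rabs|]. rewrite ERe, EIm. lra.
  - intros H. split; intros eps Heps; destruct (H eps Heps) as (d & Hd & K);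
      exists d; (split; [exact Hd|]); intros s Hs; specialize (K s Hs).
    + rewrite <- ERe. eapply Rle_trans; [apply re_le_Cmod|exact K].
    + rewrite <- EIm. eapply Rle_trans; [apply Rabs_Im_le|exact K].
Qed.

Lemma is_RCderive_comp (g : C -> C) (f : R -> C) (t : R) (l v : C) :
  is_Cderive g (f t) l -> is_RCderive f t v ->
  is_RCderive (fun s => g (f s)) t (l * v)%C.
Proof.
  rewrite is_Cderive_eps, !is_RCderive_eps. intros Hg Hf eps Heps.
  pose proof (Cmod_ge_0 l) as Hl. pose proof (Cmod_ge_0 v) as Hv.
  set (e1 := Rmin 1 (eps / (2 * (Cmod v + 1)))).
  assert (He1 : 0 < e1) by (apply Rmin_glb_lt; [lra|apply Rdiv_lt_0_compat; lra]).
  set (e2 := Rmin 1 (eps / (2 * (Cmod l + 1)))).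
  assert (He2 : 0 < e2) by (apply Rmin_glb_lt; [lra|apply Rdiv_lt_0_compat; lra]).
  destruct (Hg e1 He1) as (d1 & Hd1 & K1). destruct (Hf e2 He2) as (d2 & Hd2 & K2).
  exists (Rmin d2 (d1 / (Cmod v + 1))). split.
  { apply Rmin_glb_lt; [exact Hd2|apply Rdiv_lt_0_compat; lra]. }
  intros s Hs. pose proof (Rmin_l d2 (d1 / (Cmod v + 1))).
  pose proof (Rmin_r d2 (d1 / (Cmod v + 1))). specialize (K2 s ltac:(lra)).
  pose proof (Rabs_pos (s - t)) as Hst.
  assert (Hinc : Cmod (f s - f t) <= (Cmod v + 1) * Rabs (s - t)).
  { replace (f s - f t)%C with ((f s - f t - (s - t)%R * v) + (s - t)%R * v)%C by ring.
    eapply Rle_trans; [apply Cmod_triangle|]. rewrite Cmod_mult, Cmod_R.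
    assert (e2 * Rabs (s - t) <= 1 * Rabs (s - t)).
    { apply Rmult_le_compat_r; [exact Hst|apply Rmin_l]. } lra. }
  assert (Hlt : Cmod (f s - f t) < d1).
  { eapply Rle_lt_trans; [exact Hinc|].
    replace d1 with ((Cmod v + 1) * (d1 / (Cmod v + 1))) by (field; lra).
    apply Rmult_lt_compat_l; lra. }
  specialize (K1 (f s) Hlt).
  replace (g (f s) - g (f t) - (s - t)%R * (l * v))%C with
    ((g (f s) - g (f t) - (f s - f t) * l) + (f s - f t - (s - t)%R * v) * l)%C by ring.
  eapply Rle_trans; [apply Cmod_triangle|]. rewrite Cmod_mult.
  assert (A1 : e1 * Cmod (f s - f t) <= eps / 2 * Rabs (s - t)).
  { apply Rle_trans with (eps / (2 * (Cmod v + 1)) * ((Cmod v + 1) * Rabs (s - t))).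
    - apply Rmult_le_compat; [lra|apply Cmod_ge_0|apply Rmin_r|exact Hinc].
    - apply Req_le. field. lra. }
  assert (A2 : Cmod (f s - f t - (s - t)%R * v) * Cmod l <= eps / 2 * Rabs (s - t)).
  { apply Rle_trans with ((eps / (2 * (Cmod l + 1)) * Rabs (s - t)) * (Cmod l + 1)).
    - apply Rmult_le_compat; [apply Cmod_ge_0|exact Hl| |lra].
      eapply Rle_trans; [exact K2|]. apply Rmult_le_compat_r; [exact Hst|apply Rmin_r].
    - apply Req_le. field. lra. }
  lra.
Qed.

Lemma is_RCderive_mult (f g : R -> C) (t : R) (df dg : C) :
  is_RCderive f t df -> is_RCderive g t dg ->
  is_RCderive (fun s => f s * g s)%C t (df * g t + f t * dg)%C.
Proof.
  intros [F1 F2] [G1 G2].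
  assert (P : forall (u v : R -> R) du dv, is_derive u t du -> is_derive v t dv ->
     is_derive (fun s => u s * v s) t (du * v t + u t * dv)).
  { intros u v du dv Hu Hv. apply (is_derive_mult (K := R_AbsRing) u v t du dv Hu Hv Rmult_comm). }
  split.
  - replace (Re (df * g t + f t * dg)) with
      ((Re df * Re (g t) + Re (f t) * Re dg) - (Im df * Im (g t) + Im (f t) * Im dg))
      by (destruct df, dg, (f t), (g t); simpl; ring).
    apply (is_derive_minus (K := R_AbsRing) (V := R_NormedModule)
      (fun s => Re (f s) * Re (g s)) (fun s => Im (f s) * Im (g s))); apply P; assumption.
  - replace (Im (df * g t + f t * dg)) with
      ((Re df * Im (g t) + Re (f t) * Im dg) + (Im df * Re (g t) + Im (f t) * Re dg))
      by (destruct df, dg, (f t), (g t); simpl; ring).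
    apply (is_derive_plus (K := R_AbsRing) (V := R_NormedModule)
      (fun s => Re (f s) * Im (g s)) (fun s => Im (f s) * Re (g s))); apply P; assumption.
Qed.

Lemma is_RCderive_cis_lin (c t : R) : is_RCderive (fun s => cis (c * s)) t (c * Ci * cis (c * t))%C.
Proof. split; unfold cis; simpl; auto_derive; trivial; ring. Qed.

Lemma is_RCderive_const (c : C) (t : R) : is_RCderive (fun _ => c) t 0.
Proof. split; apply (is_derive_const (K := R_AbsRing) (V := R_NormedModule)). Qed.

Lemma is_RCderive_RtoC (t : R) : is_RCderive (fun s => RtoC s) t 1.
Proof. split; simpl; auto_derive; trivial. Qed.

Lemma is_RCderive_eq (f : R -> C) (t : R) (v v' : C) :
  is_RCderive f t v -> v = v' -> is_RCderive f t v'.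
Proof. intros H <-. exact H. Qed.

Lemma CInt_derive (f df : R -> C) :
  (forall t, is_RCderive f t (df t)) -> ccont df -> CInt df = (f PI - f (- PI)%R)%C.
Proof.
  intros Hf Hc. unfold CInt. apply injective_projections; cbn [fst snd];
    apply (is_RInt_unique (V := R_CompleteNormedModule)).
  - apply (is_RInt_derive (V := R_CompleteNormedModule) (fun t => Re (f t))).
    + intros t _. apply Hf.
    + intros t _. apply continuous_Re, Hc.
  - apply (is_RInt_derive (V := R_CompleteNormedModule) (fun t => Im (f t))).
    + intros t _. apply Hf.
    + intros t _. apply continuous_Im, Hc.
Qed.

(** Differentiation under the integral sign, done on real and imaginary parts; joint continuity of
    the derivative is required only on the segment at parameter [r0]. *)
Lemma CInt_param_derive (F dF : R -> R -> C) (r0 d : R) :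
  0 < d ->
  (forall r t, Rabs (r - r0) < d -> is_RCderive (fun s => F s t) r (dF r t)) ->
  (forall t, continuous (T := R2)
     (U := C_UniformSpace) (fun p => dF (fst p) (snd p)) (r0, t)) ->
  (forall r, Rabs (r - r0) < d -> ccont (F r)) ->
  is_RCderive (fun r => CInt (F r)) r0 (CInt (dF r0)).
Proof.
  intros Hd Hder Hcont HF.
  assert (G : forall (p : C -> R), (p = Re \/ p = Im) ->
    is_derive (fun r => RInt (fun t => p (F r t)) (- PI) PI) r0
              (RInt (fun t => p (dF r0 t)) (- PI) PI)).
  { intros p Hp.
    assert (Hp1 : forall r t, Rabs (r - r0) < d -> is_derive (fun s => p (F s t)) r (p (dF r t))).
    { intros r t Hr. destruct Hp as [-> | ->]; apply Hder, Hr. }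
    rewrite (RInt_ext (fun t => p (dF r0 t)) (fun t => Derive (fun u => p (F u t)) r0)).
    2:{ intros t _. symmetry. apply is_derive_unique, Hp1.
        rewrite Rminus_diag, Rabs_R0. exact Hd. }
    apply (is_derive_RInt_param (fun r t => p (F r t))).
    - exists (mkposreal d Hd). intros r Hr t _. eexists. apply Hp1, Hr.
    - intros t _. apply continuity_2d_pt_ext_loc with (fun u v => p (dF u v)).
      + exists (mkposreal d Hd). intros u v Hu _. symmetry. apply is_derive_unique, Hp1, Hu.
      + apply continuity_2d_pt_filterlim.
        assert (K : continuous (T := R2)
          (fun q => p (dF (fst q) (snd q))) (r0, t)).
        { destruct Hp as [-> | ->]; [apply continuous_Re|apply continuous_Im]; apply Hcont. }
        exact K.
    - exists (mkposreal d Hd). intros r Hr.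
      destruct Hp as [-> | ->]; [apply ex_RInt_Re|apply ex_RInt_Im]; apply HF, Hr. }
  split; apply G; auto.
Qed.

Lemma continuous_cis_comp {T : UniformSpace} (u : T -> R) (x : T) :
  continuous u x -> continuous (U := C_UniformSpace) (fun y => cis (u y)) x.
Proof.
  intros Hu. apply continuous_Cpair.
  - apply (continuous_comp u cos); [exact Hu|].
    apply continuity_pt_filterlim, derivable_continuous_pt, derivable_pt_cos.
  - apply (continuous_comp u sin); [exact Hu|].
    apply continuity_pt_filterlim, derivable_continuous_pt, derivable_pt_sin.
Qed.

Lemma continuous_RtoC_comp {T : UniformSpace} (u : T -> R) (x : T) :
  continuous u x -> continuous (U := C_UniformSpace) (fun y => RtoC (u y)) x.
Proof. intros Hu. apply continuous_Cpair; [exact Hu|apply continuous_const]. Qed.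

Lemma continuous_C_comp {T : UniformSpace} (f : T -> C) (g : C -> C) (x : T) :
  continuous (U := C_UniformSpace) f x ->
  Ccontinuous g (f x) ->
  continuous (U := C_UniformSpace) (fun y => g (f y)) x.
Proof. intros Hf Hg. apply (continuous_comp (V := C_UniformSpace) f g); assumption. Qed.

Lemma continuous_lin (c t : R) : continuous (fun s : R => c * s) t.
Proof. apply (ex_derive_continuous (V := R_NormedModule)). auto_derive. trivial. Qed.

Lemma ccont_circle (g : C -> C) (r : R) :
  (forall t, Ccontinuous g (r * cis t)%C) ->
  ccont (fun t => g (r * cis t)%C).
Proof.
  intros Hg t. apply (continuous_C_comp (fun t => r * cis t)%C); [|apply Hg].
  apply continuous_Cmult; [apply continuous_Cconst|].
  apply continuous_cis_comp, continuous_id.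
Qed.

Lemma ccont_mult (f g : R -> C) : ccont f -> ccont g -> ccont (fun t => f t * g t)%C.
Proof. intros Hf Hg t. apply continuous_Cmult; [apply Hf|apply Hg]. Qed.

Lemma ccont_const (c : C) : ccont (fun _ => c).
Proof. intros t. apply continuous_Cconst. Qed.

Lemma ccont_cis (c : R) : ccont (fun t => cis (c * t)).
Proof. intros t. apply continuous_cis_comp, continuous_lin. Qed.

(** The Fourier coefficient of [g] on the circle of radius [r]. There is no division by r^m: a term
    c z^m has coefficient c r^m. *)
Definition circle_coef (r : R) (g : C -> C) (m : Z) : C :=
  (/ (2 * PI)%R * CInt (fun t => g (r * cis t) * cis (- IZR m * t)))%C.

Definition circle_cont (r : R) (g : C -> C) : Prop :=
  forall z, Cmod z = r -> Ccontinuous g z.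

Lemma circle_cont_ccont (r : R) (g : C -> C) :
  0 <= r -> circle_cont r g -> ccont (fun t => g (r * cis t)%C).
Proof. intros Hr Hg. apply ccont_circle. intros t. apply Hg, Cmod_circle, Hr. Qed.

Lemma circle_coef_ccont (r : R) (g : C -> C) (m : Z) :
  0 <= r -> circle_cont r g -> ccont (fun t => g (r * cis t) * cis (- IZR m * t))%C.
Proof.
  intros Hr Hg. apply ccont_mult; [apply circle_cont_ccont; assumption|apply ccont_cis].
Qed.

Lemma two_PI_C_neq_0 : RtoC (2 * PI) <> 0.
Proof. apply RtoC_neq_0. pose proof PI_RGT_0. lra. Qed.

Lemma circle_coef_ext (r : R) (g h : C -> C) (m : Z) :
  (forall t, - PI < t < PI -> g (r * cis t)%C = h (r * cis t)%C) ->
  circle_coef r g m = circle_coef r h m.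
Proof.
  intros H. unfold circle_coef. f_equal. apply CInt_ext. intros t Ht. rewrite H by exact Ht.
  reflexivity.
Qed.

Lemma circle_coef_plus (r : R) (g h : C -> C) (m : Z) :
  0 <= r -> circle_cont r g -> circle_cont r h ->
  circle_coef r (fun z => g z + h z)%C m = (circle_coef r g m + circle_coef r h m)%C.
Proof.
  intros Hr Hg Hh. unfold circle_coef. rewrite <- Cmult_plus_distr_l, <- CInt_plus
    by (apply circle_coef_ccont; assumption).
  f_equal. apply CInt_ext. intros; ring.
Qed.

Lemma circle_coef_scal (r : R) (c : C) (g : C -> C) (m : Z) :
  0 <= r -> circle_cont r g ->
  circle_coef r (fun z => c * g z)%C m = (c * circle_coef r g m)%C.
Proof.
  intros Hr Hg. unfold circle_coef.
  rewrite (CInt_ext _ (fun t => c * (g (r * cis t) * cis (- IZR m * t)))%C) by (intros; ring).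
  rewrite CInt_scal by (apply circle_coef_ccont; assumption). ring.
Qed.

Lemma circle_coef_bound (r : R) (g : C -> C) (m : Z) (B : R) :
  0 <= r -> circle_cont r g -> (forall z, Cmod z = r -> Cmod (g z) <= B) ->
  Cmod (circle_coef r g m) <= 2 * B.
Proof.
  intros Hr Hg HB. pose proof PI_RGT_0 as HPI. unfold circle_coef.
  rewrite Cmod_mult, Cmod_inv, Cmod_R, Rabs_pos_eq by (try apply two_PI_C_neq_0; lra).
  apply Rmult_le_reg_l with (2 * PI); [lra|]. rewrite <- Rmult_assoc, Rinv_r, Rmult_1_l by lra.
  replace (2 * PI * (2 * B)) with (2 * (2 * PI * B)) by ring.
  apply CInt_bound; [apply circle_coef_ccont; assumption|]. intros t _.
  rewrite Cmod_mult, Cmod_cis, Rmult_1_r. apply HB, Cmod_circle, Hr.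
Qed.

Lemma circle_cont_mult (r : R) (g h : C -> C) :
  circle_cont r g -> circle_cont r h -> circle_cont r (fun z => g z * h z)%C.
Proof. intros Hg Hh z Hz. apply continuous_Cmult; [apply Hg|apply Hh]; exact Hz. Qed.

Lemma circle_cont_plus (r : R) (g h : C -> C) :
  circle_cont r g -> circle_cont r h -> circle_cont r (fun z => g z + h z)%C.
Proof. intros Hg Hh z Hz. apply continuous_Cplus; [apply Hg|apply Hh]; exact Hz. Qed.

Lemma circle_cont_const (r : R) (c : C) : circle_cont r (fun _ => c).
Proof. intros z _. apply continuous_Cconst. Qed.

Lemma circle_cont_pow (r : R) (i : nat) : circle_cont r (fun z => z ^ i)%C.
Proof.
  intros z Hz. induction i as [|i IH]; simpl.
  - apply continuous_Cconst.
  - apply continuous_Cmult; [apply continuous_id|exact IH].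
Qed.

Lemma circle_coef_pow_mult (r : R) (g : C -> C) (i : nat) (m : Z) :
  0 <= r -> circle_cont r g ->
  circle_coef r (fun z => z ^ i * g z)%C m = (RtoC r ^ i * circle_coef r g (m - Z.of_nat i))%C.
Proof.
  intros Hr Hg. unfold circle_coef.
  rewrite (CInt_ext _ (fun t => RtoC r ^ i *
    (g (r * cis t) * cis (- IZR (m - Z.of_nat i) * t)))%C).
  - rewrite CInt_scal by (apply circle_coef_ccont; assumption). ring.
  - intros t _. rewrite Cpow_mult_l, cis_pow, minus_IZR, <- INR_IZR_INZ.
    replace (- (IZR m - INR i) * t) with (INR i * t + - IZR m * t) by ring.
    rewrite cis_plus. ring.
Qed.

Lemma circle_bounded (r : R) (g : C -> C) :
  0 <= r -> circle_cont r g -> exists B, 0 <= B /\ forall t, - PI <= t <= PI ->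
    Cmod (g (r * cis t)%C) <= B.
Proof.
  intros Hr Hg.
  assert (Hc : forall t, continuity_pt (fun t => Cmod (g (r * cis t)%C)) t).
  { intros t. apply continuity_pt_filterlim.
    apply (continuous_comp (V := C_UniformSpace) (fun t => g (r * cis t)%C) Cmod).
    - apply circle_cont_ccont; assumption.
    - apply continuous_Cmod. }
  pose proof PI_range.
  destruct (continuity_ab_maj _ (- PI) PI ltac:(lra) (fun t _ => Hc t)) as (t0 & H0 & _).
  eexists. split; [apply Cmod_ge_0|exact H0].
Qed.

(** A product in which only one factor is given as a power series. Its partial sums converge
    uniformly on the circle, and terms with [i > m] contribute nothing because the negative
    coefficients of [g] vanish. *)
Lemma circle_coef_psum_mult (a : nat -> C) (g : C -> C) (r : R) (m : nat) :
  subexp a -> 0 <= r < 1 -> circle_cont r g ->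
  (forall j, (j < 0)%Z -> circle_coef r g j = 0) ->
  circle_coef r (fun z => psum a z * g z)%C (Z.of_nat m) =
  csum (fun i => a i * RtoC r ^ i * circle_coef r g (Z.of_nat (m - i)))%C (S m).
Proof.
  intros Ha Hr Hg Hneg.
  destruct (circle_bounded r g ltac:(lra) Hg) as (B & HB0 & HB).
  assert (Hpart : forall N, circle_cont r (fun z => partial a z N * g z)%C).
  { intros N. apply circle_cont_mult; [|exact Hg]. intros z Hz. unfold partial.
    induction N as [|N IH]; cbn [csum]; [apply continuous_Cconst|].
    apply continuous_Cplus; [exact IH|].
    apply continuous_Cmult; [apply continuous_Cconst|apply (circle_cont_pow r N); exact Hz]. }
  assert (Hps : circle_cont r (psum a)).
  { intros z Hz. apply (is_Cderive_continuity _ _ _ (is_Cderive_psum a z Ha ltac:(lra))). }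
  assert (E : forall N, circle_coef r (fun z => partial a z N * g z)%C (Z.of_nat m) =
    csum (fun i => a i * RtoC r ^ i * circle_coef r g (Z.of_nat m - Z.of_nat i))%C N).
  { induction N as [|N IH].
    - unfold partial. cbn [csum].
      transitivity (circle_coef r (fun z => 0 * g z)%C (Z.of_nat m)); [reflexivity|].
      rewrite circle_coef_scal by (assumption || lra). ring.
    - cbn [csum]. rewrite <- IH.
      transitivity (circle_coef r (fun z => partial a z N * g z + a N * (z ^ N * g z))%C
                      (Z.of_nat m)).
      + apply circle_coef_ext. intros t _. unfold partial. cbn [csum]. ring.
      + assert (Hz : circle_cont r (fun z => z ^ N * g z)%C)
          by (apply circle_cont_mult; [apply circle_cont_pow|exact Hg]).
        rewrite circle_coef_plus, circle_coef_scal, circle_coef_pow_mult; try assumption;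
          try lra; [ring|apply Hpart|].
        apply (circle_cont_mult r (fun _ => a N)); [apply circle_cont_const|exact Hz]. }
  apply Cmod_small_eq. intros eps Heps.
  destruct (psum_uniform a r (eps / (2 * (B + 1))) Ha Hr) as [N0 HN];
    [apply Rdiv_lt_0_compat; lra|].
  set (N := (S m + N0)%nat).
  assert (EN : csum (fun i => a i * RtoC r ^ i * circle_coef r g (Z.of_nat (m - i)))%C (S m)
    = circle_coef r (fun z => partial a z N * g z)%C (Z.of_nat m)).
  { rewrite E. unfold N. clear HN N. induction N0 as [|N0 IH].
    - rewrite Nat.add_0_r. apply csum_ext. intros i Hi. do 2 f_equal. lia.
    - rewrite Nat.add_succ_r. cbn [csum] in *. rewrite IH, (Hneg (_ - _)%Z) by lia. ring. }
  rewrite EN.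
  replace (circle_coef r (fun z => psum a z * g z)%C (Z.of_nat m)
     - circle_coef r (fun z => partial a z N * g z)%C (Z.of_nat m))%C with
    (circle_coef r (fun z => psum a z * g z + -1 * (partial a z N * g z))%C (Z.of_nat m)).
  - unfold circle_coef. pose proof PI_RGT_0.
    rewrite Cmod_mult, Cmod_inv, Cmod_R, Rabs_pos_eq by (try apply two_PI_C_neq_0; lra).
    apply Rmult_le_reg_l with (2 * PI); [lra|].
    rewrite <- Rmult_assoc, Rinv_r, Rmult_1_l by lra.
    apply Rle_trans with (2 * (2 * PI * (eps / (2 * (B + 1)) * (B + 1)))).
    + apply CInt_bound.
      * apply (circle_coef_ccont r (fun z => psum a z * g z + -1 * (partial a z N * g z))%C);
          [lra|]. apply circle_cont_plus; [apply circle_cont_mult; assumption|].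
        apply (circle_cont_mult r (fun _ => (-1)%C)); [apply circle_cont_const|apply Hpart].
      * intros t Ht. rewrite Cmod_mult, Cmod_cis, Rmult_1_r.
        replace (psum a (r * cis t) * g (r * cis t) +
          -1 * (partial a (r * cis t) N * g (r * cis t)))%C with
          ((psum a (r * cis t) - partial a (r * cis t) N) * g (r * cis t))%C by ring.
        rewrite Cmod_mult. specialize (HB t Ht).
        apply Rmult_le_compat; try apply Cmod_ge_0; [|lra].
        apply HN; [unfold N; lia|]. rewrite Cmod_circle; lra.
    + apply Req_le. field. lra.
  - rewrite (circle_coef_plus r (fun z => psum a z * g z)%C
      (fun z => -1 * (partial a z N * g z))%C); [|lra| |].
    + rewrite (circle_coef_scal r (-1)%C (fun z => partial a z N * g z)%C); [ring|lra|apply Hpart].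
    + apply circle_cont_mult; assumption.
    + apply (circle_cont_mult r (fun _ => (-1)%C)); [apply circle_cont_const|apply Hpart].
Qed.

(** * Dependence of the Fourier coefficients on the index and on the radius *)

Definition punctured (z : C) : Prop := 0 < Cmod z < 1.

(** Here [gt] is z g'. The origin is left out because 1/f, which has a pole there, will occur in
    [gt]. *)
Definition theta_on (g gt : C -> C) : Prop :=
  forall z, punctured z -> is_Cderive g z (gt z / z)%C /\
    Ccontinuous gt z.

Lemma theta_on_cont (g gt : C -> C) (r : R) :
  theta_on g gt -> 0 < r < 1 -> circle_cont r g.
Proof.
  intros H Hr z Hz. apply (is_Cderive_continuity g z (gt z / z)%C), H.
  unfold punctured. lra.
Qed.

Lemma theta_on_cont_theta (g gt : C -> C) (r : R) :
  theta_on g gt -> 0 < r < 1 -> circle_cont r gt.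
Proof. intros H Hr z Hz. apply H. unfold punctured. lra. Qed.

Lemma punctured_circle (r t : R) : 0 < r < 1 -> punctured (r * cis t).
Proof. intros Hr. unfold punctured. rewrite Cmod_circle; lra. Qed.

(** Integration by parts over a period: g(r e^(it)) e^(-imt) agrees at both ends, and its derivative
    in t is i (gt - m g) e^(-imt). *)
Lemma circle_coef_theta (g gt : C -> C) (r : R) (m : Z) :
  theta_on g gt -> 0 < r < 1 -> circle_coef r gt m = (IZR m * circle_coef r g m)%C.
Proof.
  intros H Hr. pose proof (theta_on_cont g gt r H Hr) as Hg.
  pose proof (theta_on_cont_theta g gt r H Hr) as Hgt.
  pose proof (circle_coef_ccont r g m ltac:(lra) Hg) as C1.
  pose proof (circle_coef_ccont r gt m ltac:(lra) Hgt) as C2.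
  assert (E : CInt (fun t => Ci * (gt (r * cis t) * cis (- IZR m * t)) +
                (- IZR m)%R * Ci * (g (r * cis t) * cis (- IZR m * t)))%C = 0).
  { rewrite (CInt_derive (fun t => g (r * cis t) * cis (- IZR m * t))%C).
    - assert (P1 : cis PI = cis (- PI)).
      { pose proof (cis_period (-1)) as P. rewrite !Ropp_mult_distr_l in P.
        replace (- -1) with 1 in P by ring. rewrite !Rmult_1_l in P. exact P. }
      pose proof (cis_period m) as P2.
      rewrite P1. replace (- IZR m * PI) with (- (IZR m * PI)) by ring.
      replace (- IZR m * - PI) with (- (IZR m * - PI)) by ring. rewrite P2. ring.
    - intros t. eapply is_RCderive_eq.
      + apply is_RCderive_mult; [|apply is_RCderive_cis_lin].
        apply (is_RCderive_comp g (fun t => r * cis t)%C).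
        * apply H, punctured_circle, Hr.
        * apply is_RCderive_mult; [apply is_RCderive_const|].
          pose proof (is_RCderive_cis_lin 1 t) as D. destruct D as [D1 D2].
          split; [eapply is_derive_ext; [|exact D1]|eapply is_derive_ext; [|exact D2]];
            intros s; simpl; rewrite Rmult_1_l; reflexivity.
      + rewrite Rmult_1_l. pose proof (cis_neq_0 t).
        assert (RtoC r <> 0) by (apply RtoC_neq_0; lra).
        field. split; assumption.
    - intros t. apply continuous_Cplus; apply continuous_Cmult;
        try apply continuous_Cconst; [apply C2|apply C1]. }
  rewrite (CInt_plus (fun t => Ci * (gt (r * cis t) * cis (- IZR m * t)))%C
    (fun t => (- IZR m)%R * Ci * (g (r * cis t) * cis (- IZR m * t)))%C), !CInt_scal in E
    by (try assumption; apply ccont_mult; try apply ccont_const; assumption).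
  rewrite RtoC_opp in E. unfold circle_coef.
  transitivity (/ (2 * PI)%R * (/ Ci * (Ci * CInt (fun t => gt (r * cis t) * cis (- IZR m * t)) +
    - IZR m * Ci * CInt (fun t => g (r * cis t) * cis (- IZR m * t)))
    + IZR m * CInt (fun t => g (r * cis t) * cis (- IZR m * t))))%C.
  - field. split; (apply Ci_nz || apply two_PI_C_neq_0).
  - rewrite E. field. split; [apply two_PI_C_neq_0|apply Ci_nz].
Qed.

(** On a complex differentiable function r d/dr and -i d/dt coincide, so the radial derivative of a
    coefficient is the coefficient of [gt] divided by [r]. *)
Lemma circle_coef_radius_derive (g gt : C -> C) (r : R) (m : Z) :
  theta_on g gt -> 0 < r < 1 ->
  is_RCderive (fun s => circle_coef s g m) r (IZR m * circle_coef r g m / r)%C.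
Proof.
  intros H Hr. rewrite <- (circle_coef_theta g gt r m H Hr).
  pose proof (circle_coef_ccont r gt m ltac:(lra) (theta_on_cont_theta g gt r H Hr)) as C2.
  assert (Hr0 : RtoC r <> 0) by (apply RtoC_neq_0; lra).
  set (d := Rmin r (1 - r)). assert (Hd : 0 < d) by (apply Rmin_glb_lt; lra).
  assert (Hdr : forall s, Rabs (s - r) < d -> 0 < s < 1).
  { intros s Hs. pose proof (Rmin_l r (1 - r)) as A1. pose proof (Rmin_r r (1 - r)) as A2.
    fold d in A1, A2. apply Rabs_lt_between in Hs. lra. }
  assert (D := CInt_param_derive (fun s t => g (s * cis t) * cis (- IZR m * t))%C
    (fun s t => (/ s)%R * (gt (s * cis t) * cis (- IZR m * t)))%C r d Hd).
  eapply is_RCderive_eq.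
  - apply is_RCderive_mult; [apply is_RCderive_const|apply D; clear D].
    + intros s t Hs. specialize (Hdr s Hs). eapply is_RCderive_eq.
      * apply is_RCderive_mult; [|apply is_RCderive_const].
        apply (is_RCderive_comp g (fun s => s * cis t)%C).
        -- apply H, punctured_circle, Hdr.
        -- apply is_RCderive_mult; [apply is_RCderive_RtoC|apply is_RCderive_const].
      * assert (Hs0 : RtoC s <> 0) by (apply RtoC_neq_0; lra).
        pose proof (cis_neq_0 t). rewrite RtoC_inv by lra. field. split; assumption.
    + intros t. apply continuous_Cmult.
      * apply (continuous_RtoC_comp (T := R2)
          (fun p => / fst p)).
        apply (continuous_comp (U := R2)
          (V := R_UniformSpace) (W := R_UniformSpace) (fun p => fst p) Rinv).
        -- apply continuous_fst.
        -- apply continuity_pt_filterlim, continuity_pt_inv;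
             [apply derivable_continuous_pt, derivable_pt_id|unfold id; simpl; lra].
      * apply continuous_Cmult.
        -- apply (continuous_C_comp (T := R2)
             (fun p => fst p * cis (snd p))%C gt).
           ++ apply continuous_Cmult.
              ** apply (continuous_RtoC_comp
                  (T := R2) (fun p => fst p)).
                 apply continuous_fst.
              ** apply (continuous_cis_comp
                  (T := R2) (fun p => snd p)).
                 apply continuous_snd.
           ++ apply H, punctured_circle, Hr.
        -- apply (continuous_cis_comp
             (T := R2) (fun p => - IZR m * snd p)).
           apply (continuous_comp (U := R2)
             (V := R_UniformSpace) (W := R_UniformSpace) (fun p => snd p) (fun x => - IZR m * x)).
           ++ apply continuous_snd.
           ++ apply continuous_lin.
    + intros s Hs. specialize (Hdr s Hs).
      apply circle_coef_ccont; [lra|apply (theta_on_cont g gt s H Hdr)].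
  - rewrite CInt_scal by exact C2. unfold circle_coef. rewrite RtoC_inv by lra.
    field. split; (exact Hr0 || apply two_PI_C_neq_0).
Qed.

(** Integrates the radial equation, whose solutions are multiples of r^m. Writing [m] as minus [j]
    keeps the exponent a natural number, and only indices [m <= 0] are needed. *)
Lemma circle_coef_radius (g gt : C -> C) (r s : R) (j : nat) :
  theta_on g gt -> 0 < s < r -> r < 1 ->
  (RtoC (r ^ j) * circle_coef r g (- Z.of_nat j))%C =
  (RtoC (s ^ j) * circle_coef s g (- Z.of_nat j))%C.
Proof.
  intros H Hs Hr. set (m := (- Z.of_nat j)%Z).
  pose (F := fun x => (RtoC (x ^ j) * circle_coef x g m)%C).
  assert (D : forall x, s <= x <= r -> is_RCderive F x 0).
  { intros x Hx. eapply is_RCderive_eq.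
    - apply is_RCderive_mult; [|apply (circle_coef_radius_derive g gt x m H); lra].
      instantiate (1 := RtoC (INR j * x ^ pred j)).
      split; simpl; auto_derive; trivial. ring.
    - assert (Hx0 : RtoC x <> 0) by (apply RtoC_neq_0; lra).
      unfold m. rewrite opp_IZR, <- INR_IZR_INZ, RtoC_mult, RtoC_opp.
      destruct j as [|j].
      + simpl INR. field. exact Hx0.
      + simpl pred. replace (x ^ S j) with (x * x ^ j) by reflexivity.
        rewrite RtoC_mult. field. exact Hx0. }
  symmetry. change (F s = F r). apply injective_projections.
  - apply (eq_is_derive (V := R_NormedModule) (fun x => Re (F x))); [|lra].
    intros t Ht. apply D, Ht.
  - apply (eq_is_derive (V := R_NormedModule) (fun x => Im (F x))); [|lra].
    intros t Ht. apply D, Ht.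
Qed.

Lemma circle_coef_const_0 (r : R) (c : C) : circle_coef r (fun _ => c) 0 = c.
Proof.
  unfold circle_coef.
  rewrite (CInt_ext _ (fun t => c * 1)%C).
  - rewrite CInt_scal by apply ccont_const. unfold CInt. simpl.
    rewrite !RInt_const. unfold scal; simpl; unfold mult; simpl.
    replace ((PI - - PI) * 1, (PI - - PI) * 0) with (RtoC (2 * PI))
      by (unfold RtoC; f_equal; ring).
    field. apply two_PI_C_neq_0.
  - intros t _. replace (- IZR 0 * t) with 0 by (simpl; ring). rewrite cis_0. reflexivity.
Qed.

Lemma theta_on_const (c : C) : theta_on (fun _ => c) (fun _ => 0).
Proof.
  intros z Hz. split; [|apply continuous_Cconst].
  apply is_Cderive_eq with (RtoC 0); [apply is_Cderive_const|].
  field. apply Cmod_gt_0, Hz.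
Qed.

Lemma circle_coef_const (r : R) (c : C) (m : Z) :
  0 < r < 1 -> m <> 0%Z -> circle_coef r (fun _ => c) m = 0.
Proof.
  intros Hr Hm. pose proof (circle_coef_theta _ _ r m (theta_on_const c) Hr) as E.
  assert (Hz : circle_coef r (fun _ => 0) m = 0).
  { transitivity (circle_coef r (fun _ => 0 * 0)%C m).
    - apply circle_coef_ext. intros; ring.
    - rewrite (circle_coef_scal r 0 (fun _ => 0)) by (lra || apply circle_cont_const). ring. }
  rewrite Hz in E.
  assert (HmC : RtoC (IZR m) <> 0) by (intros K; apply RtoC_inj in K; apply Hm, eq_IZR, K).
  transitivity (/ IZR m * (IZR m * circle_coef r (fun _ => c) m))%C; [field; exact HmC|].
  rewrite <- E. ring.
Qed.

(** The substitute for Cauchy's theorem. Near 0 the coefficients stay bounded by continuity, while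
    r^j times the coefficient of index -j does not depend on r; letting the radius tend to 0 gives 0
    for j > 0 and the value at the centre for j = 0. *)
Lemma circle_coef_nonpos (g gt : C -> C) (r : R) :
  theta_on g gt -> Ccontinuous g (RtoC 0) -> 0 < r < 1 ->
  circle_coef r g 0 = g 0 /\ forall m, (m < 0)%Z -> circle_coef r g m = 0.
Proof.
  intros H Hc Hr.
  assert (Hsmall : forall eps, 0 < eps -> exists s, 0 < s < r /\ s <= eps /\
            forall z, Cmod z = s -> Cmod (g z - g 0) <= eps).
  { intros eps Heps. destruct (continuous_C_eps g 0 Hc eps Heps) as (d & Hd & K).
    set (s := Rmin (Rmin (d / 2) (r / 2)) eps). exists s.
    pose proof (Rmin_l (Rmin (d / 2) (r / 2)) eps) as A1.
    pose proof (Rmin_r (Rmin (d / 2) (r / 2)) eps) as A2.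
    pose proof (Rmin_l (d / 2) (r / 2)). pose proof (Rmin_r (d / 2) (r / 2)).
    fold s in A1, A2. assert (0 < s) by (apply Rmin_glb_lt; [apply Rmin_glb_lt|]; lra).
    split; [lra|]. split; [lra|]. intros z Hz. apply Rlt_le, K.
    replace (z - 0)%C with z by ring. lra. }
  split.
  - apply Cmod_small_eq. intros eps Heps.
    destruct (Hsmall (eps / 2) ltac:(lra)) as (s & Hs & _ & K).
    pose proof (circle_coef_radius g gt r s 0 H Hs ltac:(lra)) as E. simpl in E.
    rewrite !Cmult_1_l in E. rewrite E.
    assert (Hg : circle_cont s g) by (apply (theta_on_cont g gt s H); lra).
    replace (circle_coef s g 0 - g 0)%C with (circle_coef s (fun z => g z + - g 0)%C 0).
    + replace eps with (2 * (eps / 2)) by field.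
      apply circle_coef_bound; [lra| |exact K].
      apply circle_cont_plus; [exact Hg|apply circle_cont_const].
    + rewrite (circle_coef_plus s g (fun _ => - g 0)%C)
        by (lra || exact Hg || apply circle_cont_const).
      rewrite circle_coef_const_0. reflexivity.
  - intros m Hm. set (j := Z.to_nat (- m)).
    assert (Hj : m = (- Z.of_nat j)%Z) by (unfold j; rewrite Z2Nat.id; lia).
    destruct j as [|j]; [simpl in Hj; lia|].
    assert (Z : (RtoC (r ^ S j) * circle_coef r g m)%C = 0).
    { apply Cmod_small_eq. intros eps Heps.
      pose proof (Cmod_ge_0 (g 0)) as Hg0.
      set (B := Cmod (g 0) + 1).
      destruct (Hsmall (Rmin 1 (eps / (2 * B)))) as (s & Hs & Hse & K).
      { apply Rmin_glb_lt; [lra|apply Rdiv_lt_0_compat; unfold B; lra]. }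
      pose proof (Rmin_l 1 (eps / (2 * B))). pose proof (Rmin_r 1 (eps / (2 * B))).
      rewrite Hj, (circle_coef_radius g gt r s (S j) H Hs) by lra. rewrite <- Hj.
      replace (_ - 0)%C with (RtoC (s ^ S j) * circle_coef s g m)%C by ring.
      rewrite Cmod_mult, Cmod_R, Rabs_pos_eq by (apply pow_le; lra).
      apply Rle_trans with (s * (2 * B)).
      - apply Rmult_le_compat; [apply pow_le; lra|apply Cmod_ge_0| |].
        + simpl. apply Rle_trans with (s * 1); [|lra]. apply Rmult_le_compat_l; [lra|].
          rewrite <- (pow1 j). apply pow_incr. lra.
        + apply circle_coef_bound; [lra|apply (theta_on_cont g gt s H); lra|].
          intros z Hz. specialize (K z Hz). unfold B.
          replace (g z) with (g 0 + (g z - g 0))%C by ring.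
          eapply Rle_trans; [apply Cmod_triangle|]. lra.
      - apply Rle_trans with (eps / (2 * B) * (2 * B)).
        + apply Rmult_le_compat_r; unfold B in *; lra.
        + apply Req_le. field. unfold B. lra. }
    assert (Hrj : RtoC (r ^ S j) <> 0).
    { intros K. apply RtoC_inj in K. revert K. apply pow_nonzero. lra. }
    transitivity (/ RtoC (r ^ S j) * (RtoC (r ^ S j) * circle_coef r g m))%C;
      [field; exact Hrj|]. rewrite Z. ring.
Qed.

(** * The Salagean operator on powers of f *)

(* This ring is closed under [z d/dz], so that all the iterates in [salagean], where
   the derivative is a total function, are genuine derivatives. *)
Inductive dring (a : nat -> C) (G : C -> C) : (C -> C) -> Prop :=
| dring_const c : dring a G (fun _ => c)
| dring_base : dring a G G
| dring_inv : dring a G (fun z => / psum a z)%C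
| dring_psum j : dring a G (psum (Nat.iter j theta a))
| dring_plus g h : dring a G g -> dring a G h -> dring a G (fun z => g z + h z)%C
| dring_mult g h : dring a G g -> dring a G h -> dring a G (fun z => g z * h z)%C.

Section DifferentialRing.
Variables (a : nat -> C) (alpha : R) (G : C -> C).
Hypothesis Ha : subexp a.
Hypothesis Ha0 : forall z, punctured z -> psum a z <> 0.
(** Satisfied by G = (f/z)^alpha, for which z G'/G = alpha (theta f / f - 1). *)
Hypothesis HG : forall z, punctured z ->
  is_Cderive G z (alpha * (psum (theta a) z * / psum a z + - (1)) * G z / z)%C.

Lemma subexp_iter_theta (j : nat) : subexp (Nat.iter j theta a).
Proof. induction j as [|j IH]; [exact Ha|apply subexp_theta, IH]. Qed.

Lemma dring_derive (g : C -> C) :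
  dring a G g ->
  exists gt, dring a G gt /\ forall z, punctured z -> is_Cderive g z (gt z / z)%C.
Proof.
  assert (Hz0 : forall z, punctured z -> z <> 0) by (intros z Hz; apply Cmod_gt_0, Hz).
  induction 1 as [c| | |j|g h _ [gt [Hgt Dg]] _ [ht [Hht Dh]]
    |g h Hg [gt [Hgt Dg]] Hh [ht [Hht Dh]]].
  - exists (fun _ => 0). split; [apply dring_const|]. intros z Hz.
    apply (theta_on_const c z Hz).
  - exists (fun z => (alpha * (psum (theta a) z * / psum a z + - (1))) * G z)%C. split.
    + apply dring_mult; [|apply dring_base]. apply (dring_mult _ _ (fun _ => RtoC alpha)).
      * apply dring_const.
      * apply (dring_plus _ _ (fun z => psum (theta a) z * / psum a z)%C (fun _ => (- (1))%C));
          [|apply dring_const].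
        apply (dring_mult _ _ (psum (theta a)) (fun z => / psum a z)%C); [|apply dring_inv].
        apply (dring_psum a G 1).
    + exact HG.
  - exists (fun z => - (1) * (psum (theta a) z * (/ psum a z * / psum a z)))%C. split.
    + apply (dring_mult _ _ (fun _ => (- (1))%C)); [apply dring_const|].
      apply (dring_mult _ _ (psum (theta a)) (fun z => / psum a z * / psum a z)%C).
      * apply (dring_psum a G 1).
      * apply (dring_mult _ _ (fun z => / psum a z)%C (fun z => / psum a z)%C); apply dring_inv.
    + intros z Hz. eapply is_Cderive_eq.
      * apply (is_Cderive_comp Cinv (psum a)); [apply is_Cderive_inv, Ha0, Hz|].
        apply is_Cderive_psum_theta; [exact Ha|apply Hz|apply Hz0, Hz].
      * specialize (Ha0 z Hz). specialize (Hz0 z Hz). field. split; assumption.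
  - exists (psum (Nat.iter (S j) theta a)). split; [apply dring_psum|]. intros z Hz.
    apply is_Cderive_psum_theta; [apply subexp_iter_theta|apply Hz|apply Hz0, Hz].
  - exists (fun z => gt z + ht z)%C. split; [apply dring_plus; assumption|]. intros z Hz.
    eapply is_Cderive_eq; [apply is_Cderive_plus; [apply Dg|apply Dh]; exact Hz|].
    field. apply Hz0, Hz.
  - exists (fun z => gt z * h z + g z * ht z)%C. split.
    + apply (dring_plus _ _ (fun z => gt z * h z)%C (fun z => g z * ht z)%C);
        apply dring_mult; assumption.
    + intros z Hz.
      eapply is_Cderive_eq; [apply is_Cderive_mult; [apply Dg|apply Dh]; exact Hz|].
      field. apply Hz0, Hz.
Qed.

Lemma dring_continuous (g : C -> C) (z : C) :
  dring a G g -> punctured z -> Ccontinuous g z.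
Proof.
  intros Hg Hz. destruct (dring_derive g Hg) as (gt & _ & D).
  apply (is_Cderive_continuity _ _ _ (D z Hz)).
Qed.

Lemma dring_theta_on (g : C -> C) :
  dring a G g -> exists gt, dring a G gt /\ theta_on g gt.
Proof.
  intros Hg. destruct (dring_derive g Hg) as (gt & Hgt & D).
  exists gt. split; [exact Hgt|]. intros z Hz. split; [apply D, Hz|].
  apply dring_continuous; assumption.
Qed.

End DifferentialRing.

Lemma slit_disk_open (z : C) :
  slit_disk z -> exists d, 0 < d /\ forall w, Cmod (w - z) < d -> slit_disk w.
Proof.
  intros [Hz Hs]. unfold unit_disk in Hz.
  assert (Hdisk : forall d w, d <= 1 - Cmod z -> Cmod (w - z) < d -> unit_disk w).
  { intros d w Hd Hw. unfold unit_disk. replace w with (z + (w - z))%C by ring.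
    eapply Rle_lt_trans; [apply Cmod_triangle|]. lra. }
  assert (HRe : forall w, Rabs (Re w - Re z) <= Cmod (w - z)).
  { intros w. replace (Re w - Re z) with (Re (w - z)) by (destruct w, z; reflexivity).
    apply re_le_Cmod. }
  assert (HIm : forall w, Rabs (Im w - Im z) <= Cmod (w - z)).
  { intros w. replace (Im w - Im z) with (Im (w - z)) by (destruct w, z; reflexivity).
    apply Rabs_Im_le. }
  destruct (Req_dec (Im z) 0) as [E|E].
  - assert (Hre : 0 < Re z) by (apply Rnot_le_lt; intros K; apply Hs; split; assumption).
    exists (Rmin (1 - Cmod z) (Re z)). split; [apply Rmin_glb_lt; lra|]. intros w Hw.
    split; [apply (Hdisk _ w (Rmin_l _ _) Hw)|]. intros [_ K].
    pose proof (Rmin_r (1 - Cmod z) (Re z)). specialize (HRe w).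
    apply Rabs_le_between in HRe. lra.
  - exists (Rmin (1 - Cmod z) (Rabs (Im z))).
    split; [apply Rmin_glb_lt; [lra|apply Rabs_pos_lt, E]|]. intros w Hw.
    split; [apply (Hdisk _ w (Rmin_l _ _) Hw)|]. intros [K _].
    pose proof (Rmin_r (1 - Cmod z) (Rabs (Im z))). specialize (HIm w). rewrite K in HIm.
    rewrite Rminus_0_l, Rabs_Ropp in HIm. lra.
Qed.

Lemma slit_disk_punctured (z : C) : slit_disk z -> punctured z.
Proof. intros [H1 H2]. split; [apply Cmod_gt_0, slit_neq_0, H2|exact H1]. Qed.

(** The circle meets the slit only at the ends of the parameter interval, so Fourier coefficients do
    not notice that the quotient is given by its formula on the slit disk alone. *)
Lemma slit_disk_circle (r t : R) : 0 < r < 1 -> - PI < t < PI -> slit_disk (r * cis t).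
Proof.
  intros Hr Ht. split; [unfold unit_disk; rewrite Cmod_circle; lra|].
  unfold cis. simpl. intros [H1 H2].
  assert (Hs : sin t = 0) by nra. assert (Hc : cos t <= 0) by nra.
  destruct (Rtotal_order t 0) as [Hneg|[Z|Hpos]].
  - assert (0 < sin (- t)) by (apply sin_gt_0; lra). rewrite sin_neg in *. lra.
  - rewrite Z, cos_0 in Hc. lra.
  - assert (0 < sin t) by (apply sin_gt_0; lra). lra.
Qed.

Lemma Cpowr_neq_0 (z : C) (alpha : R) : Cpowr z alpha <> 0.
Proof. apply Cexp_neq_0. Qed.

Lemma is_Cderive_Cpowr (z : C) (alpha : R) :
  slit_disk z -> is_Cderive (fun w => Cpowr w alpha) z (alpha * Cpowr z alpha / z)%C.
Proof.
  intros [Hz Hs]. pose proof (slit_neq_0 z Hs) as Hz0. eapply is_Cderive_eq.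
  - apply (is_Cderive_comp Cexp (fun w => alpha * Cln w)%C).
    + apply is_Cderive_Cexp.
    + apply is_Cderive_scal, is_Cderive_Cln, Hs.
  - unfold Cpowr. field. exact Hz0.
Qed.

(* One application of [D] to [z^alpha g] is one application of
   [alpha (1 + theta / alpha)] to [g]. *)
Lemma salagean_step (alpha : R) (n : nat) (F g gt : C -> C) :
  alpha <> 0 ->
  (forall z, slit_disk z -> salagean n F z = (RtoC alpha ^ n * Cpowr z alpha * g z)%C) ->
  (forall z, punctured z -> is_Cderive g z (gt z / z)%C) ->
  forall z, slit_disk z ->
    salagean (S n) F z = (RtoC alpha ^ S n * Cpowr z alpha * (g z + / alpha * gt z))%C.
Proof.
  intros Hal HF Hg z Hz. simpl salagean.
  pose proof (slit_disk_punctured z Hz) as Hp.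
  assert (Hz0 : z <> 0) by (apply Cmod_gt_0, Hp).
  assert (Hal' : RtoC alpha <> 0) by (intros K; apply Hal, RtoC_inj, K).
  destruct (slit_disk_open z Hz) as (d & Hd & Hw).
  rewrite (is_C_derive_unique (salagean n F) z
    (RtoC alpha ^ n * (alpha * Cpowr z alpha / z * g z + Cpowr z alpha * (gt z / z)))%C).
  - rewrite Cpow_S. field. split; assumption.
  - apply (is_Cderive_ext_loc (fun w => RtoC alpha ^ n * (Cpowr w alpha * g w))%C _ z _ d Hd).
    + intros w Hwd. rewrite HF by (apply Hw, Hwd). ring.
    + apply is_Cderive_scal, is_Cderive_mult; [apply is_Cderive_Cpowr, Hz|apply Hg, Hp].
Qed.

Section Branch.
Variables (f l : C -> C) (a : nat -> C) (alpha : R).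
Hypothesis Halpha : alpha <> 0.
Hypothesis Hf : has_expansion f a.
Hypothesis Hl : log_branch f l.

Let G (z : C) : C := Cexp (alpha * l z).

Lemma branch_subexp : subexp a.
Proof. apply (has_expansion_subexp f), Hf. Qed.

Lemma branch_psum (z : C) : unit_disk z -> psum a z = (z * Cexp (l z))%C.
Proof.
  intros Hz. rewrite <- (has_expansion_psum f a z Hf Hz). apply Hl, Hz.
Qed.

Lemma branch_psum_neq_0 (z : C) : punctured z -> psum a z <> 0.
Proof.
  intros Hz. rewrite branch_psum by apply Hz.
  apply Cmult_neq_0; [apply Cmod_gt_0, Hz|apply Cexp_neq_0].
Qed.

(** Two expressions for f' are compared: the termwise derivative and that of z e^l. *)
Lemma branch_derive (z : C) :
  unit_disk z -> exists dl, is_Cderive l z dl /\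
    psum (dseries a) z = (Cexp (l z) + z * (dl * Cexp (l z)))%C.
Proof.
  intros Hz. destruct Hl as (Han & _ & _). destruct (Han z Hz) as [dl Hdl].
  exists dl. split; [exact Hdl|].
  apply (is_Cderive_unique (psum a) z).
  - apply is_Cderive_psum; [apply branch_subexp|exact Hz].
  - unfold unit_disk in Hz.
    apply (is_Cderive_ext_loc (fun w => w * Cexp (l w))%C _ z _ (1 - Cmod z)); [lra| |].
    + intros w Hw. symmetry. apply branch_psum. unfold unit_disk.
      replace w with (z + (w - z))%C by ring.
      eapply Rle_lt_trans; [apply Cmod_triangle|]. lra.
    + eapply is_Cderive_eq.
      * apply is_Cderive_mult; [apply is_Cderive_id|].
        apply (is_Cderive_comp Cexp l); [apply is_Cderive_Cexp|exact Hdl].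
      * cbv beta; ring.
Qed.

Lemma branch_coef_0 : a O = 0.
Proof.
  assert (H0 : unit_disk 0) by (unfold unit_disk; rewrite Cmod_0; lra).
  rewrite <- (psum_0 a branch_subexp), (branch_psum 0 H0). ring.
Qed.

Lemma branch_coef_1 : a 1%nat = 1.
Proof.
  assert (H0 : unit_disk 0) by (unfold unit_disk; rewrite Cmod_0; lra).
  destruct (branch_derive 0 H0) as (dl & _ & E).
  rewrite psum_0 in E by (apply subexp_dseries, branch_subexp).
  destruct Hl as (_ & Hl0 & _). rewrite Hl0, Cexp_0 in E. unfold dseries in E.
  simpl INR in E. transitivity (1 * a 1%nat)%C; [ring|]. rewrite E. ring.
Qed.

Lemma branch_power_derive (z : C) :
  punctured z ->
  is_Cderive G z (alpha * (psum (theta a) z * / psum a z + - (1)) * G z / z)%C.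
Proof.
  intros Hz. assert (Hz0 : z <> 0) by (apply Cmod_gt_0, Hz).
  destruct (branch_derive z (proj2 Hz)) as (dl & Hdl & E).
  eapply is_Cderive_eq.
  - apply (is_Cderive_comp Cexp (fun w => alpha * l w)%C); [apply is_Cderive_Cexp|].
    apply is_Cderive_scal, Hdl.
  - rewrite psum_theta, E by (apply branch_subexp || apply Hz).
    rewrite branch_psum by apply Hz. unfold G. field.
    split; [apply Cexp_neq_0|exact Hz0].
Qed.

Lemma branch_power_continuous_0 :
  Ccontinuous G (RtoC 0).
Proof.
  destruct Hl as (Han & _ & _).
  destruct (Han 0) as [dl Hdl]; [unfold unit_disk; rewrite Cmod_0; lra|].
  apply (is_Cderive_continuity G 0 (alpha * dl * Cexp (alpha * l 0))%C).
  apply (is_Cderive_comp Cexp (fun w => alpha * l w)%C); [apply is_Cderive_Cexp|].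
  apply is_Cderive_scal, Hdl.
Qed.

Lemma branch_power_0 : G 0 = 1.
Proof.
  destruct Hl as (_ & Hl0 & _). unfold G. rewrite Hl0, <- Cexp_0. f_equal. ring.
Qed.

Lemma branch_theta_on :
  theta_on G (fun z => alpha * (psum (theta a) z * / psum a z + - (1)) * G z)%C.
Proof.
  intros z Hz. split; [apply branch_power_derive, Hz|].
  apply (dring_continuous a alpha G branch_subexp branch_psum_neq_0 branch_power_derive);
    [|exact Hz].
  apply dring_mult; [|apply dring_base]. apply (dring_mult _ _ (fun _ => RtoC alpha)).
  - apply dring_const.
  - apply (dring_plus _ _ (fun z => psum (theta a) z * / psum a z)%C (fun _ => (- (1))%C));
      [|apply dring_const].
    apply (dring_mult _ _ (psum (theta a)) (fun z => / psum a z)%C); [|apply dring_inv].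
    apply (dring_psum a G 1).
Qed.

(** The witness [g] represents the quotient inside the differential ring, so that it can be
    differentiated again; each step multiplies the coefficient of index [m] by 1 + m/alpha. *)
Lemma branch_salagean (n : nat) :
  exists g, dring a G g /\
    (forall z, slit_disk z ->
       salagean n (fpow l alpha) z = (RtoC alpha ^ n * Cpowr z alpha * g z)%C) /\
    forall r m, 0 < r < 1 ->
      circle_coef r g m = (RtoC ((1 + IZR m / alpha) ^ n) * circle_coef r G m)%C.
Proof.
  induction n as [|n (g & Hg & Hsal & Hcoef)].
  - exists G. split; [apply dring_base|]. split.
    + intros z _. unfold fpow, G. simpl. ring.
    + intros r m _. simpl. ring.
  - destruct (dring_theta_on a alpha G branch_subexp branch_psum_neq_0 branch_power_derive g Hg)
      as (gt & Hgt & Ht).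
    exists (fun z => g z + / alpha * gt z)%C. split; [|split].
    + apply (dring_plus _ _ g (fun z => / alpha * gt z)%C); [exact Hg|].
      apply (dring_mult _ _ (fun _ => / alpha)%C gt); [apply dring_const|exact Hgt].
    + apply salagean_step; [exact Halpha|exact Hsal|]. intros z Hz. apply Ht, Hz.
    + intros r m Hr. pose proof (theta_on_cont g gt r Ht Hr) as C1.
      pose proof (theta_on_cont_theta g gt r Ht Hr) as C2.
      rewrite (circle_coef_plus r g (fun z => / alpha * gt z)%C), circle_coef_scal,
        (circle_coef_theta g gt r m Ht Hr), Hcoef; try assumption; try lra.
      * replace ((1 + IZR m / alpha) ^ S n)
          with ((1 + IZR m / alpha) ^ n + / alpha * (IZR m * (1 + IZR m / alpha) ^ n))
          by (simpl; field; exact Halpha).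
        rewrite RtoC_plus, !RtoC_mult, RtoC_inv by exact Halpha. ring.
      * apply (circle_cont_mult r (fun _ => / alpha)%C); [apply circle_cont_const|exact C2].
Qed.

(** The Fourier form of f theta G = alpha (theta f - f) G. As [f] has no constant term, the identity
    is read at index [S m] and divided by [r]; in terms of h = f/z it becomes alpha G theta h = h
    theta G. *)
Lemma branch_recurrence (r : R) (m : nat) :
  0 < r < 1 ->
  let gam := fun j => circle_coef r G (Z.of_nat j) in
  let h := fun j => (a (S j) * RtoC r ^ j)%C in
  (alpha * conv gam (theta h) m)%C = conv h (theta gam) m.
Proof.
  intros Hr gam h. pose proof branch_theta_on as Ht.
  set (Gt := (fun z => alpha * (psum (theta a) z * / psum a z + - (1)) * G z)%C) in Ht.
  pose proof (theta_on_cont G Gt r Ht Hr) as CG.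
  pose proof (theta_on_cont_theta G Gt r Ht Hr) as CGt.
  destruct (circle_coef_nonpos G Gt r Ht branch_power_continuous_0 Hr) as [_ Hneg].
  assert (Hneg' : forall j, (j < 0)%Z -> circle_coef r Gt j = 0).
  { intros j Hj. rewrite (circle_coef_theta G Gt r j Ht Hr), (Hneg j Hj). ring. }
  pose proof branch_subexp as Ha. pose proof (subexp_theta a Ha) as Hta.
  assert (Cps : forall b, subexp b -> circle_cont r (psum b)).
  { intros b Hb z Hz. apply (is_Cderive_continuity _ _ _ (is_Cderive_psum b z Hb ltac:(lra))). }
  assert (E : circle_coef r (fun z => psum a z * Gt z)%C (Z.of_nat (S m)) =
    (alpha * (circle_coef r (fun z => psum (theta a) z * G z) (Z.of_nat (S m))
     + - (1) * circle_coef r (fun z => psum a z * G z) (Z.of_nat (S m))))%C).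
  { assert (K1 : circle_cont r (fun z => psum (theta a) z * G z)%C)
      by (apply circle_cont_mult; [apply Cps, Hta|exact CG]).
    assert (K2 : circle_cont r (fun z => psum a z * G z)%C)
      by (apply circle_cont_mult; [apply Cps, Ha|exact CG]).
    assert (K3 : circle_cont r (fun z => - (1) * (psum a z * G z))%C)
      by (apply (circle_cont_mult r (fun _ => - (1))%C); [apply circle_cont_const|exact K2]).
    assert (K4 : circle_cont r (fun z => psum (theta a) z * G z + - (1) * (psum a z * G z))%C)
      by (apply circle_cont_plus; assumption).
    rewrite <- (circle_coef_scal r (- (1))%C), <- circle_coef_plus, <- circle_coef_scal
      by (assumption || lra).
    apply circle_coef_ext. intros t _. unfold Gt.
    pose proof (branch_psum_neq_0 _ (punctured_circle r t Hr)). field. assumption. }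
  rewrite !circle_coef_psum_mult in E by (assumption || lra).
  assert (Hr0 : RtoC r <> 0) by (apply RtoC_neq_0; lra).
  rewrite !(csum_head _ (S m)) in E. unfold theta at 1 in E. rewrite branch_coef_0 in E.
  assert (L : csum (fun i => a (S i) * RtoC r ^ S i *
      circle_coef r Gt (Z.of_nat (S m - S i)))%C (S m) = (r * conv h (theta gam) m)%C).
  { unfold conv. rewrite <- csum_scal. apply csum_ext. intros i Hi.
    rewrite (circle_coef_theta G Gt r _ Ht Hr), <- INR_IZR_INZ.
    unfold h, theta, gam. simpl (S m - S i)%nat. rewrite Cpow_S. ring. }
  assert (L2 : (csum (fun i => theta a (S i) * RtoC r ^ S i *
      circle_coef r G (Z.of_nat (S m - S i))) (S m) +
      - (1) * csum (fun i => a (S i) * RtoC r ^ S i *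
      circle_coef r G (Z.of_nat (S m - S i))) (S m))%C = (r * conv (theta h) gam m)%C).
  { unfold conv. rewrite <- !csum_scal, <- csum_plus. apply csum_ext. intros i Hi.
    unfold h, theta, gam. simpl (S m - S i)%nat. rewrite Cpow_S, S_INR, RtoC_plus. ring. }
  rewrite L in E. rewrite (conv_comm gam).
  transitivity (/ r * (alpha * (r * conv (theta h) gam m)))%C; [field; exact Hr0|].
  rewrite <- L2.
  transitivity (/ r * (r * conv h (theta gam) m))%C; [|field; exact Hr0].
  f_equal. transitivity (0 * RtoC r ^ 0 * circle_coef r Gt (Z.of_nat (S m - 0)) +
    r * conv h (theta gam) m)%C; [|ring].
  rewrite E. ring.
Qed.

Lemma branch_quotient_coef (n : nat) (Q : C -> C) (r : R) :
  (forall z, slit_disk z ->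
     Q z = (salagean n (fpow l alpha) z / (RtoC alpha ^ n * Cpowr z alpha))%C) ->
  0 < r < 1 ->
  circle_coef r G 0 = 1 /\
  (forall m, circle_coef r Q m = (RtoC ((1 + IZR m / alpha) ^ n) * circle_coef r G m)%C) /\
  (forall m, (m < 0)%Z -> circle_coef r Q m = 0).
Proof.
  intros HQ Hr.
  destruct (circle_coef_nonpos G _ r branch_theta_on branch_power_continuous_0 Hr) as [H0 Hneg].
  rewrite branch_power_0 in H0.
  assert (E : forall m, circle_coef r Q m
    = (RtoC ((1 + IZR m / alpha) ^ n) * circle_coef r G m)%C).
  { intros m. destruct (branch_salagean n) as (g & _ & Hsal & Hcoef).
    rewrite <- Hcoef by exact Hr. apply circle_coef_ext. intros t Ht.
    pose proof (slit_disk_circle r t Hr Ht) as Hs. rewrite (HQ _ Hs), (Hsal _ Hs).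
    field. split; [apply Cpowr_neq_0|].
    apply Cpow_nz. intros K. apply Halpha, RtoC_inj, K. }
  split; [exact H0|]. split; [exact E|].
  intros m Hm. rewrite E, Hneg by exact Hm. ring.
Qed.

End Branch.

(** * The coefficient bound *)

(** The necessity half of the Caratheodory-Toeplitz criterion: integrate (Q - beta) |U|^2, of
    nonnegative real part, for a trigonometric polynomial [U] with coefficients [u]. As negative
    coefficients of [Q] vanish, exactly the entries [j <= i] of the half form remain. *)
Lemma circle_toeplitz_pos (Q : C -> C) (r beta : R) (K : nat) (p : nat -> C) :
  0 < r < 1 -> beta < 1 -> circle_cont r Q ->
  (forall z, Cmod z = r -> beta <= Re (Q z)) ->
  (forall m, (m < 0)%Z -> circle_coef r Q m = 0) ->
  circle_coef r Q 0 = 1 -> p O = 1 ->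
  (forall m, (1 <= m < K)%nat -> circle_coef r Q (Z.of_nat m) = ((1 - beta)%R * p m)%C) ->
  kernel_pos K (fun i j => p (i - j)%nat).
Proof.
  intros Hr Hb CQ HRe Hneg H0 Hp0 Hp u.
  pose (Qb := fun z => (Q z + - beta)%C).
  assert (CQb : circle_cont r Qb).
  { apply (circle_cont_plus r Q (fun _ => - beta)%C); [exact CQ|apply circle_cont_const]. }
  assert (Ecoef : forall m, circle_coef r Qb m =
            (circle_coef r Q m + circle_coef r (fun _ => - beta) m)%C).
  { intros m. apply circle_coef_plus; [lra|exact CQ|apply circle_cont_const]. }
  (* Subtracting [beta] affects index 0 only, where 1 - beta matches the normalisation [p O = 1]. *)
  assert (Epos : forall m, (m < K)%nat -> circle_coef r Qb (Z.of_nat m) = ((1 - beta)%R * p m)%C).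
  { intros m Hm. rewrite Ecoef. destruct m as [|m].
    - simpl Z.of_nat. rewrite circle_coef_const_0, H0, Hp0, RtoC_minus. ring.
    - rewrite circle_coef_const, Hp by (assumption || lia). ring. }
  assert (Eneg : forall m, (m < 0)%Z -> circle_coef r Qb m = 0).
  { intros m Hm. rewrite Ecoef, Hneg, circle_coef_const by (assumption || lia). ring. }
  pose (U := fun t => csum (fun j => u j * cis (INR j * t))%C K).
  assert (CU : ccont U).
  { apply (ccont_csum (fun j t => u j * cis (INR j * t))%C). intros j.
    apply ccont_mult; [apply ccont_const|apply ccont_cis]. }
  pose (F := fun t => (Qb (r * cis t) * (U t * Cconj (U t)))%C).
  assert (CF : ccont F).
  { apply ccont_mult; [apply circle_cont_ccont; [lra|exact CQb]|].
    apply ccont_mult; [exact CU|]. intros t. apply continuous_Cconj, CU. }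
  assert (HF : 0 <= Re (CInt F)).
  { apply CInt_Re_nonneg; [exact CF|]. intros t. unfold F.
    rewrite <- Cmod2_conj, re_scal_r. apply Rmult_le_pos; [|apply pow2_ge_0].
    unfold Qb. rewrite re_plus, re_opp. simpl (Re (RtoC beta)).
    specialize (HRe (r * cis t)%C (Cmod_circle r t ltac:(lra))). lra. }
  pose (T := fun i j t => (u j * Cconj (u i) *
       (Qb (r * cis t) * cis (- IZR (Z.of_nat i - Z.of_nat j) * t)))%C).
  assert (CT : forall i j, ccont (T i j)).
  { intros i j. apply ccont_mult; [apply ccont_const|].
    apply circle_coef_ccont; [lra|exact CQb]. }
  assert (EF : CInt F = csum (fun i => csum (fun j => CInt (T i j)) K) K).
  { rewrite (csum_ext _ (fun i => CInt (fun t => csum (fun j => T i j t) K)))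
      by (intros; symmetry; apply CInt_csum; auto).
    rewrite <- (CInt_csum (fun i t => csum (fun j => T i j t) K))
      by (intros i; apply ccont_csum; auto).
    apply CInt_ext. intros t _. unfold F.
    assert (EU : Cconj (U t) = csum (fun i => Cconj (u i) * cis (- (INR i * t)))%C K).
    { unfold U. clear. induction K as [|K IH]; cbn [csum].
      - unfold Cconj, RtoC. simpl. f_equal. ring.
      - rewrite Cplus_conj, IH, Cmult_conj, cis_conj. reflexivity. }
    rewrite EU.
    transitivity (csum (fun i => (Qb (r * cis t) * U t) *
       (Cconj (u i) * cis (- (INR i * t))))%C K); [rewrite csum_scal; ring|].
    apply csum_ext. intros i Hi.
    transitivity ((Qb (r * cis t) * (Cconj (u i) * cis (- (INR i * t)))) * U t)%C; [ring|].
    unfold U. rewrite <- csum_scal. apply csum_ext. intros j Hj. unfold T.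
    rewrite minus_IZR, <- !INR_IZR_INZ.
    replace (- (INR i - INR j) * t) with (- (INR i * t) + INR j * t) by ring.
    rewrite cis_plus. ring. }
  assert (ET : forall i j, (i < K)%nat -> CInt (T i j) =
     ((2 * PI)%R * (u j * Cconj (u i) * circle_coef r Qb (Z.of_nat i - Z.of_nat j)))%C).
  { intros i j Hi. unfold T. rewrite CInt_scal by (apply circle_coef_ccont; [lra|exact CQb]).
    unfold circle_coef. field. apply two_PI_C_neq_0. }
  assert (EH : CInt F = ((2 * PI * (1 - beta))%R * half_form K (fun i j => p (i - j)%nat) u)%C).
  { rewrite EF. unfold half_form. rewrite <- csum_scal. apply csum_ext. intros i Hi.
    rewrite <- csum_scal.
    assert (Z : forall N, (i < N)%nat -> csum (fun j => CInt (T i j)) N =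
              csum (fun j => CInt (T i j)) (S i)).
    { induction N as [|N IH]; intros HN; [lia|].
      destruct (Nat.eq_dec N i) as [->|Hne]; [reflexivity|].
      cbn [csum] in *. rewrite IH, (ET i N Hi), (Eneg (Z.of_nat i - Z.of_nat N)%Z) by lia.
      ring. }
    rewrite Z by exact Hi. apply csum_ext. intros j Hj. rewrite ET by exact Hi.
    replace (Z.of_nat i - Z.of_nat j)%Z with (Z.of_nat (i - j)) by lia.
    rewrite Epos by lia. rewrite !RtoC_mult. ring. }
  rewrite EH, re_scal_l in HF. pose proof PI_RGT_0.
  assert (0 < 2 * PI * (1 - beta)) by (apply Rmult_lt_0_compat; lra).
  apply Rmult_le_reg_l with (2 * PI * (1 - beta)); [assumption|]. rewrite Rmult_0_r. exact HF.
Qed.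

(** The index shift from [f] to f/z turns alpha + k - 1 into alpha + k, and the exponent n - 1
    leaves a division by [alpha]. *)
Lemma coeff_bound_eq (n : nat) (alpha beta : R) (k : nat) :
  1 < alpha -> coeff_bound n alpha beta (S k) = 2 * (1 - beta) * wt alpha n k / alpha.
Proof.
  intros Ha. unfold coeff_bound, wt. rewrite S_INR.
  unfold Z.sub. rewrite powerRZ_add, <- pow_powerRZ by lra. simpl powerRZ.
  unfold Rdiv at 3. rewrite Rpow_mult_distr, pow_inv.
  replace (alpha + (INR k + 1) - 1) with (alpha + INR k) by ring.
  pose proof (pos_INR k). field. split; [apply pow_nonzero|]; lra.
Qed.

Lemma le_of_radius_le (x B : R) (k : nat) :
  0 <= x -> (forall r, 0 < r < 1 -> x * r ^ k <= B) -> x <= B.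
Proof.
  intros Hx H. apply le_epsilon. intros eps Heps.
  pose proof (pos_INR k) as Hk.
  set (d := Rmin (/ 2) (eps / (x * INR k + 1))).
  assert (Hxk : 0 <= x * INR k) by (apply Rmult_le_pos; assumption).
  assert (Hd : 0 < d) by (apply Rmin_glb_lt; [lra|apply Rdiv_lt_0_compat; lra]).
  assert (Hd1 : d <= / 2) by apply Rmin_l.
  assert (Hd2 : d <= eps / (x * INR k + 1)) by apply Rmin_r.
  (* Bernoulli's inequality makes the passage of the radius to 1 explicit. *)
  assert (Hpow : 1 - INR k * d <= (1 - d) ^ k).
  { clearbody d. clear - Hd Hd1. induction k as [|k IH]; [simpl; lra|].
    rewrite S_INR. simpl. pose proof (pos_INR k).
    assert (0 <= INR k * d * d) by (apply Rmult_le_pos; [apply Rmult_le_pos|]; lra). nra. }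
  specialize (H (1 - d) ltac:(lra)).
  assert (x * (1 - INR k * d) <= x * (1 - d) ^ k) by (apply Rmult_le_compat_l; assumption).
  assert (x * INR k * d <= eps).
  { apply Rle_trans with ((x * INR k + 1) * (eps / (x * INR k + 1))).
    - apply Rmult_le_compat; lra.
    - apply Req_le. field. lra. }
  lra.
Qed.

Lemma wt_inv (alpha : R) (n m : nat) :
  0 < alpha -> (1 + IZR (Z.of_nat m) / alpha) ^ n = / wt alpha n m.
Proof.
  intros Ha. unfold wt. rewrite <- pow_inv, <- INR_IZR_INZ. f_equal.
  pose proof (pos_INR m). field. lra.
Qed.

Lemma class_T_coeff_bound (n : nat) (alpha beta : R) (f : C -> C) (a : nat -> C) (k : nat) :
  0 <= beta < 1 -> 1 < alpha -> class_T n alpha beta f -> has_expansion f a ->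
  (1 <= k)%nat -> Cmod (a (S k)) <= coeff_bound n alpha beta (S k).
Proof.
  intros Hb Ha (_ & Q & (HQan & HQ0 & l & Hl & HQ) & HQRe) Hf Hk.
  rewrite coeff_bound_eq by exact Ha.
  apply (le_of_radius_le _ _ k); [apply Cmod_ge_0|]. intros r Hr.
  assert (Ha0 : alpha <> 0) by lra.
  pose (G := fun z => Cexp (alpha * l z)).
  pose (gam := fun j => circle_coef r G (Z.of_nat j)).
  pose (h := fun j => (a (S j) * RtoC r ^ j)%C).
  destruct (branch_quotient_coef f l a alpha Ha0 Hf Hl n Q r HQ Hr) as (G0 & GQ & Gneg).
  fold G in G0, GQ.
  (* The coefficients of (Q - beta) / (1 - beta), still scaled by r^m: the formal bound is applied
     on a fixed circle. *)
  pose (p := fun m => match m with O => RtoC 1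
              | S _ => (/ (1 - beta)%R * circle_coef r Q (Z.of_nat m))%C end).
  assert (Hb' : RtoC (1 - beta) <> 0) by (apply RtoC_neq_0; lra).
  assert (CQ : circle_cont r Q).
  { intros z Hz. destruct (HQan z) as [dQ HdQ]; [unfold unit_disk; lra|].
    apply (is_Cderive_continuity _ _ _ HdQ). }
  assert (Q0 : circle_coef r Q 0 = 1).
  { rewrite GQ, G0. unfold Rdiv. rewrite Rmult_0_l, Rplus_0_r, pow1. ring. }
  replace (Cmod (a (S k)) * r ^ k) with (Cmod (h k)).
  - apply (root_coefficient_bound alpha beta n k p gam h); try assumption; try reflexivity.
    + apply (circle_toeplitz_pos Q r beta); try assumption; try lra; try reflexivity.
      * intros z Hz. apply Rlt_le, HQRe. unfold unit_disk. lra.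
      * intros [|m] Hm; [lia|]. unfold p. field. exact Hb'.
    + intros [|m] Hm; [lia|]. unfold p, gam. rewrite GQ, wt_inv by lra.
      assert (Hw : RtoC (wt alpha n (S m)) <> 0).
      { intros K. apply RtoC_inj in K. pose proof (wt_pos alpha n (S m) ltac:(lra)). lra. }
      rewrite RtoC_mult, RtoC_inv by (intros K; apply Hw; rewrite K; reflexivity).
      field. split; assumption.
    + unfold h. rewrite (branch_coef_1 f l a Hf Hl). simpl. ring.
    + intros m _. apply (branch_recurrence f l a alpha Hf Hl r m Hr).
  - unfold h. rewrite Cmod_mult, Cmod_pow, Cmod_R, Rabs_pos_eq; lra.
Qed.

(** * The extremal functions *)

(** With w = z^N the quotient is beta + (1 - beta) (1 + w) / (1 - w), and the Cayley transform sends
    the disk to the right half-plane. *)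
Lemma extremal_quotient_Re (beta : R) (N : nat) (z : C) :
  beta < 1 -> (1 <= N)%nat -> unit_disk z -> Re (extremal_quotient beta (S N) z) > beta.
Proof.
  intros Hb HN Hz. unfold extremal_quotient. replace (S N - 1)%nat with N by lia.
  set (w := (z ^ N)%C).
  assert (Hw : Cmod w < 1).
  { unfold w. rewrite Cmod_pow. unfold unit_disk in Hz. pose proof (Cmod_ge_0 z).
    destruct N as [|N]; [lia|]. simpl.
    assert (Cmod z ^ N <= 1) by (rewrite <- (pow1 N); apply pow_incr; lra).
    assert (0 <= Cmod z ^ N) by (apply pow_le; lra). nra. }
  pose proof (Cmod_ge_0 w) as Hw0.
  assert (Hd : (1 - w)%C <> 0).
  { intros K. apply Ceq_minus in K. rewrite <- K, Cmod_1 in Hw. lra. }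
  pose proof (Cmod2_alt w) as E. pose proof (proj1 (Cmod_gt_0 _) Hd) as Hd0.
  pose proof (Cmod2_alt (1 - w)) as E2.
  replace ((1 + (1 - 2 * beta) * w) / (1 - w))%C with
    (beta + ((1 - beta) / Cmod (1 - w) ^ 2)%R * ((1 + w) * Cconj (1 - w)))%C.
  - rewrite re_plus, re_scal_l. simpl (Re (RtoC beta)).
    assert (0 < (1 - beta) / Cmod (1 - w) ^ 2) by
      (apply Rdiv_lt_0_compat; [lra|apply pow_lt, Hd0]).
    assert (0 < Re ((1 + w) * Cconj (1 - w))).
    { replace (Re ((1 + w) * Cconj (1 - w))) with (1 - (Re w ^ 2 + Im w ^ 2))
        by (destruct w; simpl; ring).
      rewrite <- E. nra. }
    assert (0 < (1 - beta) / Cmod (1 - w) ^ 2 * Re ((1 + w) * Cconj (1 - w)))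
      by (apply Rmult_lt_0_compat; assumption). lra.
  - assert (Hc : Cconj (1 - w) <> 0).
    { intros K. apply Hd, Cmod_eq_0. rewrite <- Cmod_conj, K. apply Cmod_0. }
    rewrite RtoC_div by (apply pow_nonzero; lra). rewrite Cmod2_conj, RtoC_minus.
    field. split; assumption.
Qed.

Lemma circle_cont_disk (r : R) (g : C -> C) :
  0 <= r < 1 -> analytic_on unit_disk g -> circle_cont r g.
Proof.
  intros Hr Hg z Hz. destruct (Hg z) as [d Hd]; [unfold unit_disk; lra|].
  apply (is_Cderive_continuity _ _ _ Hd).
Qed.

Lemma one_minus_pow_neq_0 (z : C) (N : nat) :
  (1 <= N)%nat -> Cmod z < 1 -> (1 - z ^ N)%C <> 0.
Proof.
  intros HN Hz K. apply Ceq_minus in K.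
  assert (E : Cmod (z ^ N) = 1) by (rewrite <- K; apply Cmod_1).
  rewrite Cmod_pow in E. destruct N as [|N]; [lia|]. simpl in E. pose proof (Cmod_ge_0 z).
  assert (Cmod z ^ N <= 1) by (rewrite <- (pow1 N); apply pow_incr; lra).
  assert (0 <= Cmod z ^ N) by (apply pow_le; lra). nra.
Qed.

(* Coefficients read off from [(1 - z^N) Q = 1 + (1 - 2 beta) z^N]. *)
Lemma extremal_circle_coef (beta r : R) (N m : nat) :
  0 < r < 1 -> (1 <= m <= N)%nat ->
  circle_cont r (extremal_quotient beta (S N)) ->
  (forall j, (j < 0)%Z -> circle_coef r (extremal_quotient beta (S N)) j = 0) ->
  circle_coef r (extremal_quotient beta (S N)) 0 = 1 ->
  circle_coef r (extremal_quotient beta (S N)) (Z.of_nat m) =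
  (if Nat.eqb m N then RtoC (2 * (1 - beta) * r ^ N) else 0).
Proof.
  intros Hr Hm CQ Hneg H0. set (Q := extremal_quotient beta (S N)) in *.
  assert (C1 : circle_cont r (fun z => z ^ N * Q z)%C)
    by (apply circle_cont_mult; [apply circle_cont_pow|exact CQ]).
  assert (C2 : circle_cont r (fun z => z ^ N * (1 - 2 * beta))%C)
    by (apply circle_cont_mult; [apply circle_cont_pow|apply circle_cont_const]).
  assert (E : circle_coef r Q (Z.of_nat m) =
    circle_coef r (fun z => z ^ N * Q z + (z ^ N * (1 - 2 * beta) + 1))%C (Z.of_nat m)).
  { apply circle_coef_ext. intros t _. set (z := (r * cis t)%C).
    assert (Hz : (1 - z ^ N)%C <> 0)
      by (apply one_minus_pow_neq_0; [lia|unfold z; rewrite Cmod_circle; lra]).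
    unfold Q, extremal_quotient. replace (S N - 1)%nat with N by lia. field. exact Hz. }
  rewrite E, (circle_coef_plus r (fun z => z ^ N * Q z)%C
      (fun z => z ^ N * (1 - 2 * beta) + 1)%C),
    (circle_coef_plus r (fun z => z ^ N * (1 - 2 * beta))%C (fun _ => 1%R)),
    circle_coef_pow_mult, (circle_coef_pow_mult r (fun _ => 1 - 2 * beta)%C),
    (circle_coef_const r 1) by
    (lra || assumption || lia || apply circle_cont_const ||
     (apply circle_cont_plus; [assumption|apply circle_cont_const])).
  destruct (Nat.eqb_spec m N) as [->|Hne].
  - replace (Z.of_nat N - Z.of_nat N)%Z with 0%Z by lia.
    rewrite H0, circle_coef_const_0, !RtoC_mult, RtoC_minus, RtoC_pow. ring.
  - rewrite Hneg by lia. rewrite circle_coef_const by (assumption || lia). ring.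
Qed.

(** The coefficients of [G] of index strictly between 0 and [N] vanish, so degree [N] of the
    recurrence reduces to alpha N h_N = N gam_N. The identity is exact on every circle, and the
    radius 1/2 is an arbitrary choice. *)
Lemma extremal_coeff (n N : nat) (alpha beta : R) (f : C -> C) (a : nat -> C) :
  0 <= beta < 1 -> 1 < alpha -> (1 <= N)%nat ->
  salagean_quotient n alpha f (extremal_quotient beta (S N)) -> has_expansion f a ->
  Cmod (a (S N)) = coeff_bound n alpha beta (S N).
Proof.
  intros Hb Ha HN (HQan & HQ0 & l & Hl & HQ) Hf.
  rewrite coeff_bound_eq by exact Ha.
  set (r := / 2). assert (Hr : 0 < r < 1) by (unfold r; lra).
  assert (Ha0 : alpha <> 0) by lra.
  pose (G := fun z => Cexp (alpha * l z)).
  pose (gam := fun j => circle_coef r G (Z.of_nat j)).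
  pose (h := fun j => (a (S j) * RtoC r ^ j)%C).
  set (Q := extremal_quotient beta (S N)) in *.
  destruct (branch_quotient_coef f l a alpha Ha0 Hf Hl n Q r HQ Hr) as (G0 & GQ & Gneg).
  fold G in G0, GQ.
  assert (CQ : circle_cont r Q) by (apply circle_cont_disk; [lra|exact HQan]).
  assert (Q0 : circle_coef r Q 0 = 1).
  { rewrite GQ, G0. unfold Rdiv. rewrite Rmult_0_l, Rplus_0_r, pow1. ring. }
  assert (Hw : forall m, RtoC (wt alpha n m) <> 0).
  { intros m K. apply RtoC_inj in K. pose proof (wt_pos alpha n m ltac:(lra)). lra. }
  assert (Hgam : forall m, gam m = (wt alpha n m * circle_coef r Q (Z.of_nat m))%C).
  { intros m. unfold gam. rewrite GQ, wt_inv by lra.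
    rewrite RtoC_inv by (intros K; apply (Hw m); rewrite K; reflexivity).
    field. apply Hw. }
  assert (Hlow : forall m, (1 <= m < N)%nat -> gam m = 0).
  { intros m Hm. rewrite Hgam. unfold Q. rewrite extremal_circle_coef by (assumption || lia).
    rewrite (proj2 (Nat.eqb_neq m N)) by lia. ring. }
  assert (HgN : gam N = RtoC (wt alpha n N * (2 * (1 - beta) * r ^ N))).
  { rewrite Hgam. unfold Q. rewrite extremal_circle_coef by (assumption || lia).
    rewrite Nat.eqb_refl, <- RtoC_mult. reflexivity. }
  pose proof (branch_recurrence f l a alpha Hf Hl r N Hr) as E.
  cbv zeta in E. change (alpha * conv gam (theta h) N = conv h (theta gam) N)%C in E.
  assert (E1 : conv gam (theta h) N = (INR N * h N)%C).
  { unfold conv. rewrite (csum_single _ _ 0); [|lia|].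
    - rewrite Nat.sub_0_r. unfold gam at 1. simpl Z.of_nat. rewrite G0. unfold theta. ring.
    - intros i Hi Hi0. destruct (Nat.eq_dec i N) as [->|Hne].
      + rewrite Nat.sub_diag. unfold theta. simpl INR. ring.
      + rewrite Hlow by lia. ring. }
  assert (E2 : conv h (theta gam) N = (INR N * gam N)%C).
  { unfold conv. rewrite (csum_single _ _ 0); [|lia|].
    - rewrite Nat.sub_0_r. unfold h. rewrite (branch_coef_1 f l a Hf Hl).
      unfold theta. simpl. ring.
    - intros i Hi Hi0. unfold theta. destruct (Nat.eq_dec i N) as [->|Hne].
      + rewrite Nat.sub_diag. simpl INR. ring.
      + rewrite (Hlow (N - i)%nat) by lia. ring. }
  rewrite E1, E2 in E.
  assert (HNC : RtoC (INR N) <> 0).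
  { intros K. apply RtoC_inj in K. revert K. apply not_0_INR. lia. }
  assert (HaC : RtoC alpha <> 0) by (intros K; apply Ha0, RtoC_inj, K).
  assert (Hrn : r ^ N <> 0) by (apply pow_nonzero; lra).
  assert (HrC : (RtoC r ^ N)%C <> 0) by (apply Cpow_nz; intros K; apply RtoC_inj in K; lra).
  assert (EA : a (S N) = RtoC (2 * (1 - beta) * wt alpha n N / alpha)).
  { transitivity (/ (INR N * alpha * RtoC r ^ N) * (alpha * (INR N * h N)))%C.
    - unfold h. field. repeat split; assumption.
    - rewrite E, HgN. rewrite RtoC_div by exact Ha0.
      rewrite !RtoC_mult, RtoC_pow. field. repeat split; assumption. }
  rewrite EA, Cmod_R. apply Rabs_pos_eq.
  pose proof (wt_pos alpha n N ltac:(lra)).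
  apply Rmult_le_pos; [|apply Rlt_le, Rinv_0_lt_compat; lra].
  apply Rmult_le_pos; lra.
Qed.

(** * Linear combinations of convergent series *)

Lemma subexp_le (a b : nat -> C) :
  subexp a -> (forall i, Cmod (b i) <= Cmod (a i)) -> subexp b.
Proof.
  intros Ha H rho Hrho. destruct (Ha rho Hrho) as [M HM]. exists M. intros i.
  eapply Rle_trans; [|apply (HM i)]. apply Rmult_le_compat_r; [apply pow_le; lra|apply H].
Qed.

Lemma subexp_lin (a b : nat -> C) (c : C) :
  subexp a -> subexp b -> subexp (fun i => a i + c * b i)%C.
Proof.
  intros Ha Hb rho Hrho. destruct (Ha rho Hrho) as [M HM]. destruct (Hb rho Hrho) as [M' HM'].
  exists (M + Cmod c * M'). intros i. specialize (HM i). specialize (HM' i).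
  pose proof (pow_le rho i ltac:(lra)).
  apply Rle_trans with ((Cmod (a i) + Cmod c * Cmod (b i)) * rho ^ i).
  - apply Rmult_le_compat_r; [assumption|]. eapply Rle_trans; [apply Cmod_triangle|].
    rewrite Cmod_mult. lra.
  - rewrite Rmult_plus_distr_r, Rmult_assoc. apply Rplus_le_compat; [exact HM|].
    apply Rmult_le_compat_l; [apply Cmod_ge_0|exact HM'].
Qed.

Lemma psum_lin (a b : nat -> C) (c z : C) :
  subexp a -> subexp b -> Cmod z < 1 ->
  psum (fun i => a i + c * b i)%C z = (psum a z + c * psum b z)%C.
Proof.
  intros Ha Hb Hz.
  assert (Hr : 0 <= Cmod z < 1) by (split; [apply Cmod_ge_0|exact Hz]).
  pose proof (Cmod_ge_0 c) as Hc.
  pose proof (subexp_lin a b c Ha Hb) as Hab.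
  apply (is_pseries_unique_eps (fun i => a i + c * b i)%C z);
    [apply is_pseries_psum; assumption|].
  apply is_pseries_eps. intros eps Heps.
  destruct (psum_uniform a (Cmod z) (eps / 2) Ha Hr ltac:(lra)) as [N1 H1].
  destruct (psum_uniform b (Cmod z) (eps / 2 / (Cmod c + 1)) Hb Hr) as [N2 H2];
    [apply Rdiv_lt_0_compat; lra|].
  exists (N1 + N2)%nat. intros N HN.
  specialize (H1 N ltac:(lia) z (Rle_refl _)). specialize (H2 N ltac:(lia) z (Rle_refl _)).
  replace (psum a z + c * psum b z - partial (fun i => a i + c * b i) z N)%C with
    ((psum a z - partial a z N) + c * (psum b z - partial b z N))%C.
  - eapply Rle_trans; [apply Cmod_triangle|]. rewrite Cmod_mult.
    assert (Cmod c * Cmod (psum b z - partial b z N) <= eps / 2).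
    { apply Rle_trans with ((Cmod c + 1) * (eps / 2 / (Cmod c + 1))).
      - apply Rmult_le_compat; try apply Cmod_ge_0; lra.
      - apply Req_le. field. lra. }
    lra.
  - unfold partial.
    rewrite (csum_ext (fun i => (a i + c * b i) * z ^ i)%C
               (fun i => a i * z ^ i + c * (b i * z ^ i))%C) by (intros; ring).
    rewrite csum_plus, csum_scal. ring.
Qed.

Lemma psum_single (c z : C) (N : nat) :
  psum (fun i => if Nat.eqb i N then c else 0) z = (c * z ^ N)%C.
Proof.
  unfold psum.
  assert (S0 : forall u : nat -> R, (forall i, i <> N -> u i = 0) -> Series u = u N).
  { intros u Hu. apply is_series_unique.
    apply (is_lim_seq_spec (sum_n u) (u N)). intros eps. exists N. intros n Hn.
    replace (sum_n u n) with (u N); [rewrite Rminus_diag, Rabs_R0; apply cond_pos|].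
    symmetry. induction n as [|n IH].
    - rewrite sum_O. replace N with O by lia. reflexivity.
    - rewrite sum_Sn. destruct (Nat.eq_dec N (S n)) as [E|E].
      + rewrite <- E. assert (Z : forall m, (m < N)%nat -> sum_n u m = 0).
        { induction m as [|m IHm]; intros Hm.
          - rewrite sum_O. apply Hu. lia.
          - rewrite sum_Sn, IHm, (Hu (S m)) by lia. apply Rplus_0_l. }
        rewrite Z by lia. apply Rplus_0_l.
      + rewrite IH, (Hu (S n)) by lia. apply Rplus_0_r. }
  rewrite !S0.
  - rewrite Nat.eqb_refl. symmetry. apply surjective_pairing.
  - intros i Hi. apply Nat.eqb_neq in Hi. rewrite Hi. rewrite Cmult_0_l. reflexivity.
  - intros i Hi. apply Nat.eqb_neq in Hi. rewrite Hi. rewrite Cmult_0_l. reflexivity.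
Qed.

Lemma psum_scal (b : nat -> C) (c z : C) :
  subexp b -> Cmod z < 1 -> psum (fun i => c * b i)%C z = (c * psum b z)%C.
Proof.
  intros Hb Hz.
  rewrite (psum_ext _ (fun i => (if Nat.eqb i 0 then RtoC 0 else 0) + c * b i)%C).
  - rewrite psum_lin, psum_single by (try assumption; apply (subexp_bounded _ 0); intros i;
      destruct (Nat.eqb i 0); rewrite Cmod_0; lra). ring.
  - intros i. destruct (Nat.eqb i 0); ring.
Qed.

(** A vanishing derivative makes [W] constant along the ray through [z] away from the origin;
    continuity at 0 then identifies the constant. *)
Lemma locally_constant_disk (W : C -> C) (z : C) :
  (forall w, punctured w -> is_Cderive W w 0) ->
  Ccontinuous W (RtoC 0) ->
  unit_disk z -> W z = W 0.
Proof.
  intros HW HC Hz. destruct (Ceq_dec z 0) as [->|Hz0]; [reflexivity|].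
  unfold unit_disk in Hz. pose proof (proj1 (Cmod_gt_0 z) Hz0) as Hm.
  apply Cmod_small_eq. intros eps Heps.
  destruct (continuous_C_eps W 0 HC eps Heps) as (d & Hd & K).
  set (s := Rmin (/ 2) (d / 2)).
  assert (Hs : 0 < s) by (apply Rmin_glb_lt; lra).
  assert (Hs1 : s <= / 2) by apply Rmin_l. assert (Hs2 : s <= d / 2) by apply Rmin_r.
  pose (F := fun t : R => W (t * z)%C).
  assert (D : forall t, s <= t <= 1 -> is_RCderive F t 0).
  { intros t Ht. eapply is_RCderive_eq.
    - apply (is_RCderive_comp W (fun t => t * z)%C).
      + apply HW. unfold punctured. rewrite Cmod_mult, Cmod_R, Rabs_pos_eq by lra.
        split; [apply Rmult_lt_0_compat; lra|nra].
      + apply is_RCderive_mult; [apply is_RCderive_RtoC|apply is_RCderive_const].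
    - ring. }
  assert (E : F s = F 1).
  { apply injective_projections.
    - apply (eq_is_derive (V := R_NormedModule) (fun x => Re (F x))); [|lra].
      intros t Ht. apply D, Ht.
    - apply (eq_is_derive (V := R_NormedModule) (fun x => Im (F x))); [|lra].
      intros t Ht. apply D, Ht. }
  unfold F in E. rewrite Cmult_1_l in E. rewrite <- E. apply Rlt_le, K.
  replace (s * z - 0)%C with (s * z)%C by ring.
  rewrite Cmod_mult, Cmod_R, Rabs_pos_eq by lra. nra.
Qed.

(* Taylor coefficients of [(1 + z^N) / (1 - z^N)]. *)
Definition cayley_coef (N m : nat) : C :=
  match m with O => 1 | S _ => if Nat.eqb (m mod N) 0 then 2 else 0 end.

(** The Toeplitz kernel of (1 + z) / (1 - z): the real part of its half form is |sum u|^2. *)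
Lemma kernel_pos_full (K : nat) :
  kernel_pos K (fun i j => if Nat.eqb j i then 1 else 2).
Proof.
  intros u.
  assert (H : Re (half_form K (fun i j => if Nat.eqb j i then 1 else 2) u)
              = Cmod (csum u K) ^ 2).
  { unfold half_form. induction K as [|K IH].
    - simpl csum. rewrite Cmod_0. simpl. ring.
    - change (csum ?f (S K)) with (csum f K + f K)%C. cbv beta.
      rewrite re_plus, IH.
      change (csum ?f (S K)) with (csum f K + f K)%C. cbv beta. rewrite Nat.eqb_refl.
      rewrite (csum_ext (fun j => _ * Cconj (u K))%C (fun j => (2 * Cconj (u K)) * u j)%C).
      + rewrite csum_scal, !Cmod2_alt. destruct (csum u K), (u K). simpl. ring.
      + intros j Hj. rewrite (proj2 (Nat.eqb_neq j K)) by lia. ring. }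
  rewrite H. apply pow2_ge_0.
Qed.

(** Replacing z by z^N keeps the entries with [i] and [j] congruent modulo [N]. Their indicator is a
    sum of rank-one multipliers, one for each residue class. *)
Lemma cayley_kernel_pos (N K : nat) :
  (1 <= N)%nat -> kernel_pos K (fun i j => cayley_coef N (i - j)).
Proof.
  intros HN.
  pose (x := fun s i => ind (Nat.eqb (i mod N) s)).
  assert (M := multiplier_sum K (fun s i j => x s i * x s j) N
                 (fun s _ => multiplier_rank1 K (x s))).
  specialize (M _ (kernel_pos_full K)).
  intros u. specialize (M u).
  rewrite (half_form_ext _ _ (fun i j => rsum (fun s => x s i * x s j)%R N *
     (if Nat.eqb j i then 1 else 2))%C); [exact M|].
  intros i j Hij.
  assert (E : rsum (fun s => x s i * x s j) N = ind (Nat.eqb (i mod N) (j mod N))).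
  { pose proof (Nat.mod_upper_bound i N ltac:(lia)) as Hi. unfold x.
    generalize dependent (i mod N). generalize (j mod N). intros q p Hp.
    clear - Hp. induction N as [|N IH]; [lia|]. cbn [rsum].
    destruct (Nat.eq_dec p N) as [->|Hne].
    - rewrite Nat.eqb_refl. rewrite (rsum_ext _ (fun _ => 0 + 0 * 0)).
      + rewrite rsum_lin. assert (Z : rsum (fun _ => 0) N = 0) by (clear; induction N; simpl; lra).
        rewrite Z, (Nat.eqb_sym q N). unfold ind. lra.
      + intros s Hs. rewrite (proj2 (Nat.eqb_neq N s)) by lia. unfold ind. ring.
    - rewrite IH by lia. rewrite (proj2 (Nat.eqb_neq p N)) by lia. unfold ind. ring. }
  rewrite E. destruct (Nat.eqb_spec j i) as [->|Hne].
  - rewrite Nat.sub_diag, Nat.eqb_refl. simpl. ring.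
  - unfold cayley_coef. destruct (i - j)%nat eqn:D; [lia|]. rewrite <- D.
    assert (Eq : Nat.eqb ((i - j) mod N) 0 = Nat.eqb (i mod N) (j mod N)).
    { apply Bool.eq_iff_eq_true. rewrite !Nat.eqb_eq. split; intros H.
      - replace i with (j + (i - j))%nat by lia.
        rewrite Nat.Div0.add_mod, H, Nat.add_0_r, Nat.Div0.mod_mod. reflexivity.
      - pose proof (Nat.div_mod_eq i N). pose proof (Nat.div_mod_eq j N).
        replace (i - j)%nat with (0 + (i / N - j / N) * N)%nat by nia.
        rewrite Nat.Div0.mod_add. apply Nat.Div0.mod_0_l. }
    rewrite Eq. destruct (Nat.eqb (i mod N) (j mod N)); simpl; ring.
Qed.

Lemma cayley_coef_shift (N m : nat) :
  (1 <= N)%nat -> (1 <= m)%nat -> cayley_coef N (m + N) = cayley_coef N m.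
Proof.
  intros HN Hm. destruct m as [|m]; [lia|]. simpl Nat.add. unfold cayley_coef.
  replace (S (m + N)) with (S m + 1 * N)%nat by lia. rewrite Nat.Div0.mod_add. reflexivity.
Qed.

Lemma Cmod_cayley_coef (N m : nat) : Cmod (cayley_coef N m) <= 2.
Proof.
  destruct m as [|m]; simpl.
  - rewrite Cmod_1. lra.
  - destruct (Nat.eqb _ _); rewrite Cmod_R, Rabs_pos_eq; lra.
Qed.

Lemma ex_Cderive_pow (z : C) (N : nat) : exists d, is_Cderive (fun w => w ^ N)%C z d.
Proof.
  induction N as [|N [d Hd]].
  - exists (RtoC 0). apply (is_Cderive_const 1).
  - eexists. apply (is_Cderive_mult (fun w => w) (fun w => w ^ N)%C z);
      [apply is_Cderive_id|exact Hd].
Qed.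

Lemma extremal_quotient_analytic (beta : R) (N : nat) :
  (1 <= N)%nat -> analytic_on unit_disk (extremal_quotient beta (S N)).
Proof.
  intros HN z Hz. destruct (ex_Cderive_pow z N) as [d Hd].
  unfold extremal_quotient. replace (S N - 1)%nat with N by lia.
  pose proof (one_minus_pow_neq_0 z N HN Hz) as Hne.
  eexists.
  apply (is_Cderive_mult (fun w => 1 + (1 - 2 * beta) * w ^ N)%C (fun w => / (1 - w ^ N))%C).
  - apply is_Cderive_plus; [apply is_Cderive_const|apply is_Cderive_scal, Hd].
  - apply (is_Cderive_comp Cinv (fun w => 1 - w ^ N)%C); [apply is_Cderive_inv, Hne|].
    apply (is_Cderive_ext_loc (fun w => 1 + -1 * w ^ N)%C _ z _ 1 Rlt_0_1); [intros w _; ring|].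
    apply is_Cderive_plus; [apply is_Cderive_const|apply is_Cderive_scal, Hd].
Qed.

(** * Reciprocal and root of a formal series with constant term 1 *)

Definition truncation (g : nat -> C) (m : nat) : C :=
  match m with O => 0 | S _ => g m end.

(** The formal 1/g by the geometric series in g - 1. The number of terms follows the index, since
    higher powers vanish there; any longer common cut-off gives the same coefficient. *)
Definition reciprocal_series (g : nat -> C) (i : nat) : C :=
  csum (fun m => (- (1)) ^ m * power_series_pow (truncation g) m i)%C (S i).

Definition binomial_series (c : R) (g : nat -> C) (i : nat) : C :=
  csum (fun m => gbinom c m * power_series_pow (truncation g) m i)%C (S i).

Lemma csum_power_stable (c : nat -> C) (x : nat -> C) (i K : nat) :
  x O = 0 -> (i <= K)%nat ->
  csum (fun m => c m * power_series_pow x m i)%C (S K) =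
  csum (fun m => c m * power_series_pow x m i)%C (S i).
Proof.
  intros Hx Hi. induction K as [|K IH].
  - replace i with O by lia. reflexivity.
  - destruct (Nat.eq_dec i (S K)) as [->|Hne]; [reflexivity|].
    rewrite <- IH by lia. cbn [csum].
    rewrite (power_series_pow_low x (S K)) by (assumption || lia). ring.
Qed.

Lemma unit_plus_truncation (g : nat -> C) (m : nat) :
  g O = 1 -> g m = (unit_series m + truncation g m)%C.
Proof. intros Hg. destruct m as [|m]; simpl; [rewrite Hg|]; ring. Qed.

Lemma reciprocal_series_eq (g : nat -> C) (k : nat) :
  reciprocal_series g k =
  (unit_series k - conv (truncation g) (reciprocal_series g) k)%C.
Proof.
  assert (Hx : truncation g O = 0) by reflexivity.
  assert (E : forall i, (i <= k)%nat -> reciprocal_series g i =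
    csum (fun m => (- (1)) ^ m * power_series_pow (truncation g) m i)%C (S k)).
  { intros i Hi. unfold reciprocal_series. symmetry.
    apply (csum_power_stable (fun m => (- (1)) ^ m)%C); assumption. }
  rewrite E by lia.
  rewrite (conv_ext (truncation g) (truncation g) (reciprocal_series g)
    (fun j => csum (fun m => (- (1)) ^ m * power_series_pow (truncation g) m j)%C (S k)))
    by (try reflexivity; exact E).
  rewrite (resolvent_series (truncation g) 1 k k Hx (le_n k)). ring.
Qed.

Lemma conv_reciprocal_series (g : nat -> C) (k : nat) :
  g O = 1 -> conv g (reciprocal_series g) k = unit_series k.
Proof.
  intros Hg.
  rewrite (conv_ext g (fun i => unit_series i + truncation g i)%C _ (reciprocal_series g))
    by (try reflexivity; intros; apply unit_plus_truncation, Hg).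
  rewrite conv_plus_l, conv_unit_l, reciprocal_series_eq. ring.
Qed.

Lemma binomial_series_recurrence (alpha : R) (g : nat -> C) (k : nat) :
  alpha <> 0 -> g O = 1 ->
  (alpha * conv g (theta (binomial_series (/ alpha) g)) k)%C =
  conv (binomial_series (/ alpha) g) (theta g) k.
Proof.
  intros Ha Hg. set (x := truncation g).
  assert (Hx : x O = 0) by reflexivity.
  pose (H := fun j => csum (fun m => gbinom (/ alpha) m * power_series_pow x m j)%C (S k)).
  assert (E : forall i, (i <= k)%nat -> binomial_series (/ alpha) g i = H i).
  { intros i Hi. unfold binomial_series, H. symmetry.
    apply (csum_power_stable (fun m => RtoC (gbinom (/ alpha) m))); assumption. }
  rewrite (conv_ext g (fun i => unit_series i + x i)%C _ (theta H)).
  2:{ intros; apply unit_plus_truncation, Hg. }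
  2:{ intros i Hi. unfold theta. rewrite E by exact Hi. reflexivity. }
  rewrite (conv_ext (binomial_series (/ alpha) g) H (theta g) (theta x)).
  2:{ exact E. }
  2:{ intros [|i] Hi; unfold theta, x; simpl INR; simpl truncation; [ring|reflexivity]. }
  rewrite conv_plus_l, conv_unit_l.
  pose proof (binomial_series_theta x (/ alpha) k k Hx (le_n k)) as B. cbv zeta in B.
  fold H in B. rewrite B, Cmult_assoc, <- RtoC_mult, Rinv_r by exact Ha. ring.
Qed.

(** * Construction of the extremal function *)

Section Extremal.
Variables (n N : nat) (alpha beta : R).
Hypothesis Hbeta : 0 <= beta < 1.
Hypothesis Halpha : 1 < alpha.
Hypothesis HN : (1 <= N)%nat.

(* Coefficients of [(1 + theta / alpha)^j G], where [G = (f / z)^alpha]. *)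
Let g_ (j m : nat) : C :=
  match m with
  | O => 1
  | S _ => ((1 - beta) * wt alpha n m * (1 + INR m / alpha) ^ j)%R * cayley_coef N m
  end%C.

Let g := g_ 0.
Let r := reciprocal_series g.
Let h := binomial_series (/ alpha) g.
(** The coefficients of log(g) / alpha, obtained by integrating theta g / g. At [m = 0] the inverse
    of 0 meets a vanishing convolution, so the constant term is 0 as required. *)
Let lam (m : nat) : C := (/ (alpha * INR m) * conv (theta g) r m)%C.

Let g_S (m : nat) : (1 <= m)%nat ->
  g m = (((1 - beta) * wt alpha n m)%R * cayley_coef N m)%C.
Proof.
  intros Hm. destruct m as [|m]; [lia|].
  unfold g, g_. rewrite pow_O, Rmult_1_r. reflexivity.
Qed.

Let g_step (j m : nat) : g_ (S j) m = (g_ j m + / alpha * theta (g_ j) m)%C.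
Proof.
  assert (Ha : RtoC alpha <> 0) by (apply RtoC_neq_0; lra).
  destruct m as [|m].
  - unfold theta, g_. simpl INR. ring.
  - unfold theta, g_. rewrite <- tech_pow_Rmult, !RtoC_mult, RtoC_plus, RtoC_div by lra.
    field. exact Ha.
Qed.

Let subexp_g_ (j : nat) : subexp (g_ j).
Proof.
  induction j as [|j IH].
  - apply (subexp_bounded _ 2). intros [|m]; [simpl; rewrite Cmod_1; lra|].
    change (g_ 0 (S m)) with (g (S m)). rewrite g_S by lia.
    pose proof (wt_pos alpha n (S m) ltac:(lra)).
    pose proof (wt_le_1 alpha n (S m) ltac:(lra)).
    rewrite Cmod_mult, Cmod_R, Rabs_pos_eq by (apply Rmult_le_pos; lra).
    apply Rle_trans with (1 * 2); [|lra].
    apply Rmult_le_compat; [apply Rmult_le_pos; lra|apply Cmod_ge_0|nra|].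
    apply Cmod_cayley_coef.
  - apply (subexp_le (fun m => g_ j m + / alpha * theta (g_ j) m)%C).
    + apply subexp_lin; [exact IH|apply subexp_theta, IH].
    + intros m. rewrite g_step. apply Rle_refl.
Qed.

(** Bounded coefficients make 1/g converge on the whole disk. Hence [g] has no zero there, and its
    logarithm exists. *)
Let r_bound (k : nat) : Cmod (r k) <= 2.
Proof.
  destruct k as [|k].
  { unfold r, reciprocal_series. simpl. replace (0 + 1 * 1)%C with (RtoC 1) by ring.
    rewrite Cmod_1. lra. }
  apply Rle_trans with (2 * (1 - beta) * wt alpha n (S k)).
  - apply (reciprocal_bound alpha (1 - beta) n (S k) (cayley_coef N) r);
      try lra; try lia; try reflexivity.
    + apply cayley_kernel_pos, HN.
    + unfold r, reciprocal_series. simpl. ring.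
    + intros i Hi. unfold r at 1. rewrite reciprocal_series_eq. fold r.
      destruct i as [|i]; [lia|]. rewrite conv_comm. unfold conv.
      change (csum ?F (S (S i))) with (csum F (S i) + F (S i))%C. cbv beta.
      rewrite Nat.sub_diag. change (truncation g 0) with (RtoC 0).
      change (unit_series (S i)) with (RtoC 0).
      rewrite Cmult_0_r, Cplus_0_r. unfold Cminus. rewrite Cplus_0_l. f_equal.
      apply csum_ext. intros j Hj. rewrite <- g_S by lia.
      destruct (S i - j)%nat eqn:D; [lia|]. change (truncation g (S n0)) with (g (S n0)). ring.
  - pose proof (wt_pos alpha n (S k) ltac:(lra)).
    pose proof (wt_le_1 alpha n (S k) ltac:(lra)). nra.
Qed.

Let h_O : h O = 1.
Proof. unfold h, binomial_series. simpl. ring. Qed.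

Let h_rec (k : nat) : (alpha * conv g (theta h) k)%C = conv h (theta g) k.
Proof. apply binomial_series_recurrence; [lra|reflexivity]. Qed.

(** The coefficient bound is applied to the formal root before any function is available; it makes
    the series of g^(1/alpha) = f/z converge. *)
Let h_bound (k : nat) : Cmod (h k) <= 2.
Proof.
  destruct k as [|k]; [rewrite h_O, Cmod_1; lra|].
  apply Rle_trans with (2 * (1 - beta) * wt alpha n (S k) / alpha).
  - apply (root_coefficient_bound alpha beta n (S k) (cayley_coef N) g h);
      try assumption; try lia; try reflexivity.
    + apply cayley_kernel_pos, HN.
    + intros m Hm. apply g_S. lia.
    + intros m _. apply h_rec.
  - pose proof (wt_pos alpha n (S k) ltac:(lra)).
    pose proof (wt_le_1 alpha n (S k) ltac:(lra)).
    apply Rmult_le_reg_r with alpha; [lra|]. unfold Rdiv.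
    rewrite Rmult_assoc, Rinv_l by lra. nra.
Qed.

Let subexp_g : subexp g := subexp_g_ 0.
Let subexp_r : subexp r := subexp_bounded r 2 r_bound.
Let subexp_h : subexp h := subexp_bounded h 2 h_bound.

Let theta_lam (m : nat) : theta lam m = (/ alpha * conv (theta g) r m)%C.
Proof.
  assert (Ha : RtoC alpha <> 0) by (apply RtoC_neq_0; lra).
  unfold theta, lam. destruct m as [|m].
  - unfold conv. simpl. ring.
  - assert (RtoC (INR (S m)) <> 0).
    { intros K. apply RtoC_inj in K. revert K. apply not_0_INR. lia. }
    fold (theta g). field. split; assumption.
Qed.

Let subexp_lam : subexp lam.
Proof.
  apply (subexp_le (conv (theta g) r)).
  - apply subexp_conv; [apply subexp_theta, subexp_g|exact subexp_r].
  - intros [|m].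
    + unfold lam, conv. simpl. unfold theta. simpl INR.
      replace (_ * (0 + _))%C with (RtoC 0) by ring. rewrite Cmod_0. apply Cmod_ge_0.
    + unfold lam. rewrite Cmod_mult, <- RtoC_mult.
      assert (H1 : 1 <= INR (S m)) by (rewrite S_INR; pose proof (pos_INR m); lra).
      assert (H : 1 <= alpha * INR (S m)) by nra.
      rewrite <- RtoC_inv, Cmod_R, Rabs_pos_eq by (try apply Rlt_le, Rinv_0_lt_compat; lra).
      rewrite <- (Rmult_1_l (Cmod (conv (theta g) r (S m)))) at 2.
      apply Rmult_le_compat_r; [apply Cmod_ge_0|].
      rewrite <- Rinv_1. apply Rinv_le_contravar; lra.
Qed.

Let l : C -> C := psum lam.

Let l_0 : l 0 = 0.
Proof.
  unfold l. rewrite (psum_0 lam subexp_lam). unfold lam, conv. simpl. unfold theta. simpl INR. ring.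
Qed.

Let psum_r (z : C) : unit_disk z -> (psum g z * psum r z)%C = 1.
Proof.
  intros Hz. rewrite <- psum_conv by (assumption || apply subexp_g || apply subexp_r).
  rewrite (psum_ext _ (fun i => if Nat.eqb i 0 then RtoC 1 else 0)).
  - rewrite psum_single. simpl. ring.
  - intros i. unfold r. rewrite conv_reciprocal_series by reflexivity.
    destruct i; reflexivity.
Qed.

Let psum_theta_lam (z : C) : unit_disk z ->
  (alpha * psum (theta lam) z)%C = (psum (theta g) z * psum r z)%C.
Proof.
  intros Hz. assert (Ha : RtoC alpha <> 0) by (apply RtoC_neq_0; lra).
  pose proof (subexp_theta g subexp_g) as Htg.
  rewrite <- psum_conv by (assumption || apply subexp_r).
  rewrite <- psum_scal by ((apply subexp_theta, subexp_lam) || exact Hz).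
  apply psum_ext. intros i. rewrite theta_lam. field. exact Ha.
Qed.

Let psum_theta_h (z : C) : unit_disk z ->
  psum (theta h) z = (psum h z * psum (theta lam) z)%C.
Proof.
  intros Hz. assert (Ha : RtoC alpha <> 0) by (apply RtoC_neq_0; lra).
  pose proof (subexp_theta g subexp_g) as Htg. pose proof (subexp_theta h subexp_h) as Hth.
  assert (E : (alpha * (psum g z * psum (theta h) z))%C = (psum h z * psum (theta g) z)%C).
  { rewrite <- !psum_conv by (assumption || apply subexp_g || apply subexp_h).
    rewrite <- psum_scal by ((apply subexp_conv; assumption) || exact Hz).
    apply psum_ext, h_rec. }
  transitivity (/ alpha * (alpha * psum (theta h) z * (psum g z * psum r z)))%C.
  - rewrite psum_r by exact Hz. field. exact Ha.
  - transitivity (/ alpha * ((alpha * (psum g z * psum (theta h) z)) * psum r z))%C; [ring|].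
    rewrite E. transitivity (/ alpha * psum h z * (psum (theta g) z * psum r z))%C; [ring|].
    rewrite <- psum_theta_lam by exact Hz. field. exact Ha.
Qed.

(* [u Cexp (- c l)] is constant as soon as [theta u = c u theta l]. *)
Let psum_eq_exp (u : nat -> C) (c : R) (z : C) :
  subexp u -> u O = 1 ->
  (forall w, unit_disk w -> psum (theta u) w = (c * psum (theta lam) w * psum u w)%C) ->
  unit_disk z -> psum u z = Cexp (c * l z).
Proof.
  intros Hu Hu0 H Hz.
  pose (W := fun w => (psum u w * Cexp (- c * l w))%C).
  assert (EW : W z = W 0).
  { apply locally_constant_disk; [| |exact Hz].
    - intros w Hw. assert (Hw0 : w <> 0) by (apply Cmod_gt_0, Hw). eapply is_Cderive_eq.
      + apply is_Cderive_mult.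
        * apply is_Cderive_psum_theta; [exact Hu|apply Hw|exact Hw0].
        * apply (is_Cderive_comp Cexp (fun w => - c * l w)%C); [apply is_Cderive_Cexp|].
          apply is_Cderive_scal, is_Cderive_psum_theta; [apply subexp_lam|apply Hw|exact Hw0].
      + cbv beta. rewrite H by apply Hw. field. exact Hw0.
    - assert (D0 : Cmod 0 < 1) by (rewrite Cmod_0; lra).
      eapply is_Cderive_continuity. apply is_Cderive_mult.
      + apply (is_Cderive_psum u 0 Hu D0).
      + apply (is_Cderive_comp Cexp (fun w => - c * l w)%C); [apply is_Cderive_Cexp|].
        apply is_Cderive_scal, (is_Cderive_psum lam 0 subexp_lam D0). }
  assert (E1 : W 0 = 1).
  { unfold W. rewrite (psum_0 u Hu), Hu0, l_0.
    replace (- c * 0)%C with (RtoC 0) by ring. rewrite Cexp_0. ring. }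
  rewrite E1 in EW. unfold W in EW.
  transitivity (psum u z * (Cexp (- c * l z) * Cexp (c * l z)))%C.
  - rewrite <- Cexp_plus. replace (- c * l z + c * l z)%C with (RtoC 0) by ring.
    rewrite Cexp_0. ring.
  - rewrite Cmult_assoc, EW. ring.
Qed.

Let psum_g (z : C) : unit_disk z -> psum g z = Cexp (alpha * l z).
Proof.
  intros Hz. apply psum_eq_exp; [apply subexp_g|reflexivity| |exact Hz].
  intros w Hw. rewrite psum_theta_lam by exact Hw.
  transitivity (psum (theta g) w * (psum g w * psum r w))%C; [|ring].
  rewrite psum_r by exact Hw. ring.
Qed.

Let psum_h (z : C) : unit_disk z -> psum h z = Cexp (l z).
Proof.
  intros Hz. replace (l z) with (1%R * l z)%C by ring.
  apply psum_eq_exp; [apply subexp_h|exact h_O| |exact Hz].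
  intros w Hw. rewrite psum_theta_h by exact Hw. ring.
Qed.

Let f (z : C) : C := (z * Cexp (l z))%C.

Let f_log_branch : log_branch f l.
Proof.
  split; [|split; [exact l_0|reflexivity]].
  intros z Hz. eexists. apply (is_Cderive_psum lam z subexp_lam Hz).
Qed.

Let f_class_A : class_A f.
Proof.
  split.
  - intros z Hz. eexists. apply (is_Cderive_mult (fun w => w) (fun w => Cexp (l w))).
    + apply is_Cderive_id.
    + apply (is_Cderive_comp Cexp l); [apply is_Cderive_Cexp|].
      apply (is_Cderive_psum lam z subexp_lam Hz).
  - exists (series_shift h). split; [reflexivity|]. split; [exact h_O|].
    intros z Hz. unfold f. rewrite <- psum_h by exact Hz.
    apply is_pseries_shift; [apply subexp_h|exact Hz].
Qed.

Let f_salagean (j : nat) (z : C) : slit_disk z ->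
  salagean j (fpow l alpha) z = (RtoC alpha ^ j * Cpowr z alpha * psum (g_ j) z)%C.
Proof.
  revert z. induction j as [|j IH]; intros z Hz.
  - change (psum (g_ 0) z) with (psum g z). rewrite psum_g by apply Hz.
    unfold fpow. simpl. ring.
  - rewrite (salagean_step alpha j (fpow l alpha) (psum (g_ j)) (psum (theta (g_ j)))
      ltac:(lra) IH); [| |exact Hz].
    2:{ intros w Hw. apply is_Cderive_psum_theta;
          [apply subexp_g_|apply Hw|apply Cmod_gt_0, Hw]. }
    f_equal. rewrite <- psum_lin by
      (apply subexp_g_ || apply subexp_theta, subexp_g_ || apply Hz).
    apply psum_ext. intros i. symmetry. apply g_step.
Qed.

(** For [j = n] the powers of 1 + m/alpha cancel the weights, leaving 1 - beta times the Cayley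
    coefficients. Multiplication by 1 - z^N then makes the series finite. *)
Let psum_g_n (z : C) : unit_disk z -> psum (g_ n) z = extremal_quotient beta (S N) z.
Proof.
  intros Hz. unfold extremal_quotient. replace (S N - 1)%nat with N by lia.
  pose proof (one_minus_pow_neq_0 z N HN Hz) as Hne.
  assert (Hgn : forall m, (1 <= m)%nat -> g_ n m = ((1 - beta)%R * cayley_coef N m)%C).
  { intros m Hm. unfold g_. destruct m as [|m]; [lia|].
    rewrite INR_IZR_INZ, wt_inv by lra.
    pose proof (wt_pos alpha n (S m) ltac:(lra)).
    f_equal. f_equal. field. lra. }
  (* [d] and [e] are the denominator and the numerator of the quotient, as series. *)
  pose (d := fun i => (unit_series i + - (1) * (if Nat.eqb i N then RtoC 1 else 0))%C).
  pose (e := fun i => ((if Nat.eqb i 0 then RtoC 1 else 0)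
                       + (1 - 2 * beta) * (if Nat.eqb i N then RtoC 1 else 0))%C).
  assert (Hsing : forall M (c : C), subexp (fun i => if Nat.eqb i M then c else 0)).
  { intros M c. apply (subexp_bounded _ (Cmod c)). intros i.
    destruct (Nat.eqb i M); [lra|rewrite Cmod_0; apply Cmod_ge_0]. }
  assert (Hunit : subexp unit_series).
  { apply (subexp_bounded _ 1). intros [|i]; simpl; [rewrite Cmod_1|rewrite Cmod_0]; lra. }
  assert (Hd : subexp d).
  { apply (subexp_bounded _ 2). intros i. unfold d.
    eapply Rle_trans; [apply Cmod_triangle|]. rewrite Cmod_mult, Cmod_opp, Cmod_1.
    apply Rle_trans with (1 + 1); [|lra]. apply Rplus_le_compat.
    - destruct i; simpl; [rewrite Cmod_1|rewrite Cmod_0]; lra.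
    - destruct (Nat.eqb i N); [rewrite Cmod_1|rewrite Cmod_0]; lra. }
  assert (Pd : psum d z = (1 - z ^ N)%C).
  { unfold d. rewrite psum_lin by (apply Hunit || apply Hsing || apply Hz).
    rewrite psum_single, (psum_ext unit_series (fun i => if Nat.eqb i 0 then RtoC 1 else 0))
      by (intros [|i]; reflexivity).
    rewrite psum_single. simpl. ring. }
  assert (Pe : psum e z = (1 + (1 - 2 * beta) * z ^ N)%C).
  { unfold e. rewrite psum_lin by (apply Hsing || apply Hz).
    rewrite !psum_single. simpl. ring. }
  assert (E : forall m, conv d (g_ n) m = e m).
  { intros m. unfold d. rewrite conv_plus_l, conv_unit_l, conv_scal_l.
    assert (Dl : conv (fun i => if Nat.eqb i N then RtoC 1 else 0) (g_ n) m =
      if Nat.leb N m then g_ n (m - N) else 0).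
    { unfold conv. destruct (Nat.leb_spec N m).
      - rewrite (csum_single _ _ N); [rewrite Nat.eqb_refl; ring|lia|].
        intros i _ Hi. apply Nat.eqb_neq in Hi. rewrite Hi. ring.
      - apply csum_0. intros i Hi. rewrite (proj2 (Nat.eqb_neq i N)) by lia. ring. }
    rewrite Dl. unfold e. destruct (Nat.leb_spec N m).
    - rewrite (proj2 (Nat.eqb_neq m 0)) by lia.
      destruct (Nat.eqb_spec m N) as [->|Hmn].
      (* At [m = N] the periodicity fails: the constant term is 1 instead of 2 (1 - beta), and the
         difference is the coefficient 1 - 2 beta of the numerator. *)
      + rewrite Nat.sub_diag, Hgn by lia. unfold cayley_coef.
        destruct N as [|N']; [lia|]. rewrite Nat.Div0.mod_same. simpl Nat.eqb.
        change (g_ n 0) with (RtoC 1). rewrite RtoC_minus. ring.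
      + rewrite !Hgn by lia. replace m with ((m - N) + N)%nat at 1 by lia.
        rewrite cayley_coef_shift by lia. ring.
    - rewrite (proj2 (Nat.eqb_neq m N)) by lia. destruct m as [|m].
      + change (g_ n 0) with (RtoC 1). simpl. ring.
      + rewrite Hgn by lia. unfold cayley_coef. rewrite Nat.mod_small by lia.
        simpl. ring. }
  assert (P : ((1 - z ^ N) * psum (g_ n) z)%C = (1 + (1 - 2 * beta) * z ^ N)%C).
  { rewrite <- Pd, <- Pe, <- psum_conv by (apply Hd || apply subexp_g_ || apply Hz).
    apply psum_ext, E. }
  rewrite <- P. field. exact Hne.
Qed.

Lemma extremal_exists :
  exists F : C -> C,
    class_A F /\ salagean_quotient n alpha F (extremal_quotient beta (S N)).
Proof.
  exists f. split; [apply f_class_A|]. split; [apply extremal_quotient_analytic, HN|].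
  split.
  - unfold extremal_quotient. replace (S N - 1)%nat with N by lia.
    destruct N as [|N']; [lia|]. simpl. field.
  - exists l. split; [apply f_log_branch|]. intros z Hz.
    rewrite f_salagean, psum_g_n by (exact Hz || apply Hz).
    field. split; [apply Cpowr_neq_0|]. apply Cpow_nz.
    intros K. apply RtoC_inj in K. lra.
Qed.

End Extremal.

(** Sharpness separates the existence of a function with the prescribed quotient from the equality,
    which is shown for every such function together with its membership in the class. *)
Theorem theorem3 :
  forall (n : nat) (alpha beta : R),
    0 <= beta < 1 -> 1 < alpha ->
    (forall (f : C -> C) (a : nat -> C),
       class_T n alpha beta f -> has_expansion f a ->
       forall k : nat, (2 <= k)%nat -> Cmod (a k) <= coeff_bound n alpha beta k)
    /\
    (forall k : nat, (2 <= k)%nat ->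
       (exists f : C -> C,
          class_A f /\ salagean_quotient n alpha f (extremal_quotient beta k)) /\
       (forall (f : C -> C) (a : nat -> C),
          class_A f -> salagean_quotient n alpha f (extremal_quotient beta k) ->
          has_expansion f a ->
          class_T n alpha beta f /\ Cmod (a k) = coeff_bound n alpha beta k)).
Proof.
  intros n alpha beta Hb Ha. split.
  - intros f a HT Hf [|k] Hk; [lia|].
    apply (class_T_coeff_bound n alpha beta f); try assumption. lia.
  - intros [|N] Hk; [lia|]. assert (HN : (1 <= N)%nat) by lia. split.
    + apply extremal_exists; assumption.
    + intros f a HA HQ Hf. split.
      * split; [exact HA|]. exists (extremal_quotient beta (S N)). split; [exact HQ|].
        intros z Hz. apply extremal_quotient_Re; [lra|exact HN|exact Hz].
      * apply (extremal_coeff n N alpha beta f); assumption.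
Qed.
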